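(* For generic values of the complex parameters $\{\alpha_0,\alpha_1,\alpha_2,\alpha_\infty,\nu,\eta\}$, the Hamiltonian system $\mathcal{H}_2(1112)$ has the following eight meromorphic solutions $(q_1,q_2,p_1,p_2)$ around $(t_1=1/s_1,\,s_2)=(0,0)$: (1) $q_1=\frac{\eta}{\alpha_\infty}+\langle t_1,s_2\rangle$, $\ q_2=\frac{\alpha_\infty+\alpha_1}{\alpha_\infty}+\langle t_1,s_2\rangle$, $\ p_1=\frac{(\alpha_\infty+\alpha_1)(\nu+\alpha_2)}{\alpha_\infty(1-\alpha_\infty-\alpha_1)}t_1s_2+\langle t_1^3,t_1^2s_2,s_2^2\rangle$, $\ p_2=\frac{-\nu\alpha_\infty}{\alpha_\infty+\alpha_1}+\langle t_1,s_2\rangle$; (2) $q_1=\frac{-\eta}{\alpha_\infty}+\langle t_1,s_2\rangle$, $\ q_2=\frac{\alpha_\infty-\alpha_1}{\alpha_\infty}+\langle t_1,s_2\rangle$, $\ p_1=\frac{(\alpha_\infty-\alpha_1)(\nu+\alpha_2+\alpha_\infty)}{\alpha_\infty(1+\alpha_\infty-\alpha_1)}t_1s_2+\langle t_1^3,t_1^2s_2,s_2^2\rangle$, $\ p_2=\frac{-(\alpha_\infty+\nu)}{\alpha_\infty-\alpha_1}\alpha_\infty+\langle t_1,s_2\rangle$; (3) $q_1=\frac{-\eta}{\alpha_1}+\langle t_1,s_2\rangle$, $\ q_2=s_2\left(\frac{\alpha_2}{\alpha_0+\alpha_2}+\langle t_1,s_2\rangle\right)$, $\ p_1=\frac{\nu(\nu+\alpha_\infty)}{1-\alpha_1}t_1+\langle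 s_2,t_1^2\rangle$, $\ p_2=\frac{1}{s_2}\left(\frac{\nu(\nu+\alpha_\infty)}{1-\alpha_0-\alpha_2}s_2+\langle t_1^2,t_1s_2,s_2^2\rangle\right)$; (4) $q_1=\frac{-\eta}{\alpha_1}+\langle t_1,s_2\rangle$, $\ q_2=s_2\left(\frac{\alpha_2}{\alpha_2-\alpha_0}+\langle t_1,s_2\rangle\right)$, $\ p_1=\frac{(\nu+\alpha_2)(\nu+\alpha_2+\alpha_\infty)}{1-\alpha_1}t_1+\langle s_2,t_1^2\rangle$, $\ p_2=\frac{1}{s_2}\left(\alpha_0-\alpha_2+\langle t_1,s_2\rangle\right)$; (5) $q_1=\frac{1}{t_1}\left(\frac{\alpha_\infty+\alpha_0+\alpha_2}{\alpha_\infty}+\langle t_1,s_2\rangle\right)$, $\ q_2=\frac{-\alpha_2}{\alpha_\infty}s_2+\langle t_1^2,t_1s_2,s_2^2\rangle$, $\ p_1=t_1\left(\frac{-\nu\alpha_\infty}{\alpha_\infty+\alpha_0+\alpha_2}+\langle t_1,s_2\rangle\right)$, $\ p_2=\frac{\eta\nu\alpha_\infty t_1}{(\alpha_1+2\nu)(\alpha_\infty+\alpha_0+\alpha_2)}+\langle s_2,t_1^2\rangle$; (6) $q_1=\frac{1}{t_1}\left(\frac{\alpha_\infty-\alpha_0-\alpha_2}{\alpha_\infty}+\langle t_1,s_2\rangle\right)$, $\ q_2=\frac{\alpha_2}{\alpha_\infty}s_2+\langle t_1^2,t_1s_2,s_2^2\rangle$, $\ p_1=t_1\left(\frac{-(\nu+\alpha_\infty)\alpha_\infty}{\alpha_\infty-\alpha_0-\alpha_2}+\langle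 t_1,s_2\rangle\right)$, $\ p_2=\frac{\eta\alpha_\infty(\nu+\alpha_\infty)t_1}{(\alpha_\infty-\alpha_0-\alpha_2)(1-\alpha_\infty+\alpha_0+\alpha_2)}+\langle s_2,t_1^2\rangle$; (7) $q_1=\frac{1}{t_1}\left(\frac{\alpha_\infty+\alpha_0-\alpha_2}{\alpha_\infty}+\langle t_1,s_2\rangle\right)$, $\ q_2=s_2\left(\frac{\alpha_2}{\alpha_\infty}+\langle t_1,s_2\rangle\right)$, $\ p_1=t_1\left(\frac{-(\nu+\alpha_2)\alpha_\infty}{\alpha_\infty+\alpha_0-\alpha_2}+\langle t_1,s_2\rangle\right)$, $\ p_2=\frac{1}{s_2}\left(\alpha_\infty+\langle t_1,s_2\rangle\right)$; (8) $q_1=\frac{1}{t_1}\left(\frac{\alpha_\infty-\alpha_0+\alpha_2}{\alpha_\infty}+\langle t_1,s_2\rangle\right)$, $\ q_2=s_2\left(\frac{-\alpha_2}{\alpha_\infty}+\langle t_1,s_2\rangle\right)$, $\ p_1=t_1\left(\frac{-(\nu+\alpha_2+\alpha_\infty)\alpha_\infty}{\alpha_\infty-\alpha_0+\alpha_2}+\langle t_1,s_2\rangle\right)$, $\ p_2=\frac{1}{s_2}\left(-\alpha_\infty+\langle t_1,s_2\rangle\right)$.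
   Context: Parameters: $\alpha_0,\alpha_1,\alpha_2,\alpha_\infty,\nu\in\mathbb{C}$ and $\eta\in\mathbb{C}\setminus\{0\}$ with $\alpha_0+\alpha_1+\alpha_2+\alpha_\infty=1-2\nu$. ''Generic'' means that none of $\alpha_1$, $\alpha_\infty$, $\alpha_1\pm\alpha_\infty$, $\alpha_0\pm\alpha_2$, $\alpha_0\pm\alpha_2\pm\alpha_\infty$ (all sign choices) is an integer. Hamiltonians $H_1,H_2$ (functions of $q_1,q_2,p_1,p_2,s_1,s_2$): $$s_1^2H_1=q_1^2(q_1-s_1)p_1^2+2q_1^2q_2p_1p_2+q_1q_2(q_2-s_2)p_2^2-\bigl[(\alpha_0+\alpha_2-1)q_1^2+\alpha_1q_1(q_1-s_1)+\eta(q_1-s_1)+\eta s_1q_2\bigr]p_1$$ $$\qquad-\bigl[(\alpha_0+\alpha_1-1)q_1q_2+\alpha_2q_1(q_2-s_2)-\eta(s_2-1)q_2\bigr]p_2+\nu(\nu+\alpha_\infty)q_1,$$ $$s_2(s_2-1)H_2=q_1^2q_2p_1^2+2q_1q_2(q_2-s_2)p_1p_2+\Bigl[q_2(q_2-1)(q_2-s_2)+\tfrac{s_2(s_2-1)}{s_1}q_1q_2\Bigr]p_2^2$$ $$\qquad-\bigl[(\alpha_0+\alpha_1-1)q_1q_2+\alpha_2q_1(q_2-s_2)-\eta(s_2-1)q_2\bigr]p_1$$ $$\qquad-\Bigl[(\alpha_0-1)q_2(q_2-1)+\alpha_1q_2(q_2-s_2)+\alpha_2(q_2-1)(q_2-s_2)+\tfrac{s_2(s_2-1)}{s_1}(\alpha_2q_1+\eta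 q_2)\Bigr]p_2+\nu(\nu+\alpha_\infty)q_2.$$ The Hamiltonian system $\mathcal{H}_2(1112)$, with independent variables $t_1=1/s_1$ and $s_2$, is, for $i=1,2$, $$-t_1\frac{\partial q_i}{\partial t_1}=s_1\frac{\partial H_1}{\partial p_i},\quad t_1\frac{\partial p_i}{\partial t_1}=s_1\frac{\partial H_1}{\partial q_i},\quad \frac{\partial q_i}{\partial s_2}=\frac{\partial H_2}{\partial p_i},\quad -\frac{\partial p_i}{\partial s_2}=\frac{\partial H_2}{\partial q_i}.$$ Notation: $R=\mathbb{C}\{\{t_1,s_2\}\}$ is the ring of convergent power series in $t_1,s_2$ around the origin. For $u_1,\dots,u_n\in R$, $\langle u_1,\dots,u_n\rangle$ is the ideal of $R$ generated by $u_1,\dots,u_n$; an expression ''$a+\langle u_1,\dots,u_n\rangle$'' means $a$ plus some element of that ideal.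
   Formalization: Misprints corrected: t1·s2 coefficient of p1 is −να∞(ν+α2)/((α∞+α1)(1−α∞−α1)) in (1), −(α∞+ν)α∞(ν+α2+α∞)/((α∞−α1)(1+α∞−α1)) in (2); s2·p2 has constant α2−α0 in (4); in (6) p2 has factor 1+α∞−α0−α2, not 1−α∞+α0+α2. *)

(* Defs.v *)
(* Stdlib reals + Coquelicot (complex numbers, series, complex derivatives). *)
From Stdlib Require Import Reals List.
From Coquelicot Require Import Coquelicot.
Import ListNotations.
Open Scope C_scope.

Definition is_int (z : C) : Prop := exists k : Z, z = RtoC (IZR k).

Definition generic (alpha0 alpha1 alpha2 alphaoo : C) : Prop :=
  ~ is_int alpha1 /\ ~ is_int alphaoo /\
  ~ is_int (alpha1 + alphaoo) /\ ~ is_int (alpha1 - alphaoo) /\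
  ~ is_int (alpha0 + alpha2) /\ ~ is_int (alpha0 - alpha2) /\
  ~ is_int (alpha0 + alpha2 + alphaoo) /\
  ~ is_int (alpha0 + alpha2 - alphaoo) /\
  ~ is_int (alpha0 - alpha2 + alphaoo) /\
  ~ is_int (alpha0 - alpha2 - alphaoo).

Definition H1 (alpha0 alpha1 alpha2 alphaoo nu eta : C)
    (q1 q2 p1 p2 s1 s2 : C) : C :=
  ( q1 ^ 2 * (q1 - s1) * p1 ^ 2 + 2 * q1 ^ 2 * q2 * p1 * p2
    + q1 * q2 * (q2 - s2) * p2 ^ 2
    - ( (alpha0 + alpha2 - 1) * q1 ^ 2 + alpha1 * q1 * (q1 - s1)
        + eta * (q1 - s1) + eta * s1 * q2 ) * p1
    - ( (alpha0 + alpha1 - 1) * q1 * q2 + alpha2 * q1 * (q2 - s2)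
        - eta * (s2 - 1) * q2 ) * p2
    + nu * (nu + alphaoo) * q1 ) / s1 ^ 2.

Definition H2 (alpha0 alpha1 alpha2 alphaoo nu eta : C)
    (q1 q2 p1 p2 s1 s2 : C) : C :=
  ( q1 ^ 2 * q2 * p1 ^ 2 + 2 * q1 * q2 * (q2 - s2) * p1 * p2
    + ( q2 * (q2 - 1) * (q2 - s2)
        + s2 * (s2 - 1) / s1 * q1 * q2 ) * p2 ^ 2
    - ( (alpha0 + alpha1 - 1) * q1 * q2 + alpha2 * q1 * (q2 - s2)
        - eta * (s2 - 1) * q2 ) * p1
    - ( (alpha0 - 1) * q2 * (q2 - 1) + alpha1 * q2 * (q2 - s2)
        + alpha2 * (q2 - 1) * (q2 - s2)
        + s2 * (s2 - 1) / s1 * (alpha2 * q1 + eta * q2) ) * p2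
    + nu * (nu + alphaoo) * q2 ) / (s2 * (s2 - 1)).

(* A germ at the origin of C^2 is represented by any function C -> C -> C
   having it as germ; the arguments are always (t1, s2). *)
Definition near0 (P : C -> C -> Prop) : Prop :=
  exists r : R, (0 < r)%R /\
    forall t s : C, (Cmod t < r)%R -> (Cmod s < r)%R -> P t s.

(* The ring C{{t1,s2}}: near the origin, f is the sum of a double power series
   whose coefficients grow at most geometrically. The series is summed by
   homogeneous parts; the bound makes it absolutely convergent on the polydisc,
   so the order of summation is immaterial. *)
Definition convergent (f : C -> C -> C) : Prop :=
  exists (a : nat -> nat -> C) (r M : R),
    (0 < r)%R /\
    (forall m n : nat, (Cmod (a m n) * r ^ (m + n) <= M)%R) /\
    forall t s : C, (Cmod t < r)%R -> (Cmod s < r)%R ->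
      is_series (K := C_AbsRing) (V := C_NormedModule)
        (fun k : nat =>
           sum_n (G := C_AbelianMonoid)
             (fun m : nat => a m (k - m)%nat * t ^ m * s ^ (k - m)%nat) k)
        (f t s).

Fixpoint in_ideal (us : list (C -> C -> C)) (f : C -> C -> C) : Prop :=
  match us with
  | [] => near0 (fun t s => f t s = 0)
  | u :: us' => exists g h : C -> C -> C,
      convergent g /\ in_ideal us' h /\
      near0 (fun t s => f t s = g t s * u t s + h t s)
  end.

Definition mon (m n : nat) : C -> C -> C := fun t s => t ^ m * s ^ n.

(* f = pref * (lead + <gens>), as meromorphic germs: equality is asked off the
   axes t1 = 0 and s2 = 0, where the prefactors 1/t1 and 1/s2 have their poles. *)
Definition expands (f pref lead : C -> C -> C) (gens : list (C -> C -> C)) : Prop :=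
  exists e : C -> C -> C,
    in_ideal gens e /\
    near0 (fun t s => t <> 0 -> s <> 0 -> f t s = pref t s * (lead t s + e t s)).

Definition meromorphic (f : C -> C -> C) : Prop :=
  exists g h : C -> C -> C,
    convergent g /\ convergent h /\ ~ near0 (fun t s => h t s = 0) /\
    near0 (fun t s => h t s <> 0 -> f t s = g t s / h t s).

Definition ex_Cderive (f : C -> C) (z : C) : Prop :=
  ex_derive (K := C_AbsRing) (V := C_NormedModule) f z.

(* The total operator [C_derive] is only meaningful at points of
   differentiability: this is required of the unknowns, and it is automatic for
   the Hamiltonians, which are polynomial in (q1,q2,p1,p2). *)
Definition has_partials (f : C -> C -> C) (t s : C) : Prop :=
  ex_Cderive (fun x => f x s) t /\ ex_Cderive (fun y => f t y) s.

Definition d_t1 (f : C -> C -> C) (t s : C) : C := C_derive (fun x => f x s) t.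
Definition d_s2 (f : C -> C -> C) (t s : C) : C := C_derive (fun y => f t y) s.

(* The Hamiltonian system in the variables t1 = 1/s1 and s2. *)
Definition hamiltonian_system (alpha0 alpha1 alpha2 alphaoo nu eta : C)
    (q1 q2 p1 p2 : C -> C -> C) (t s : C) : Prop :=
  let h1 := H1 alpha0 alpha1 alpha2 alphaoo nu eta in
  let h2 := H2 alpha0 alpha1 alpha2 alphaoo nu eta in
  let s1 := / t in
  let Q1 := q1 t s in
  let Q2 := q2 t s in
  let P1 := p1 t s in
  let P2 := p2 t s in
  has_partials q1 t s /\ has_partials q2 t s /\
  has_partials p1 t s /\ has_partials p2 t s /\
  - t * d_t1 q1 t s = s1 * C_derive (fun x => h1 Q1 Q2 x P2 s1 s) P1 /\
  - t * d_t1 q2 t s = s1 * C_derive (fun x => h1 Q1 Q2 P1 x s1 s) P2 /\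
  t * d_t1 p1 t s = s1 * C_derive (fun x => h1 x Q2 P1 P2 s1 s) Q1 /\
  t * d_t1 p2 t s = s1 * C_derive (fun x => h1 Q1 x P1 P2 s1 s) Q2 /\
  d_s2 q1 t s = C_derive (fun x => h2 Q1 Q2 x P2 s1 s) P1 /\
  d_s2 q2 t s = C_derive (fun x => h2 Q1 Q2 P1 x s1 s) P2 /\
  - d_s2 p1 t s = C_derive (fun x => h2 x Q2 P1 P2 s1 s) Q1 /\
  - d_s2 p2 t s = C_derive (fun x => h2 Q1 x P1 P2 s1 s) Q2.

Definition meromorphic_solution (alpha0 alpha1 alpha2 alphaoo nu eta : C)
    (q1 q2 p1 p2 : C -> C -> C) : Prop :=
  meromorphic q1 /\ meromorphic q2 /\ meromorphic p1 /\ meromorphic p2 /\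
  near0 (fun t s => t <> 0 -> s <> 0 ->
    hamiltonian_system alpha0 alpha1 alpha2 alphaoo nu eta q1 q2 p1 p2 t s).

(* Pitfall: four of the coefficients commonly displayed for the expansions of
   the eight solutions contain slips that contradict the equations. The correct
   values, with Q2, P2, A, B the constant terms of q2, p2, t1*q1, p1/t1, follow
   from one order of one equation each:
   - q1 = +-eta/alphaoo: the order t1*s2 of the equation for dp1/ds2 gives
     p1 = P2 (nu+alpha2) / (1-alphaoo-alpha1) t1 s2 + ... for the sign +, and
     p1 = P2 (nu+alpha2+alphaoo) / (1+alphaoo-alpha1) t1 s2 + ... for the
     sign - (not Q2 in place of P2);
   - q2 = s2 (alpha2/(alpha2-alpha0) + ...): the order 1/s2 of the equation for
     dp2/ds2 gives p2 = (alpha2-alpha0 + ...)/s2 (not alpha0-alpha2);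
   - t1*q1 = (alphaoo-alpha0-alpha2)/alphaoo + ..., p2 regular: the order t1 of
     the equation for dp2/dt1 gives p2 = - eta B / (1+alphaoo-alpha0-alpha2) t1
     + ... (not 1-alphaoo+alpha0+alpha2). *)

(* Main.v *)
Require Import Defs.
From Stdlib Require Import Reals List Lra Lia FunctionalExtensionality.
From Stdlib Require Import Ring_polynom.
From Coquelicot Require Import Coquelicot.
Import ListNotations.
Open Scope C_scope.

(** The system is a Pfaffian system of Briot-Bouquet type. Write
    [T = t d/dt] and [D = s (1 - s) d/ds]; these derivations commute. With
    [q1 = A / t ^ e], [q2 = u * s ^ d], [p1 = B * t ^ e], [p2 = v / s ^ d] and
    [(e, d)] equal to [(0, 0)], [(0, 1)] or [(1, 1)], the system becomes
    [T Y = F (t, s, Y)], [D Y = G (t, s, Y)] for [Y = (A, u, B, v)], with [F] and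
    [G] polynomial. Each solution of the statement starts from a common zero
    [Y0] of [F] and [G] over the origin, and its poles are those of the
    coordinates.

    One equation. Put [L = a T + b D] with [a], [b] in [{0, 1}] and let [M] be
    the linear part of [a F + b G] in [Y] at [Y0]. On [t ^ m * s ^ n] the
    operator [L] acts as the number [k = a m + b n], up to a multiple of
    [t ^ m * s ^ (n + 1)], so that [L Y = a F + b G] is a recursion whose
    solvability is the invertibility of [k - M]. The vector fields are
    Hamiltonian, so the spectrum of [M] is [mu1], [- mu1], [mu2], [- mu2]; for a
    suitable choice of [a] and [b] genericity says that [mu1] and [mu2] are not
    integers, whence [k - M] is invertible for every [k] with an inverse of size
    [O (1 / (k + 1))] ([char_resolvent_spec]). The recursion is solved by a
    fixed point iteration in which every coefficient is eventually constant.
    Convergence comes from the norms [sum |y_mn| rho ^ (m + n)], truncated at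
    any order: they are submultiplicative, and the remainder is bounded by a
    multiple of [rho + delta ^ 2] on series of norm at most [delta], so a small
    ball is stable ([limit_majorized]).

    Both equations. The fields [T + F] and [D + G] commute, which is a
    polynomial identity ([bracket_zero]). Hence the defects [T Y - F] and
    [D Y - G] satisfy the linear equation obtained by linearizing
    [L Y = a F + b G] along [Y]; its lowest homogeneous part is killed by some
    [k - M], and the defects vanish ([regular_system_solution]).

    From series to germs. Evaluation of majorized series is a ring morphism
    that turns [T] and [D] into the analytic derivations ([eval_pval],
    [eval_theta_t], [eval_delta_s]), so the series give meromorphic solutions
    ([garnier_solution]). The expansions beyond [Y0] need a few coefficients,
    read off the components of [F] and [G] which are multiples of [B] or [v]
    up to [t] or [s]. Five solutions are treated directly; the three others
    follow because the Hamiltonians involve [alphaoo] only through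
    [nu * (nu + alphaoo)], hence are invariant under
    [(alphaoo, nu) -> (- alphaoo, nu + alphaoo)]. *)



(** * Formal power series over a commutative ring *)

Definition shift {A : Type} (a : nat -> A) : nat -> A := fun n => a (S n).

Section OneVariable.
Variable A : Type.
Variables (zero one : A) (add mul sub : A -> A -> A) (opp : A -> A).
Hypothesis Ath : ring_theory zero one add mul sub opp eq.
Add Ring coefficients : Ath.

(** The Cauchy product, by recursion on the index along
    [a = a 0 + X * shift a]: this form makes every law below a two-line
    induction on the index. *)
Fixpoint conv (a b : nat -> A) (n : nat) : A :=
  match n with
  | O => mul (a O) (b O)
  | S n' => add (mul (a O) (b (S n'))) (conv (shift a) b n')
  end.

Definition sadd (a b : nat -> A) : nat -> A := fun n => add (a n) (b n).
Definition ssub (a b : nat -> A) : nat -> A := fun n => sub (a n) (b n).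
Definition sopp (a : nat -> A) : nat -> A := fun n => opp (a n).
Definition scst (c : A) : nat -> A :=
  fun n => match n with O => c | S _ => zero end.
Definition sX (a : nat -> A) : nat -> A :=
  fun n => match n with O => zero | S n' => a n' end.

Lemma conv_S_r a b n :
  conv a b (S n) = add (conv a (shift b) n) (mul (a (S n)) (b O)).
Proof.
  revert a; induction n as [|n IH]; intros a; [reflexivity|].
  change (conv a b (S (S n)))
    with (add (mul (a O) (b (S (S n)))) (conv (shift a) b (S n))).
  rewrite IH; simpl; unfold shift; ring.
Qed.

Lemma conv_comm a b n : conv a b n = conv b a n.
Proof.
  revert a b; induction n as [|n IH]; intros a b; [simpl; ring|].
  rewrite conv_S_r; simpl; rewrite IH; ring.
Qed.

Lemma conv_sadd_l a b c n :
  conv (sadd a b) c n = add (conv a c n) (conv b c n).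
Proof.
  revert a b; induction n as [|n IH]; intros a b;
    [simpl; unfold sadd; ring|].
  change (shift (sadd a b)) with (sadd (shift a) (shift b)); simpl.
  change (shift (sadd a b)) with (sadd (shift a) (shift b)); rewrite IH.
  unfold sadd; ring.
Qed.

Lemma conv_scal_l x a b n :
  conv (fun k => mul x (a k)) b n = mul x (conv a b n).
Proof.
  revert a; induction n as [|n IH]; intros a; simpl; [ring|].
  change (shift (fun k => mul x (a k))) with (fun k => mul x (shift a k)).
  rewrite IH; ring.
Qed.

Lemma conv_assoc a b c n : conv a (conv b c) n = conv (conv a b) c n.
Proof.
  revert a; induction n as [|n IH]; intros a; simpl; [ring|].
  change (shift (conv a b))
    with (sadd (fun k => mul (a O) (shift b k)) (conv (shift a) b)).
  rewrite conv_sadd_l, conv_scal_l, IH; ring.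
Qed.

Lemma conv_zero_l b n : conv (fun _ => zero) b n = zero.
Proof.
  induction n as [|n IH]; simpl; [ring|].
  change (shift (fun _ => zero)) with (fun _ : nat => zero); rewrite IH; ring.
Qed.

Lemma conv_scst_l x b n : conv (scst x) b n = mul x (b n).
Proof.
  destruct n as [|n]; [reflexivity|]; simpl.
  change (shift (scst x)) with (fun _ : nat => zero).
  rewrite conv_zero_l; ring.
Qed.

Lemma conv_sX_l a b n : conv (sX a) b n = sX (conv a b) n.
Proof.
  destruct n as [|n]; simpl; [ring|].
  change (shift (sX a)) with a; ring.
Qed.

Lemma series_ring :
  ring_theory (scst zero) (scst one) sadd conv ssub sopp eq.
Proof.
  constructor; intros; apply functional_extensionality; intros n;
    unfold sadd, ssub, sopp.
  - destruct n; simpl; ring.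
  - ring.
  - ring.
  - rewrite conv_scst_l; ring.
  - apply conv_comm.
  - apply conv_assoc.
  - apply conv_sadd_l.
  - ring.
  - destruct n; simpl; ring.
Qed.

Lemma conv_scale (x : A) (p : nat -> A) (p0 : p O = one)
  (pS : forall n, p (S n) = mul x (p n)) a b n :
  conv (fun k => mul (p k) (a k)) (fun k => mul (p k) (b k)) n
  = mul (p n) (conv a b n).
Proof.
  revert a; induction n as [|n IH]; intros a; simpl; [rewrite p0; ring|].
  replace (shift (fun k => mul (p k) (a k)))
    with (fun k => mul x (mul (p k) (shift a k))).
  2:{ apply functional_extensionality; intros k; unfold shift; rewrite pS; ring. }
  rewrite conv_scal_l, IH, pS, p0; ring.
Qed.

Lemma conv_map (f : A -> A)
  (fadd : forall x y, f (add x y) = add (f x) (f y))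
  (fmul : forall x y, f (mul x y) = mul (f x) (f y)) a b n :
  conv (fun k => f (a k)) (fun k => f (b k)) n = f (conv a b n).
Proof.
  revert a; induction n as [|n IH]; intros a; simpl; [symmetry; apply fmul|].
  change (shift (fun k => f (a k))) with (fun k => f (shift a k)).
  rewrite IH, fadd, fmul; reflexivity.
Qed.

(** Setting both variables equal: the [k]-th coefficient of [sum a_mn X^(m+n)]. *)
Fixpoint diag (a : nat -> nat -> A) (k : nat) : A :=
  match k with
  | O => a O O
  | S k' => add (a O (S k')) (diag (shift a) k')
  end.

Lemma diag_split a k :
  diag a k = sadd (a O) (sX (diag (shift a))) k.
Proof. destruct k; unfold sadd; simpl; [ring|reflexivity]. Qed.

Lemma diag_sadd a b k :
  diag (fun m => sadd (a m) (b m)) k = add (diag a k) (diag b k).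
Proof.
  revert a b; induction k as [|k IH]; intros a b; simpl; [reflexivity|].
  change (shift (fun m => sadd (a m) (b m)))
    with (fun m => sadd (shift a m) (shift b m)).
  rewrite IH; unfold sadd; ring.
Qed.

Lemma diag_mul_l c b k : diag (fun m => conv c (b m)) k = conv c (diag b) k.
Proof.
  revert b; induction k as [|k IH]; intros b; [reflexivity|].
  assert (E : diag b = sadd (b O) (sX (diag (shift b)))).
  { apply functional_extensionality; intros j; apply diag_split. }
  rewrite (conv_comm c (diag b)), E, conv_sadd_l, conv_sX_l.
  unfold sX; cbv beta iota.
  rewrite (conv_comm (b O)), (conv_comm (diag (shift b))), <- IH.
  reflexivity.
Qed.

Fixpoint nmul (n : nat) (x : A) : A :=
  match n with O => zero | S n' => add x (nmul n' x) end.

Lemma nmul_add n x y : nmul n (add x y) = add (nmul n x) (nmul n y).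
Proof. induction n as [|n IH]; simpl; [ring|rewrite IH; ring]. Qed.

Lemma nmul_mul_r n x y : nmul n (mul x y) = mul x (nmul n y).
Proof. induction n as [|n IH]; simpl; [ring|rewrite IH; ring]. Qed.

Definition euler (a : nat -> A) : nat -> A := fun n => nmul n (a n).

Lemma shift_euler a : shift (euler a) = sadd (shift a) (euler (shift a)).
Proof. reflexivity. Qed.

Lemma euler_conv a b n :
  euler (conv a b) n = add (conv (euler a) b n) (conv a (euler b) n).
Proof.
  revert a; induction n as [|n IH]; intros a; [simpl; unfold euler; simpl; ring|].
  unfold euler at 1; change (conv a b (S n))
    with (add (mul (a O) (b (S n))) (conv (shift a) b n)).
  rewrite nmul_add, nmul_mul_r.
  change (nmul (S n) (conv (shift a) b n))
    with (add (conv (shift a) b n) (euler (conv (shift a) b) n)).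
  change (conv (euler a) b (S n))
    with (add (mul zero (b (S n))) (conv (shift (euler a)) b n)).
  change (conv a (euler b) (S n))
    with (add (mul (a O) (nmul (S n) (b (S n)))) (conv (shift a) (euler b) n)).
  rewrite IH, shift_euler, conv_sadd_l; ring.
Qed.

Lemma conv_derivation (d : A -> A)
  (dadd : forall x y, d (add x y) = add (d x) (d y))
  (dmul : forall x y, d (mul x y) = add (mul (d x) y) (mul x (d y))) a b n :
  d (conv a b n)
  = add (conv (fun k => d (a k)) b n) (conv a (fun k => d (b k)) n).
Proof.
  revert a; induction n as [|n IH]; intros a; simpl; [apply dmul|].
  rewrite dadd, dmul, IH.
  change (shift (fun k => d (a k))) with (fun k => d (shift a k)); ring.
Qed.

(** Stated for a filtration [I] of the coefficients so that it can be applied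
    once for each variable, [X] having degree one. *)
Lemma conv_filtration (I : nat -> A -> Prop)
  (Iadd : forall k x y, I k x -> I k y -> I k (add x y))
  (Ile : forall k l x, (k <= l)%nat -> I l x -> I k x)
  (Imul : forall k l x y, I k x -> I l y -> I (k + l)%nat (mul x y))
  k l a b :
  (forall n, I (k - n)%nat (a n)) -> (forall n, I (l - n)%nat (b n)) ->
  forall n, I (k + l - n)%nat (conv a b n).
Proof.
  intros Ha Hb n; revert k a Ha; induction n as [|n IH]; intros k a Ha; simpl.
  - eapply Ile; [|apply Imul; [apply (Ha O)|apply (Hb O)]]; lia.
  - apply Iadd.
    + eapply Ile; [|apply Imul; [apply (Ha O)|apply (Hb (S n))]]; lia.
    + apply Ile with ((k - 1) + l - n)%nat; [lia|].
      apply IH; intros m; unfold shift.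
      apply Ile with (k - S m)%nat; [lia|apply Ha].
Qed.

(** Weighted [l^1] norms; as for the filtration, an arbitrary submultiplicative
    [nu] on the coefficients lets the construction be iterated. *)
Section Norm.
Variable nu : A -> R.
Hypothesis nu_pos : forall x, (0 <= nu x)%R.
Hypothesis nu_add : forall x y, (nu (add x y) <= nu x + nu y)%R.
Hypothesis nu_mul : forall x y, (nu (mul x y) <= nu x * nu y)%R.
Variable rho : R.
Hypothesis rho_pos : (0 <= rho)%R.

(** The sum of [nu (a n) * rho ^ n] over [n <= K], in Horner form. *)
Fixpoint norm1 (a : nat -> A) (K : nat) : R :=
  match K with
  | O => nu (a O)
  | S K' => (nu (a O) + rho * norm1 (shift a) K')%R
  end.

Lemma norm1_pos a K : (0 <= norm1 a K)%R.
Proof.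
  revert a; induction K as [|K IH]; intros a; simpl; [apply nu_pos|].
  specialize (IH (shift a)); specialize (nu_pos (a O)); nra.
Qed.

Lemma norm1_S a K : (norm1 a K <= norm1 a (S K))%R.
Proof.
  revert a; induction K as [|K IH]; intros a; simpl.
  - specialize (nu_pos (shift a O)); nra.
  - specialize (IH (shift a)); simpl in IH.
    apply Rplus_le_compat_l, Rmult_le_compat_l; assumption.
Qed.

Lemma norm1_add a b K : (norm1 (sadd a b) K <= norm1 a K + norm1 b K)%R.
Proof.
  revert a b; induction K as [|K IH]; intros a b; simpl; [apply nu_add|].
  change (shift (sadd a b)) with (sadd (shift a) (shift b)).
  specialize (IH (shift a) (shift b)).
  generalize (nu_add (a O) (b O)); unfold sadd at 1.
  generalize (Rmult_le_compat_l _ _ _ rho_pos IH); lra.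
Qed.

Lemma norm1_scal x a K :
  (norm1 (fun k => mul x (a k)) K <= nu x * norm1 a K)%R.
Proof.
  revert a; induction K as [|K IH]; intros a; simpl; [apply nu_mul|].
  specialize (IH (shift a)).
  generalize (nu_mul x (a O)) (Rmult_le_compat_l _ _ _ rho_pos IH).
  unfold shift; lra.
Qed.

Lemma norm1_conv a b K : (norm1 (conv a b) K <= norm1 a K * norm1 b K)%R.
Proof.
  revert a; induction K as [|K IH]; intros a; simpl; [apply nu_mul|].
  change (shift (conv a b))
    with (sadd (fun k => mul (a O) (shift b k)) (conv (shift a) b)).
  pose proof (norm1_add (fun k => mul (a O) (shift b k)) (conv (shift a) b) K)
    as H1.
  pose proof (norm1_scal (a O) (shift b) K) as H2.
  pose proof (IH (shift a)) as H3.
  pose proof (nu_mul (a O) (b O)) as H4.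
  pose proof (norm1_S b K) as H5.
  pose proof (norm1_pos (shift a) K) as H6.
  simpl in H5.
  pose proof (Rmult_le_compat_l _ _ _ H6 H5) as H7.
  assert (H8 : (norm1 (sadd (fun k => mul (a O) (shift b k))
                     (conv (shift a) b)) K
    <= nu (a O) * norm1 (shift b) K
       + norm1 (shift a) K * (nu (b O) + rho * norm1 (shift b) K))%R) by lra.
  pose proof (Rmult_le_compat_l _ _ _ rho_pos H8) as H9.
  lra.
Qed.
End Norm.
End OneVariable.

Arguments conv {A} add mul a b n.
Arguments sadd {A} add a b n /.
Arguments ssub {A} sub a b n /.
Arguments sopp {A} opp a n /.
Arguments scst {A} zero c n.
Arguments sX {A} zero a n.
Arguments nmul {A} zero add n x.
Arguments euler {A} zero add a n.
Arguments norm1 {A} nu rho a K.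
Arguments diag {A} add a k.

(** Collecting terms by total degree turns products of double series into Cauchy
    products of single series, so that evaluation at a point of [C ^ 2] only
    needs the theorem on products of absolutely convergent single series. *)
Lemma diag_conv {A : Type} zero one add mul sub opp
  (Ath : ring_theory zero one add mul sub opp eq) (a b : nat -> nat -> A) k :
  diag add (conv (sadd add) (conv add mul) a b) k
  = conv add mul (diag add a) (diag add b) k.
Proof.
  revert a; induction k as [|k IH]; intros a; [reflexivity|].
  set (cv := conv add mul); set (cv2 := conv (sadd add) cv).
  change (diag add (cv2 a b) (S k))
    with (add (cv (a O) (b O) (S k)) (diag add (shift (cv2 a b)) k)).
  change (shift (cv2 a b))
    with (fun m => sadd add (cv (a O) (shift b m)) (cv2 (shift a) b m)).
  rewrite (diag_sadd _ _ _ _ _ _ _ Ath).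
  change (diag add (fun m => cv2 (shift a) b m)) with (diag add (cv2 (shift a) b)).
  unfold cv2, cv; rewrite IH, (diag_mul_l _ _ _ _ _ _ _ Ath).
  replace (diag add a) with (sadd add (a O) (sX zero (diag add (shift a)))).
  2:{ apply functional_extensionality; intros j; symmetry.
      apply (diag_split _ _ _ _ _ _ _ Ath). }
  rewrite (conv_sadd_l _ _ _ _ _ _ _ Ath), (conv_sX_l _ _ _ _ _ _ _ Ath).
  unfold sX at 1; cbv beta iota.
  replace (diag add b) with (sadd add (b O) (sX zero (diag add (shift b)))) at 2.
  2:{ apply functional_extensionality; intros j; symmetry.
      apply (diag_split _ _ _ _ _ _ _ Ath). }
  rewrite (conv_comm _ _ _ _ _ _ _ Ath (a O) (sadd _ _ _)).
  rewrite (conv_sadd_l _ _ _ _ _ _ _ Ath), (conv_sX_l _ _ _ _ _ _ _ Ath).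
  unfold sX at 1; cbv beta iota.
  rewrite (conv_comm _ _ _ _ _ _ _ Ath (b O)).
  rewrite (conv_comm _ _ _ _ _ _ _ Ath (diag add (shift b))).
  apply (Radd_assoc Ath).
Qed.

Lemma norm1_le {A B : Type} (nu : A -> R) (nu' : B -> R) rho a b K :
  (0 <= rho)%R -> (forall n, (n <= K)%nat -> (nu (a n) <= nu' (b n))%R) ->
  (norm1 nu rho a K <= norm1 nu' rho b K)%R.
Proof.
  intros Hrho; revert a b; induction K as [|K IH]; intros a b H; simpl.
  - apply H; lia.
  - apply Rplus_le_compat; [apply H; lia|].
    apply Rmult_le_compat_l; [exact Hrho|].
    apply IH; intros n Hn; apply H; lia.
Qed.

Lemma norm1_term {A : Type} (nu : A -> R) rho a K n :
  (forall x, 0 <= nu x)%R -> (0 <= rho)%R -> (n <= K)%nat ->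
  (nu (a n) * rho ^ n <= norm1 nu rho a K)%R.
Proof.
  intros Hnu Hrho; revert a n; induction K as [|K IH]; intros a n Hn.
  - replace n with O by lia; simpl; lra.
  - destruct n as [|n]; simpl.
    + pose proof (norm1_pos A nu Hnu rho Hrho (shift a) K); nra.
    + assert (Hn' : (n <= K)%nat) by lia; pose proof (IH (shift a) n Hn') as H.
      unfold shift at 1 in H; specialize (Hnu (a O)).
      apply Rmult_le_compat_l with (r := rho) in H; [lra|exact Hrho].
Qed.


(** * Formal power series in two variables *)

(** [a m n] is the coefficient of [t ^ m * s ^ n]: a series in [t] whose
    coefficients are series in [s]. *)
Definition ps : Type := nat -> nat -> C.

Definition z1 : nat -> C := scst (RtoC 0) (RtoC 0).
Definition padd : ps -> ps -> ps := sadd (sadd Cplus).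
Definition psub : ps -> ps -> ps := ssub (ssub Cminus).
Definition popp : ps -> ps := sopp (sopp Copp).
Definition pmul : ps -> ps -> ps := conv (sadd Cplus) (conv Cplus Cmult).
Definition pcst (c : C) : ps := scst z1 (scst (RtoC 0) c).
Definition pT : ps := sX z1 (pcst 1).
Definition pS : ps := scst z1 (sX (RtoC 0) (scst (RtoC 0) (RtoC 1))).

Declare Scope ps_scope.
Delimit Scope ps_scope with ps.
Bind Scope ps_scope with ps.
Infix "+" := padd : ps_scope.
Infix "-" := psub : ps_scope.
Notation "- a" := (popp a) : ps_scope.
Infix "*" := pmul : ps_scope.

Lemma ps1_ring :
  ring_theory z1 (scst (RtoC 0) (RtoC 1)) (sadd Cplus) (conv Cplus Cmult) (ssub Cminus)
    (sopp Copp) eq.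
Proof. apply (series_ring C 0 1 _ _ _ _ C_ring_theory). Qed.

Lemma ps_ring : ring_theory (pcst 0) (pcst 1) padd pmul psub popp eq.
Proof. apply (series_ring _ _ _ _ _ _ _ ps1_ring). Qed.

Add Ring ps_Ring : ps_ring.

Lemma ps_ext (a b : ps) : (forall m n, a m n = b m n) -> a = b.
Proof.
  intros H; apply functional_extensionality; intros m.
  apply functional_extensionality; intros n; apply H.
Qed.

Lemma pcst_zero m n : pcst 0 m n = 0.
Proof. destruct m, n; reflexivity. Qed.

Lemma pcst_mul c a m n : (pcst c * a)%ps m n = c * a m n.
Proof.
  unfold pmul, pcst; rewrite (conv_scst_l _ _ _ _ _ _ _ ps1_ring).
  apply (conv_scst_l _ _ _ _ _ _ _ C_ring_theory).
Qed.

Lemma pcst_add x y : pcst (x + y) = (pcst x + pcst y)%ps.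
Proof.
  apply ps_ext; intros [|m] [|n]; unfold padd; simpl; try reflexivity;
    unfold pcst, z1; simpl; ring.
Qed.

Lemma pcst_opp x : pcst (- x) = (- pcst x)%ps.
Proof.
  apply ps_ext; intros [|m] [|n]; unfold popp; simpl; try reflexivity;
    unfold pcst, z1; simpl; ring.
Qed.

Lemma pcst_pcst x y : pcst (x * y) = (pcst x * pcst y)%ps.
Proof.
  apply ps_ext; intros m n; rewrite pcst_mul.
  destruct m, n; unfold pcst, z1; simpl; ring.
Qed.

Lemma pT_mul a m n :
  (pT * a)%ps m n = match m with O => 0 | S m' => a m' n end.
Proof.
  unfold pmul, pT; rewrite (conv_sX_l _ _ _ _ _ _ _ ps1_ring).
  destruct m as [|m]; simpl; [destruct n; reflexivity|].
  exact (f_equal (fun f => f m n) (Rmul_1_l ps_ring a)).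
Qed.

Lemma pS_mul a m n :
  (pS * a)%ps m n = match n with O => 0 | S n' => a m n' end.
Proof.
  unfold pmul, pS; rewrite (conv_scst_l _ _ _ _ _ _ _ ps1_ring).
  rewrite (conv_sX_l _ _ _ _ _ _ _ C_ring_theory).
  destruct n as [|n]; simpl; [reflexivity|].
  exact (f_equal (fun f => f n) (Rmul_1_l ps1_ring (a m))).
Qed.

(** ** The Euler derivations *)

Definition theta_t (a : ps) : ps := fun m n => RtoC (INR m) * a m n.
Definition theta_s (a : ps) : ps := fun m n => RtoC (INR n) * a m n.

Lemma nmul_C n x : nmul (RtoC 0) Cplus n x = RtoC (INR n) * x.
Proof.
  induction n as [|n IH]; [simpl; ring|].
  rewrite S_INR, RtoC_plus; simpl; rewrite IH; ring.
Qed.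

Lemma nmul_ps1 m a n :
  nmul z1 (sadd Cplus) m a n = RtoC (INR m) * a n.
Proof.
  induction m as [|m IH]; [unfold z1; destruct n; simpl; ring|].
  rewrite S_INR, RtoC_plus; simpl; rewrite IH; ring.
Qed.

Lemma theta_t_mul a b : theta_t (a * b) = (theta_t a * b + a * theta_t b)%ps.
Proof.
  assert (E : forall c, theta_t c = euler z1 (sadd Cplus) c).
  { intros c; apply ps_ext; intros m n; unfold euler; now rewrite nmul_ps1. }
  rewrite !E; apply functional_extensionality; intros m.
  apply (euler_conv _ _ _ _ _ _ _ ps1_ring).
Qed.

Lemma theta_s_mul a b : theta_s (a * b) = (theta_s a * b + a * theta_s b)%ps.
Proof.
  assert (E : forall c, theta_s c = fun m => euler (RtoC 0) Cplus (c m)).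
  { intros c; apply ps_ext; intros m n; unfold euler; now rewrite nmul_C. }
  rewrite !E; apply functional_extensionality; intros m.
  apply (conv_derivation _ _ _ _ _ _ _ ps1_ring).
  - intros x y; apply functional_extensionality; intros n; unfold euler; simpl.
    apply (nmul_add _ _ _ _ _ _ _ C_ring_theory).
  - intros x y; apply functional_extensionality; intros n.
    apply (euler_conv _ _ _ _ _ _ _ C_ring_theory).
Qed.

(** The derivation [s * (1 - s) * d/ds], which commutes with [theta_t]. *)
Definition delta_s (a : ps) : ps := (theta_s a - pS * theta_s a)%ps.

(** Derivations over the constants: the chain rule [pval_derivation] is the only
    way in which [theta_t] and [delta_s] enter. *)
Record derivation (d : ps -> ps) : Prop := {
  der_add : forall a b, d (a + b)%ps = (d a + d b)%ps;
  der_opp : forall a, d (- a)%ps = (- d a)%ps;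
  der_mul : forall a b, d (a * b)%ps = (d a * b + a * d b)%ps;
  der_cst : forall c, d (pcst c) = pcst 0 }.

Lemma theta_t_derivation : derivation theta_t.
Proof.
  constructor.
  - intros a b; apply ps_ext; intros m n; unfold theta_t, padd; simpl; ring.
  - intros a; apply ps_ext; intros m n; unfold theta_t, popp; simpl; ring.
  - apply theta_t_mul.
  - intros c; apply ps_ext; intros m n; rewrite pcst_zero; unfold theta_t.
    destruct m, n; simpl; unfold z1; simpl; ring.
Qed.

Lemma theta_s_derivation : derivation theta_s.
Proof.
  constructor.
  - intros a b; apply ps_ext; intros m n; unfold theta_s, padd; simpl; ring.
  - intros a; apply ps_ext; intros m n; unfold theta_s, popp; simpl; ring.
  - apply theta_s_mul.
  - intros c; apply ps_ext; intros m n; rewrite pcst_zero; unfold theta_s.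
    destruct m, n; simpl; unfold z1; simpl; ring.
Qed.

Lemma delta_s_derivation : derivation delta_s.
Proof.
  destruct theta_s_derivation as [Ha Ho Hm Hc].
  constructor; intros; unfold delta_s; rewrite ?Ha, ?Ho, ?Hm, ?Hc; ring.
Qed.

Lemma delta_s_coef a m n :
  delta_s a m n
  = RtoC (INR n) * a m n
    - match n with O => 0 | S n' => RtoC (INR n') * a m n' end.
Proof.
  unfold delta_s, psub; simpl; rewrite pS_mul.
  destruct n as [|n]; unfold theta_s; ring.
Qed.

Lemma theta_delta_comm a : theta_t (delta_s a) = delta_s (theta_t a).
Proof.
  apply ps_ext; intros m n; rewrite delta_s_coef; unfold theta_t at 1.
  rewrite delta_s_coef; unfold theta_t; destruct n; ring.
Qed.

Lemma theta_t_T : theta_t pT = pT.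
Proof.
  apply ps_ext; intros m n; unfold theta_t.
  destruct m as [|[|m]], n; unfold pT, pcst, z1; simpl; ring.
Qed.

Lemma theta_t_S : theta_t pS = pcst 0.
Proof.
  apply ps_ext; intros m n; rewrite pcst_zero; unfold theta_t.
  destruct m as [|m], n as [|n]; unfold pS, pcst, z1; simpl; ring.
Qed.

Lemma delta_s_T : delta_s pT = pcst 0.
Proof.
  apply ps_ext; intros m n; rewrite pcst_zero, delta_s_coef.
  destruct m as [|[|m]], n as [|[|n]]; unfold pT, pcst, z1; simpl; ring.
Qed.

Lemma delta_s_S : delta_s pS = (pS * (pcst 1 - pS))%ps.
Proof.
  assert (E : theta_s pS = pS).
  { apply ps_ext; intros m n; unfold theta_s.
    destruct m as [|m], n as [|[|n]]; unfold pS, pcst, z1; simpl; ring. }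
  unfold delta_s; rewrite E; ring.
Qed.

(** ** The order filtration *)

Definition ord_ge (k : nat) (a : ps) : Prop :=
  forall m n, (m + n < k)%nat -> a m n = 0.

Lemma ord_ge_le k l a : (k <= l)%nat -> ord_ge l a -> ord_ge k a.
Proof. intros Hkl H m n Hmn; apply H; lia. Qed.

Lemma ord_ge_add k a b : ord_ge k a -> ord_ge k b -> ord_ge k (a + b).
Proof.
  intros Ha Hb m n Hmn; unfold padd; simpl; rewrite Ha, Hb by exact Hmn; ring.
Qed.

Lemma ord_ge_opp k a : ord_ge k a -> ord_ge k (- a).
Proof.
  intros Ha m n Hmn; unfold popp; simpl; rewrite Ha by exact Hmn; ring.
Qed.

Lemma ord_ge_0 a : ord_ge 0 a.
Proof. intros m n H; lia. Qed.

Lemma ord_ge_zero k : ord_ge k (pcst 0).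
Proof. intros m n _; apply pcst_zero. Qed.

Lemma ord_ge_mul k l a b : ord_ge k a -> ord_ge l b -> ord_ge (k + l) (a * b).
Proof.
  set (I0 := fun (k : nat) (c : C) => (0 < k)%nat -> c = 0).
  set (I1 := fun k (c : nat -> C) => forall n, I0 (k - n)%nat (c n)).
  intros Ha Hb.
  assert (Iadd : forall j x y, I1 j x -> I1 j y -> I1 j (sadd Cplus x y)).
  { intros j x y Hx Hy n Hn; simpl; rewrite (Hx n Hn), (Hy n Hn); ring. }
  assert (H : forall m, I1 (k + l - m)%nat ((a * b)%ps m)).
  { apply conv_filtration.
    - exact Iadd.
    - intros i j x Hij Hx n Hn; apply Hx; lia.
    - intros i j x y Hx Hy.
      unfold I1; apply conv_filtration; [| | |exact Hx|exact Hy].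
      + intros p u v Hu Hv Hp; rewrite Hu, Hv by exact Hp; ring.
      + intros p q u Hpq Hu Hp; apply Hu; lia.
      + intros p q u v Hu Hv Hpq.
        destruct (Nat.eq_dec p 0) as [->|Hp].
        * rewrite Hv by lia; ring.
        * rewrite Hu by lia; ring.
    - intros m n Hn; apply Ha; lia.
    - intros m n Hn; apply Hb; lia. }
  intros m n Hmn; apply (H m n); lia.
Qed.

Lemma ord_ge_T : ord_ge 1 pT.
Proof. intros m n H; replace m with O by lia; replace n with O by lia; reflexivity. Qed.

Lemma ord_ge_S : ord_ge 1 pS.
Proof. intros m n H; replace m with O by lia; replace n with O by lia; reflexivity. Qed.

(** ** Majorants *)

(** The truncated norms [sum of |a m n| * rho ^ (m + n)] over [m, n <= K] are
    submultiplicative, so a bound uniform in [K] passes to polynomial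
    expressions without any convergence argument. *)
Definition norm2 (rho : R) (a : ps) (K : nat) : R :=
  norm1 (fun c => norm1 Cmod rho c K) rho a K.

Definition majorized (rho delta : R) (a : ps) : Prop :=
  forall K, (norm2 rho a K <= delta)%R.

Section Bounds.
Variable rho : R.
Hypothesis rho_pos : (0 <= rho)%R.

Lemma Cmod_mult_le x y : (Cmod (x * y) <= Cmod x * Cmod y)%R.
Proof. rewrite Cmod_mult; apply Rle_refl. Qed.

Lemma norm1_Cmod_pos c K : (0 <= norm1 Cmod rho c K)%R.
Proof. apply norm1_pos; [exact Cmod_ge_0|exact rho_pos]. Qed.

Lemma norm2_pos a K : (0 <= norm2 rho a K)%R.
Proof.
  apply norm1_pos; [intros c; apply norm1_Cmod_pos|exact rho_pos].
Qed.

Lemma majorized_pos delta a : majorized rho delta a -> (0 <= delta)%R.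
Proof. intros H; apply Rle_trans with (2 := H O), norm2_pos. Qed.

Lemma majorized_le d d' a : (d <= d')%R -> majorized rho d a -> majorized rho d' a.
Proof. intros Hd H K; apply Rle_trans with (2 := Hd), H. Qed.

Lemma majorized_add d d' a b :
  majorized rho d a -> majorized rho d' b -> majorized rho (d + d') (a + b).
Proof.
  intros Ha Hb K; specialize (Ha K); specialize (Hb K).
  apply Rle_trans with (norm2 rho a K + norm2 rho b K)%R; [|lra].
  apply norm1_add; [|exact rho_pos].
  intros x y; apply norm1_add; [exact Cmod_triangle|exact rho_pos].
Qed.

Lemma majorized_mul d d' a b :
  majorized rho d a -> majorized rho d' b -> majorized rho (d * d') (a * b).
Proof.
  intros Ha Hb K.
  apply Rle_trans with (norm2 rho a K * norm2 rho b K)%R.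
  - apply norm1_conv; try exact rho_pos.
    + intros x; apply norm1_Cmod_pos.
    + intros x y; apply norm1_add; [exact Cmod_triangle|exact rho_pos].
    + intros x y; apply norm1_conv; try exact rho_pos.
      * exact Cmod_ge_0.
      * exact Cmod_triangle.
      * exact Cmod_mult_le.
  - apply Rmult_le_compat; try apply norm2_pos; [apply Ha|apply Hb].
Qed.

Lemma majorized_dominated d a b :
  (forall m n, (Cmod (a m n) <= Cmod (b m n))%R) ->
  majorized rho d b -> majorized rho d a.
Proof.
  intros H Hb K; apply Rle_trans with (2 := Hb K).
  apply norm1_le; [exact rho_pos|]; intros m _.
  apply norm1_le; [exact rho_pos|]; intros n _; apply H.
Qed.

Lemma majorized_abs d a :
  majorized rho d a -> majorized rho d (fun m n => RtoC (Cmod (a m n))).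
Proof.
  apply majorized_dominated; intros m n.
  rewrite Cmod_R, Rabs_pos_eq by apply Cmod_ge_0; apply Rle_refl.
Qed.

Lemma majorized_opp d a : majorized rho d a -> majorized rho d (- a).
Proof.
  apply majorized_dominated; intros m n; unfold popp; simpl.
  rewrite Cmod_opp; apply Rle_refl.
Qed.

Lemma norm1_zero K : norm1 Cmod rho z1 K = 0%R.
Proof.
  assert (H : forall (c : nat -> C), (forall n, c n = 0) ->
    norm1 Cmod rho c K = 0%R).
  { induction K as [|K IH]; intros c Hc; simpl; rewrite Hc, Cmod_0;
      [reflexivity|].
    rewrite IH by (intros n; apply Hc); ring. }
  apply H; intros [|n]; reflexivity.
Qed.

Lemma majorized_scst d (c : nat -> C) :
  (forall K, (norm1 Cmod rho c K <= d)%R) -> majorized rho d (scst z1 c).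
Proof.
  assert (Z : forall K L (a : ps), (forall m, a m = z1) ->
    norm1 (fun c => norm1 Cmod rho c L) rho a K = 0%R).
  { induction K as [|K IH]; intros L a Ha; simpl; rewrite Ha, norm1_zero;
      [reflexivity|].
    rewrite IH by (intros m; apply Ha); ring. }
  intros H K; unfold norm2.
  enough (E : forall L, (norm1 (fun c => norm1 Cmod rho c L) rho (scst z1 c) K
     = norm1 Cmod rho c L)%R) by (rewrite E; apply H).
  intros L; destruct K as [|K]; simpl; [reflexivity|].
  rewrite Z by reflexivity; ring.
Qed.

Lemma majorized_cst c : majorized rho (Cmod c) (pcst c).
Proof.
  apply majorized_scst; intros [|K]; simpl; [apply Rle_refl|].
  change (shift (scst (RtoC 0) c)) with z1 || change (shift (scst (RtoC 0) c)) with (fun _ : nat => RtoC 0).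
  assert (E : (fun _ : nat => RtoC 0) = z1).
  { apply functional_extensionality; intros [|n]; reflexivity. }
  rewrite E, norm1_zero; lra.
Qed.

Lemma majorized_zero : majorized rho 0 (pcst 0).
Proof. pose proof (majorized_cst 0) as H; rewrite Cmod_0 in H; exact H. Qed.

Lemma majorized_S : majorized rho rho pS.
Proof.
  apply majorized_scst.
  assert (E : shift (shift (sX (RtoC 0) (scst (RtoC 0) (RtoC 1)))) = z1).
  { apply functional_extensionality; intros [|n]; reflexivity. }
  intros [|[|K]]; simpl; rewrite ?Cmod_0; [lra|unfold shift; simpl; rewrite Cmod_1; lra|].
  rewrite E, norm1_zero; unfold shift; simpl; rewrite Cmod_1; lra.
Qed.

Lemma majorized_T : majorized rho rho pT.
Proof.
  intros K; unfold norm2, pT.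
  destruct K as [|K]; simpl; [rewrite Cmod_0; lra|].
  change (shift (sX z1 (pcst 1))) with (pcst 1).
  change (Cmod 0 + rho * norm1 Cmod rho (shift z1) K)%R
    with (norm1 Cmod rho z1 (S K)).
  rewrite norm1_zero.
  assert (H : (norm1 (fun c => norm1 Cmod rho c (S K)) rho (pcst 1) K <= 1)%R).
  { pose proof (majorized_cst 1 (S K)) as H; rewrite Cmod_1 in H.
    apply Rle_trans with (2 := H); unfold norm2; apply norm1_S.
    - intros c; apply norm1_Cmod_pos.
    - exact rho_pos. }
  apply Rmult_le_compat_l with (r := rho) in H; [|exact rho_pos].
  simpl in H |- *; lra.
Qed.

Lemma majorized_coef d a m n :
  majorized rho d a -> (Cmod (a m n) * rho ^ (m + n) <= d)%R.
Proof.
  intros H; apply Rle_trans with (2 := H (m + n)%nat).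
  apply Rle_trans with (norm1 Cmod rho (a m) (m + n) * rho ^ m)%R.
  - rewrite pow_add, (Rmult_comm (rho ^ m)), <- Rmult_assoc.
    apply Rmult_le_compat_r; [apply pow_le, rho_pos|].
    apply norm1_term; [exact Cmod_ge_0|exact rho_pos|lia].
  - apply (norm1_term (fun c => norm1 Cmod rho c (m + n)));
      [intros c; apply norm1_Cmod_pos|exact rho_pos|lia].
Qed.
End Bounds.


(** * Polynomial vector fields and their linearization *)

Inductive unknown : Type := Q1 | Q2 | P1 | P2.

Definition sum4 (f : unknown -> R) : R := (f Q1 + f Q2 + f P1 + f P2)%R.

Inductive poly : Type :=
| Cst (c : C) | Tvar | Svar | Var (i : unknown)
| Add (e1 e2 : poly) | Opp (e : poly) | Mul (e1 e2 : poly).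

Section Interpretation.
Context {A : Type} (add mul : A -> A -> A) (opp : A -> A) (cst : C -> A).
Variables (t s : A) (Y : unknown -> A).

Fixpoint interp (e : poly) : A :=
  match e with
  | Cst c => cst c
  | Tvar => t
  | Svar => s
  | Var i => Y i
  | Add e1 e2 => add (interp e1) (interp e2)
  | Opp e1 => opp (interp e1)
  | Mul e1 e2 => mul (interp e1) (interp e2)
  end.

(** The differential at [(t, s, Y)] applied to [(dt, ds, dY)], a linear map that
    never has to be written as a matrix. *)
Fixpoint dinterp (dt ds : A) (dY : unknown -> A) (e : poly) : A :=
  match e with
  | Cst c => cst 0
  | Tvar => dt
  | Svar => ds
  | Var i => dY i
  | Add e1 e2 => add (dinterp dt ds dY e1) (dinterp dt ds dY e2)
  | Opp e1 => opp (dinterp dt ds dY e1)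
  | Mul e1 e2 =>
      add (mul (dinterp dt ds dY e1) (interp e2))
          (mul (interp e1) (dinterp dt ds dY e2))
  end.
End Interpretation.

Definition cval : C -> C -> (unknown -> C) -> poly -> C :=
  interp Cplus Cmult Copp (fun c => c).
Definition cdiff :
  C -> C -> (unknown -> C) -> C -> C -> (unknown -> C) -> poly -> C :=
  dinterp Cplus Cmult Copp (fun c => c).
Definition pval : (unknown -> ps) -> poly -> ps :=
  interp padd pmul popp pcst pT pS.
Definition pdiff : (unknown -> ps) -> ps -> ps -> (unknown -> ps) -> poly -> ps :=
  dinterp padd pmul popp pcst pT pS.

Lemma pval_derivation d (Hd : derivation d) Y e :
  d (pval Y e) = pdiff Y (d pT) (d pS) (fun i => d (Y i)) e.
Proof.
  destruct Hd as [Ha Ho Hm Hc].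
  unfold pval, pdiff; induction e; simpl; auto.
  - rewrite Ha, IHe1, IHe2; reflexivity.
  - rewrite Ho, IHe; reflexivity.
  - rewrite Hm, IHe1, IHe2; reflexivity.
Qed.

Lemma pdiff_add Y t s V t' s' V' e :
  pdiff Y (t + t')%ps (s + s')%ps (fun i => V i + V' i)%ps e
  = (pdiff Y t s V e + pdiff Y t' s' V' e)%ps.
Proof.
  unfold pdiff; induction e; simpl; try ring;
    rewrite ?IHe1, ?IHe2, ?IHe; ring.
Qed.

Lemma pdiff_scal Y x V e :
  pdiff Y (pcst 0) (pcst 0) (fun i => x * V i)%ps e
  = (x * pdiff Y (pcst 0) (pcst 0) V e)%ps.
Proof.
  unfold pdiff; induction e; simpl; try ring;
    rewrite ?IHe1, ?IHe2, ?IHe; ring.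
Qed.

Section Linearization.
Variable Y0 : unknown -> C.

Definition val0 : poly -> C := cval 0 0 Y0.
Definition lin0 : (unknown -> C) -> poly -> C := cdiff 0 0 Y0 0 0.

Definition lin (y : unknown -> ps) : poly -> ps :=
  dinterp padd pmul popp pcst (pcst 0) (pcst 0) (fun i => pcst (Y0 i))
    (pcst 0) (pcst 0) y.

Definition around (y : unknown -> ps) : unknown -> ps :=
  fun i => (pcst (Y0 i) + y i)%ps.

(** The terms of weight at least two when [t], [s] have weight two and the [y i]
    weight one. *)
Definition rem (y : unknown -> ps) (e : poly) : ps :=
  (pval (around y) e - pcst (val0 e) - lin y e)%ps.

Lemma interp_base e :
  interp padd pmul popp pcst (pcst 0) (pcst 0) (fun i => pcst (Y0 i)) e
  = pcst (val0 e).
Proof.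
  unfold val0, cval; induction e; simpl; auto;
    rewrite ?IHe1, ?IHe2, ?IHe, ?pcst_add, ?pcst_opp, ?pcst_pcst; reflexivity.
Qed.

Lemma lin_Mul y e1 e2 :
  lin y (Mul e1 e2)
  = (lin y e1 * pcst (val0 e2) + pcst (val0 e1) * lin y e2)%ps.
Proof. unfold lin; simpl; rewrite !interp_base; reflexivity. Qed.

Lemma lin_coef y e m n : lin y e m n = lin0 (fun i => y i m n) e.
Proof.
  unfold lin0, cdiff.
  induction e; try reflexivity; try apply pcst_zero.
  - change (lin y (Add e1 e2) m n) with (lin y e1 m n + lin y e2 m n).
    rewrite IHe1, IHe2; reflexivity.
  - change (lin y (Opp e) m n) with (- lin y e m n).
    rewrite IHe; reflexivity.
  - rewrite lin_Mul.
    change ((lin y e1 * pcst (val0 e2) + pcst (val0 e1) * lin y e2)%ps m n)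
      with ((lin y e1 * pcst (val0 e2))%ps m n
            + (pcst (val0 e1) * lin y e2)%ps m n).
    rewrite (Rmul_comm ps_ring (lin y e1)), !pcst_mul, IHe1, IHe2.
    simpl; unfold val0, cval; ring.
Qed.

Lemma lin0_zero e : lin0 (fun _ => 0) e = 0.
Proof.
  unfold lin0, cdiff; induction e; simpl; try reflexivity;
    [rewrite IHe1, IHe2|rewrite IHe|rewrite IHe1, IHe2]; ring.
Qed.

Lemma rem_Mul y e1 e2 :
  rem y (Mul e1 e2)
  = ((lin y e1 + rem y e1) * (lin y e2 + rem y e2)
     + pcst (val0 e1) * rem y e2 + pcst (val0 e2) * rem y e1)%ps.
Proof.
  unfold rem at 1; rewrite lin_Mul.
  change (pval (around y) (Mul e1 e2))
    with (pval (around y) e1 * pval (around y) e2)%ps.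
  change (val0 (Mul e1 e2)) with (val0 e1 * val0 e2); rewrite pcst_pcst.
  unfold rem; ring.
Qed.

Lemma rem_Add y e1 e2 : rem y (Add e1 e2) = (rem y e1 + rem y e2)%ps.
Proof.
  unfold rem; change (val0 (Add e1 e2)) with (val0 e1 + val0 e2).
  rewrite pcst_add; unfold lin, pval; simpl; ring.
Qed.

Lemma rem_Opp y e : rem y (Opp e) = (- rem y e)%ps.
Proof.
  unfold rem; change (val0 (Opp e)) with (- val0 e).
  rewrite pcst_opp; unfold lin, pval; simpl; ring.
Qed.

Lemma rem_Cst y c : rem y (Cst c) = pcst 0.
Proof. unfold rem, lin, pval, val0, cval; simpl; ring. Qed.
Lemma rem_Tvar y : rem y Tvar = pT.
Proof. unfold rem, lin, pval, val0, cval; simpl; ring. Qed.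
Lemma rem_Svar y : rem y Svar = pS.
Proof. unfold rem, lin, pval, val0, cval; simpl; ring. Qed.
Lemma rem_Var y i : rem y (Var i) = pcst 0.
Proof. unfold rem, lin, pval, val0, cval, around; simpl; ring. Qed.

(** Size of the linear part and of the remainder in terms of a bound [delta] on
    the unknowns; the remainder gains because it is of order one in [t], [s]
    and of order two in [y]. *)
Lemma lin_majorized e :
  exists K, (0 <= K)%R /\ forall rho delta y, (0 <= rho)%R -> (0 <= delta)%R ->
    (forall i, majorized rho delta (y i)) -> majorized rho (K * delta) (lin y e).
Proof.
  induction e.
  - exists 0%R; split; [lra|]; intros; rewrite Rmult_0_l; now apply majorized_zero.
  - exists 0%R; split; [lra|]; intros; rewrite Rmult_0_l; now apply majorized_zero.
  - exists 0%R; split; [lra|]; intros; rewrite Rmult_0_l; now apply majorized_zero.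
  - exists 1%R; split; [lra|]; intros; rewrite Rmult_1_l; apply H1.
  - destruct IHe1 as [K1 [H1 B1]], IHe2 as [K2 [H2 B2]].
    exists (K1 + K2)%R; split; [lra|]; intros.
    rewrite Rmult_plus_distr_r; apply majorized_add; auto.
  - destruct IHe as [K [HK B]]; exists K; split; [lra|]; intros.
    apply majorized_opp; auto.
  - destruct IHe1 as [K1 [H1 B1]], IHe2 as [K2 [H2 B2]].
    pose proof (Cmod_ge_0 (val0 e1)); pose proof (Cmod_ge_0 (val0 e2)).
    exists (K1 * Cmod (val0 e2) + Cmod (val0 e1) * K2)%R; split; [nra|].
    intros; rewrite lin_Mul.
    replace ((K1 * Cmod (val0 e2) + Cmod (val0 e1) * K2) * delta)%R
      with (K1 * delta * Cmod (val0 e2) + Cmod (val0 e1) * (K2 * delta))%R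
      by ring.
    apply majorized_add; [assumption|apply majorized_mul..];
      auto using majorized_cst.
Qed.

Lemma rem_majorized e :
  exists K, (0 <= K)%R /\ forall rho delta y,
    (0 <= rho <= 1)%R -> (0 <= delta <= 1)%R ->
    (forall i, majorized rho delta (y i)) ->
    majorized rho (K * (rho + delta * delta)) (rem y e).
Proof.
  induction e.
  - exists 0%R; split; [lra|]; intros rho delta y Hr Hd Hy.
    rewrite Rmult_0_l, rem_Cst; now apply majorized_zero.
  - exists 1%R; split; [lra|]; intros rho delta y Hr Hd Hy.
    rewrite Rmult_1_l, rem_Tvar.
    apply majorized_le with rho; [nra|apply majorized_T, Hr].
  - exists 1%R; split; [lra|]; intros rho delta y Hr Hd Hy.
    rewrite Rmult_1_l, rem_Svar.
    apply majorized_le with rho; [nra|apply majorized_S, Hr].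
  - exists 0%R; split; [lra|]; intros rho delta y Hr Hd Hy.
    rewrite Rmult_0_l, rem_Var; now apply majorized_zero.
  - destruct IHe1 as [K1 [H1 B1]], IHe2 as [K2 [H2 B2]].
    exists (K1 + K2)%R; split; [lra|]; intros rho delta y Hr Hd Hy.
    rewrite rem_Add, Rmult_plus_distr_r; apply majorized_add; [apply Hr|auto..].
  - destruct IHe as [K [HK B]]; exists K; split; [lra|].
    intros rho delta y Hr Hd Hy.
    rewrite rem_Opp; apply majorized_opp; [apply Hr|auto].
  - destruct IHe1 as [R1 [HR1 B1]], IHe2 as [R2 [HR2 B2]].
    destruct (lin_majorized e1) as [K1 [HK1 maximal_ideal]].
    destruct (lin_majorized e2) as [K2 [HK2 L2]].
    pose proof (Cmod_ge_0 (val0 e1)) as Hc1.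
    pose proof (Cmod_ge_0 (val0 e2)) as Hc2.
    set (c1 := Cmod (val0 e1)) in *; set (c2 := Cmod (val0 e2)) in *.
    exists (K1 * K2 + K1 * R2 + K2 * R1 + 2 * (R1 * R2) + c1 * R2 + c2 * R1)%R.
    split.
    { repeat apply Rplus_le_le_0_compat;
        repeat apply Rmult_le_pos; assumption || lra. }
    intros rho delta y Hr Hd Hy; rewrite rem_Mul.
    set (x := (rho + delta * delta)%R).
    assert (Hx : (0 <= x <= 2)%R) by (unfold x; nra).
    assert (Hdx : (delta * delta <= x)%R) by (unfold x; lra).
    apply majorized_le with
      ((K1 * delta + R1 * x) * (K2 * delta + R2 * x)
        + c1 * (R2 * x) + c2 * (R1 * x))%R.
    { assert ((K1 * K2) * (delta * delta) <= (K1 * K2) * x)%R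
        by (apply Rmult_le_compat_l; [apply Rmult_le_pos|]; assumption).
      assert ((K1 * R2 + K2 * R1) * (delta * x)
              <= (K1 * R2 + K2 * R1) * (1 * x))%R.
      { apply Rmult_le_compat_l;
          [apply Rplus_le_le_0_compat; apply Rmult_le_pos; assumption|].
        apply Rmult_le_compat_r; [apply Hx|apply Hd]. }
      assert ((R1 * R2) * (x * x) <= (R1 * R2) * (2 * x))%R.
      { apply Rmult_le_compat_l; [apply Rmult_le_pos; assumption|].
        apply Rmult_le_compat_r; apply Hx. }
      lra. }
    destruct Hr as [Hr Hr1], Hd as [Hd Hd1].
    repeat apply majorized_add; try apply majorized_mul; try apply majorized_add;
      try assumption; try apply majorized_cst; unfold x; auto.
Qed.

(** Because the remainder has no term linear in [y], an agreement of [y] and [y']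
    to order [k] is improved by one order; this is what makes the coefficients
    of the iterates below stationary. *)
Lemma rem_agree e k y y' :
  (forall i, ord_ge 1 (y i)) -> (forall i, ord_ge 1 (y' i)) ->
  (forall i, ord_ge k (y i - y' i)%ps) ->
  ord_ge 1 (lin y e + rem y e)%ps /\
  ord_ge k (lin y e - lin y' e)%ps /\
  ord_ge (S k) (rem y e - rem y' e)%ps.
Proof.
  intros Hy Hy' Hk.
  assert (Z : forall a j, ord_ge j (a - a)%ps).
  { intros a j; replace (a - a)%ps with (pcst 0) by ring; apply ord_ge_zero. }
  assert (Main : (ord_ge 1 (lin y e + rem y e)%ps /\
     ord_ge 1 (lin y' e + rem y' e)%ps) /\
    ord_ge k (lin y e - lin y' e)%ps /\
    ord_ge (S k) (rem y e - rem y' e)%ps); [|tauto].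
  induction e.
  - rewrite !rem_Cst; unfold lin; simpl; repeat split; try apply Z;
      apply ord_ge_add; apply ord_ge_zero.
  - rewrite !rem_Tvar; unfold lin; simpl; repeat split; try apply Z;
      apply ord_ge_add; apply ord_ge_zero || apply ord_ge_T.
  - rewrite !rem_Svar; unfold lin; simpl; repeat split; try apply Z;
      apply ord_ge_add; apply ord_ge_zero || apply ord_ge_S.
  - rewrite !rem_Var; unfold lin; simpl; repeat split; try apply Z; auto;
      apply ord_ge_add; auto; apply ord_ge_zero.
  - destruct IHe1 as [[A1 A1'] [B1 D1]], IHe2 as [[A2 A2'] [B2 D2]].
    rewrite !rem_Add; unfold lin in *; simpl.
    repeat split;
    match goal with
    | |- ord_ge ?j ((?a + ?b) + (?c + ?d))%ps =>
        replace ((a + b) + (c + d))%ps with ((a + c) + (b + d))%ps by ring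
    | |- ord_ge ?j ((?a + ?b) - (?c + ?d))%ps =>
        replace ((a + b) - (c + d))%ps with ((a - c) + (b - d))%ps by ring
    end; apply ord_ge_add; assumption.
  - destruct IHe as [[A1 A1'] [B1 D1]].
    rewrite !rem_Opp; unfold lin in *; simpl.
    repeat split;
    match goal with
    | |- ord_ge ?j (- ?a + - ?b)%ps =>
        replace (- a + - b)%ps with (- (a + b))%ps by ring
    | |- ord_ge ?j (- ?a - - ?b)%ps =>
        replace (- a - - b)%ps with (- (a - b))%ps by ring
    end; apply ord_ge_opp; assumption.
  - destruct IHe1 as [[A1 A1'] [B1 D1]], IHe2 as [[A2 A2'] [B2 D2]].
    rewrite !rem_Mul, !lin_Mul.
    set (l1 := lin y e1) in *; set (l2 := lin y e2) in *.
    set (l1' := lin y' e1) in *; set (l2' := lin y' e2) in *.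
    set (r1 := rem y e1) in *; set (r2 := rem y e2) in *.
    set (r1' := rem y' e1) in *; set (r2' := rem y' e2) in *.
    set (c1 := pcst (val0 e1)); set (c2 := pcst (val0 e2)).
    repeat split.
    + replace (l1 * c2 + c1 * l2 + ((l1 + r1) * (l2 + r2) + c1 * r2 + c2 * r1))%ps
        with ((l1 + r1) * (l2 + r2 + c2) + c1 * (l2 + r2))%ps by ring.
      apply ord_ge_add; [apply (ord_ge_mul 1 0)|apply (ord_ge_mul 0 1)];
        assumption || apply ord_ge_0.
    + replace (l1' * c2 + c1 * l2'
               + ((l1' + r1') * (l2' + r2') + c1 * r2' + c2 * r1'))%ps
        with ((l1' + r1') * (l2' + r2' + c2) + c1 * (l2' + r2'))%ps by ring.
      apply ord_ge_add; [apply (ord_ge_mul 1 0)|apply (ord_ge_mul 0 1)];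
        assumption || apply ord_ge_0.
    + replace (l1 * c2 + c1 * l2 - (l1' * c2 + c1 * l2'))%ps
        with (c2 * (l1 - l1') + c1 * (l2 - l2'))%ps by ring.
      apply ord_ge_add; apply (ord_ge_mul 0 k); assumption || apply ord_ge_0.
    + replace ((l1 + r1) * (l2 + r2) + c1 * r2 + c2 * r1
               - ((l1' + r1') * (l2' + r2') + c1 * r2' + c2 * r1'))%ps
        with ((((l1 - l1') + (r1 - r1')) * (l2 + r2)
               + (l1' + r1') * ((l2 - l2') + (r2 - r2')))
              + (c1 * (r2 - r2') + c2 * (r1 - r1')))%ps by ring.
      apply ord_ge_add; apply ord_ge_add.
      * replace (S k) with (k + 1)%nat by lia.
        apply ord_ge_mul; [|assumption].
        apply ord_ge_add; [assumption|].
        apply ord_ge_le with (2 := D1); lia.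
      * apply (ord_ge_mul 1 k); [assumption|].
        apply ord_ge_add; [assumption|].
        apply ord_ge_le with (2 := D2); lia.
      * apply (ord_ge_mul 0 (S k)); [apply ord_ge_0|assumption].
      * apply (ord_ge_mul 0 (S k)); [apply ord_ge_0|assumption].
Qed.
End Linearization.


(** * Solving one nonresonant equation *)

Definition vnorm (v : unknown -> C) : R := sum4 (fun i => Cmod (v i)).

Definition pabs (a : ps) : ps := fun m n => RtoC (Cmod (a m n)).

Section Nonresonant.
Variables (Y0 : unknown -> C) (a b : nat) (H : unknown -> poly).

Let M (v : unknown -> C) : unknown -> C := fun i => lin0 Y0 v (H i).

(** The decay in [k] makes up for the derivative [theta_s] in [source] below. *)
Record resolvent (Rk : nat -> (unknown -> C) -> unknown -> C) (K : R) : Prop := {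
  res_pos : (0 <= K)%R;
  res_sol : forall k r i, RtoC (INR k) * Rk k r i - M (Rk k r) i = r i;
  res_uniq : forall k (v : unknown -> C), (forall i, RtoC (INR k) * v i = M v i) ->
    forall i, v i = 0;
  res_bound : forall k r i,
    (Cmod (Rk k r i) <= K / (INR k + 1) * vnorm r)%R }.

(** [a * t d/dt + b * s (1 - s) d/ds], for which [t ^ m * s ^ n] has the weight
    [a * m + b * n]. *)
Definition euler_op (y : ps) : ps :=
  (pcst (RtoC (INR a)) * theta_t y + pcst (RtoC (INR b)) * delta_s y)%ps.

(** Everything but the diagonal part of [L y = M y + rem], the last term being
    the off-diagonal part of [delta_s]. *)
Definition source (y : unknown -> ps) (i : unknown) : ps :=
  (rem Y0 y (H i) + pcst (RtoC (INR b)) * (pS * theta_s (y i)))%ps.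

Lemma pS_theta_s y m n :
  (pS * theta_s y)%ps m n
  = match n with O => 0 | S n' => RtoC (INR n') * y m n' end.
Proof. rewrite pS_mul; destruct n; reflexivity. Qed.

Lemma euler_op_coef y m n :
  euler_op y m n
  = RtoC (INR (a * m + b * n)) * y m n
    - RtoC (INR b) * (pS * theta_s y)%ps m n.
Proof.
  unfold euler_op, padd; simpl; rewrite !pcst_mul, delta_s_coef, pS_theta_s.
  rewrite plus_INR, !mult_INR, RtoC_plus, !RtoC_mult; unfold theta_t.
  destruct n; simpl; ring.
Qed.

Variables (Rk : nat -> (unknown -> C) -> unknown -> C) (K0 : R).
Hypothesis HR : resolvent Rk K0.
Hypothesis Hbase : forall i, val0 Y0 (H i) = 0.

(** One linear equation in [C ^ 4] for each bidegree, with the source frozen. *)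
Definition step (y : unknown -> ps) : unknown -> ps := fun i m n =>
  Rk (a * m + b * n) (fun j => source y j m n) i.

Lemma vnorm_zero (v : unknown -> C) : (forall i, v i = 0) -> vnorm v = 0%R.
Proof. intros E; unfold vnorm, sum4; rewrite !E, Cmod_0; ring. Qed.

Lemma step_zero y m n : (forall j, source y j m n = 0) ->
  forall i, step y i m n = 0.
Proof.
  intros E i; apply Cmod_eq_0, Rle_antisym; [|apply Cmod_ge_0].
  apply Rle_trans with (1 := res_bound _ _ HR _ _ _).
  rewrite (vnorm_zero (fun j => source y j m n) E); lra.
Qed.

Lemma source_ord1 y : (forall i, ord_ge 1 (y i)) ->
  forall i, ord_ge 1 (source y i).
Proof.
  intros Hy i.
  assert (E : ord_ge 1 (rem Y0 y (H i))).
  { destruct (rem_agree Y0 (H i) 0 y (fun _ => pcst 0) Hy) as [E _].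
    - intros j; apply ord_ge_zero.
    - intros j; apply ord_ge_0.
    - intros m n Hmn; specialize (E m n Hmn); unfold padd in E; simpl in E.
      rewrite lin_coef in E.
      replace (lin0 Y0 (fun i0 => y i0 m n) (H i)) with (RtoC 0) in E.
      { rewrite Cplus_0_l in E; exact E. }
      assert (Z : (fun i0 => y i0 m n) = fun _ => RtoC 0).
      { apply functional_extensionality; intros j; apply (Hy j m n Hmn). }
      rewrite Z, lin0_zero; reflexivity. }
  apply ord_ge_add; [exact E|]; intros m n Hmn; rewrite pcst_mul, pS_theta_s.
  replace n with O by lia; ring.
Qed.

Lemma source_agree k y y' :
  (forall i, ord_ge 1 (y i)) -> (forall i, ord_ge 1 (y' i)) ->
  (forall i, ord_ge k (y i - y' i)%ps) ->
  forall i, ord_ge (S k) (source y i - source y' i)%ps.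
Proof.
  intros Hy Hy' Hk i.
  destruct (rem_agree Y0 (H i) k y y' Hy Hy' Hk) as [_ [_ E]].
  unfold source.
  replace (rem Y0 y (H i) + pcst (RtoC (INR b)) * (pS * theta_s (y i)) -
     (rem Y0 y' (H i) + pcst (RtoC (INR b)) * (pS * theta_s (y' i))))%ps
    with ((rem Y0 y (H i) - rem Y0 y' (H i))
          + pcst (RtoC (INR b)) * (pS * theta_s (y i) - pS * theta_s (y' i)))%ps
    by ring.
  apply ord_ge_add; [exact E|].
  intros m n Hmn; rewrite pcst_mul; unfold psub; simpl; rewrite !pS_theta_s.
  destruct n as [|n]; [ring|].
  assert (F : y i m n - y' i m n = 0) by (apply (Hk i m n); lia).
  replace (y i m n) with (y' i m n + (y i m n - y' i m n)) by ring.
  rewrite F; ring.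
Qed.

Lemma psub_eq0 (x y : ps) m n : (x - y)%ps m n = 0 -> x m n = y m n.
Proof.
  unfold psub; simpl; intros E.
  replace (x m n) with (y m n + (x m n - y m n)) by ring; rewrite E; ring.
Qed.

Lemma step_agree k y y' :
  (forall i, ord_ge 1 (y i)) -> (forall i, ord_ge 1 (y' i)) ->
  (forall i, ord_ge k (y i - y' i)%ps) ->
  forall i, ord_ge (S k) (step y i - step y' i)%ps.
Proof.
  intros Hy Hy' Hk i m n Hmn; unfold psub; simpl; unfold step.
  replace (fun j => source y j m n) with (fun j => source y' j m n); [ring|].
  apply functional_extensionality; intros j; symmetry; apply psub_eq0.
  apply (source_agree k y y' Hy Hy' Hk j m n Hmn).
Qed.

(** In [Rk] the factor [1 / (k + 1)] absorbs the unbounded derivation coming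
    from the factor [1 - s]. *)
Lemma step_coef_le y i m n :
  (Cmod (step y i m n)
   <= K0 * (sum4 (fun j => Cmod (rem Y0 y (H j) m n))
            + sum4 (fun j => Cmod ((pS * y j)%ps m n))))%R.
Proof.
  pose proof (res_pos _ _ HR) as HK.
  apply Rle_trans with (1 := res_bound _ _ HR _ _ _).
  set (k := (a * m + b * n)%nat).
  assert (Hk : (0 < INR k + 1)%R) by (pose proof (pos_INR k); lra).
  assert (Hi : (0 < / (INR k + 1) <= 1)%R).
  { split; [apply Rinv_0_lt_compat, Hk|].
    rewrite <- Rinv_1; apply Rinv_le_contravar; [lra|].
    pose proof (pos_INR k); lra. }
  assert (E : forall j, (Cmod (source y j m n) * / (INR k + 1)
    <= Cmod (rem Y0 y (H j) m n) + Cmod ((pS * y j)%ps m n))%R).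
  { intros j; unfold source, padd; simpl.
    rewrite pcst_mul, pS_theta_s, pS_mul.
    apply Rle_trans with ((Cmod (rem Y0 y (H j) m n)
       + Cmod (RtoC (INR b) * match n with O => 0
            | S n' => RtoC (INR n') * y j m n' end)) * / (INR k + 1))%R.
    { apply Rmult_le_compat_r; [lra|apply Cmod_triangle]. }
    rewrite Rmult_plus_distr_r; apply Rplus_le_compat.
    - rewrite <- (Rmult_1_r (Cmod (rem _ _ _ _ _))) at 2.
      apply Rmult_le_compat_l; [apply Cmod_ge_0|lra].
    - destruct n as [|n']; [rewrite Cmult_0_r, Cmod_0; lra|].
      rewrite !Cmod_mult, !Cmod_R, !Rabs_pos_eq by apply pos_INR.
      rewrite <- Rmult_assoc, <- mult_INR.
      replace (INR (b * n') * Cmod (y j m n') * / (INR k + 1))%R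
        with (INR (b * n') * / (INR k + 1) * Cmod (y j m n'))%R by ring.
      rewrite <- (Rmult_1_l (Cmod (y j m n'))) at 2.
      apply Rmult_le_compat_r; [apply Cmod_ge_0|].
      apply Rmult_le_reg_r with (INR k + 1)%R; [exact Hk|].
      rewrite Rmult_assoc, Rinv_l, Rmult_1_r, Rmult_1_l by lra.
      assert (INR (b * n') <= INR k)%R by (apply le_INR; unfold k; nia).
      lra. }
  unfold Rdiv; rewrite Rmult_assoc; apply Rmult_le_compat_l; [exact HK|].
  unfold vnorm, sum4.
  pose proof (E Q1); pose proof (E Q2); pose proof (E P1); pose proof (E P2).
  lra.
Qed.

Lemma step_majorized :
  exists K, (0 <= K)%R /\ forall rho delta y,
    (0 <= rho <= 1)%R -> (0 <= delta <= 1)%R ->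
    (forall i, majorized rho delta (y i)) ->
    forall i, majorized rho (K * (rho + delta * delta)) (step y i).
Proof.
  destruct (rem_majorized Y0 (H Q1)) as [K1 [HK1 B1]].
  destruct (rem_majorized Y0 (H Q2)) as [K2 [HK2 B2]].
  destruct (rem_majorized Y0 (H P1)) as [K3 [HK3 B3]].
  destruct (rem_majorized Y0 (H P2)) as [K4 [HK4 B4]].
  pose proof (res_pos _ _ HR) as HK.
  exists (K0 * (K1 + K2 + K3 + K4 + 4))%R; split; [nra|].
  intros rho delta y Hr Hd Hy i.
  assert (HS : forall j, majorized rho (rho * delta) (pS * y j)).
  { intros j; apply majorized_mul; [apply Hr|apply majorized_S, Hr|apply Hy]. }
  assert (Habs : forall d x, majorized rho d x -> majorized rho d (pabs x)).
  { intros d x; apply majorized_abs, Hr. }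
  set (x := (rho + delta * delta)%R).
  set (B := (pcst (RtoC K0) *
    (((pabs (rem Y0 y (H Q1)) + pabs (rem Y0 y (H Q2)))
     + (pabs (rem Y0 y (H P1)) + pabs (rem Y0 y (H P2))))
    + ((pabs (pS * y Q1) + pabs (pS * y Q2))
     + (pabs (pS * y P1) + pabs (pS * y P2)))))%ps).
  apply majorized_dominated with B; [apply Hr| |].
  - intros m n; apply Rle_trans with (1 := step_coef_le y i m n).
    unfold B; rewrite pcst_mul; unfold padd, pabs; simpl.
    rewrite <- !RtoC_plus, <- RtoC_mult, Cmod_R.
    apply Rle_trans with (2 := Rle_abs _).
    apply Rmult_le_compat_l; [exact HK|]; unfold sum4; lra.
  - apply majorized_le with (Cmod (RtoC K0)
      * (((K1 * x + K2 * x) + (K3 * x + K4 * x))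
       + ((rho * delta + rho * delta) + (rho * delta + rho * delta))))%R.
    + rewrite Cmod_R, Rabs_pos_eq by exact HK; rewrite Rmult_assoc.
      apply Rmult_le_compat_l; [exact HK|].
      assert (rho * delta <= x)%R by (unfold x; nra); lra.
    + assert (Hr0 : (0 <= rho)%R) by apply Hr.
      apply majorized_mul; [exact Hr0|apply majorized_cst|].
      repeat apply majorized_add; try exact Hr0; apply Habs;
        first [apply B1|apply B2|apply B3|apply B4|apply HS]; assumption.
Qed.

Fixpoint iterate (k : nat) : unknown -> ps :=
  match k with
  | O => fun _ => pcst 0
  | S k' => step (iterate k')
  end.

Lemma iterate_ord1 k i : ord_ge 1 (iterate k i).
Proof.
  revert i; induction k as [|k IH]; intros i; [apply ord_ge_zero|].
  intros m n Hmn; apply step_zero; intros j.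
  apply (source_ord1 _ IH j m n Hmn).
Qed.

Lemma iterate_agree k i : ord_ge k (iterate (S k) i - iterate k i)%ps.
Proof.
  revert i; induction k as [|k IH]; intros i; [apply ord_ge_0|].
  apply (step_agree k (iterate (S k)) (iterate k));
    [intros j; apply iterate_ord1..|exact IH].
Qed.

(** The coefficient at [(m, n)] no longer changes after [m + n + 1] steps. *)
Definition limit : unknown -> ps := fun i m n => iterate (S (m + n)) i m n.

Lemma iterate_limit k i m n :
  (m + n < k)%nat -> iterate k i m n = limit i m n.
Proof.
  intros Hmn; unfold limit.
  replace k with (S (m + n) + (k - S (m + n)))%nat by lia.
  induction (k - S (m + n))%nat as [|d IH]; [rewrite Nat.add_0_r; reflexivity|].
  rewrite <- IH, Nat.add_succ_r; apply psub_eq0.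
  apply iterate_agree; lia.
Qed.

Lemma limit_ord1 i : ord_ge 1 (limit i).
Proof. intros m n Hmn; apply iterate_ord1; exact Hmn. Qed.

Lemma limit_fixed i m n : limit i m n = step limit i m n.
Proof.
  rewrite <- (iterate_limit (S (m + n))) by lia; simpl.
  apply psub_eq0.
  apply (step_agree (m + n)); [apply iterate_ord1|apply limit_ord1| |lia].
  intros j m' n' Hmn; unfold psub; simpl.
  rewrite iterate_limit by exact Hmn; ring.
Qed.

Lemma limit_majorized :
  exists rho delta, (0 < rho <= 1)%R /\
    forall i, majorized rho delta (limit i).
Proof.
  destruct step_majorized as [K [HK B]].
  (* with rho = delta ^ 2 the bound K (rho + delta ^ 2) is below delta *)
  set (delta := (/ (2 * K + 1))%R).
  assert (Hd : (0 < delta <= 1)%R).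
  { unfold delta; split; [apply Rinv_0_lt_compat; lra|].
    rewrite <- Rinv_1; apply Rinv_le_contravar; lra. }
  assert (HKd : (K * (delta * delta + delta * delta) <= delta)%R).
  { assert (E : ((2 * K + 1) * delta = 1)%R)
      by (unfold delta; apply Rinv_r; lra).
    nra. }
  exists (delta * delta)%R, delta; split; [nra|]; intros i.
  assert (Hr : (0 <= delta * delta)%R) by nra.
  assert (Hit : forall k j, majorized (delta * delta) delta (iterate k j)).
  { induction k as [|k IH]; intros j.
    - apply majorized_le with 0%R; [lra|apply majorized_zero].
    - apply majorized_le with (1 := HKd); apply B; auto; nra. }
  intros K'; apply Rle_trans with (2 := Hit (S (K' + K')) i K').
  apply norm1_le; [exact Hr|]; intros m Hm.
  apply norm1_le; [exact Hr|]; intros n Hn.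
  rewrite iterate_limit by lia; apply Rle_refl.
Qed.

Lemma limit_solves i : euler_op (around Y0 limit i) = pval (around Y0 limit) (H i).
Proof.
  assert (E : euler_op (limit i) = (lin Y0 limit (H i) + rem Y0 limit (H i))%ps).
  { apply ps_ext; intros m n; rewrite euler_op_coef.
    unfold padd; simpl; rewrite lin_coef.
    pose proof (res_sol _ _ HR (a * m + b * n)
                  (fun j => source limit j m n) i) as E.
    fold (step limit i m n) in E; rewrite <- limit_fixed in E.
    unfold M in E.
    replace (Rk (a * m + b * n) (fun j => source limit j m n))
      with (fun j => limit j m n) in E.
    2:{ apply functional_extensionality; intros j; apply limit_fixed. }
    unfold source, padd in E; simpl in E; rewrite pcst_mul in E.
    replace (rem Y0 limit (H i) m n) with
      (rem Y0 limit (H i) m n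
       + RtoC (INR b) * (pS * theta_s (limit i))%ps m n
       - RtoC (INR b) * (pS * theta_s (limit i))%ps m n) by ring.
    rewrite <- E; ring. }
  replace (euler_op (around Y0 limit i)) with (euler_op (limit i)).
  { rewrite E; unfold rem; rewrite Hbase; ring. }
  unfold euler_op, around.
  rewrite (der_add _ theta_t_derivation), (der_add _ delta_s_derivation).
  rewrite (der_cst _ theta_t_derivation), (der_cst _ delta_s_derivation); ring.
Qed.

(** The lowest homogeneous part of a nonzero solution would lie in the kernel of
    some [k - M]. *)
Lemma variational_unique y Z :
  (forall i, ord_ge 1 (y i)) ->
  (forall i, euler_op (Z i)
     = pdiff (around Y0 y) (pcst 0) (pcst 0) Z (H i)) ->
  forall i, Z i = pcst 0.
Proof.
  intros Hy HZ.
  assert (D : forall k e, (forall i, ord_ge k (Z i)) ->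
    ord_ge k (pdiff (around Y0 y) (pcst 0) (pcst 0) Z e) /\
    ord_ge (S k)
      (pdiff (around Y0 y) (pcst 0) (pcst 0) Z e - lin Y0 Z e)%ps).
  { intros k e Hk; unfold pdiff; induction e; simpl.
    1-3: split; [apply ord_ge_zero|]; unfold lin; simpl.
    1-3: replace (pcst 0 - pcst 0)%ps with (pcst 0) by ring;
      apply ord_ge_zero.
    - split; [apply Hk|]; unfold lin; simpl.
      replace (Z i - Z i)%ps with (pcst 0) by ring; apply ord_ge_zero.
    - destruct IHe1 as [A1 B1], IHe2 as [A2 B2].
      split; [apply ord_ge_add; assumption|].
      change (lin Y0 Z (Add e1 e2)) with (lin Y0 Z e1 + lin Y0 Z e2)%ps.
      match goal with |- ord_ge _ ((?p + ?q) - (?r + ?s))%ps =>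
        replace ((p + q) - (r + s))%ps with ((p - r) + (q - s))%ps by ring end.
      apply ord_ge_add; assumption.
    - destruct IHe as [A1 B1].
      split; [apply ord_ge_opp; assumption|].
      change (lin Y0 Z (Opp e)) with (- lin Y0 Z e)%ps.
      match goal with |- ord_ge _ (- ?p - - ?q)%ps =>
        replace (- p - - q)%ps with (- (p - q))%ps by ring end.
      apply ord_ge_opp; assumption.
    - destruct IHe1 as [A1 B1], IHe2 as [A2 B2]; rewrite lin_Mul.
      assert (V : forall e, exists u, ord_ge 1 u /\
        interp padd pmul popp pcst pT pS (around Y0 y) e
        = (pcst (val0 Y0 e) + u)%ps).
      { intros e; exists (lin Y0 y e + rem Y0 y e)%ps; split.
        - apply (rem_agree Y0 e 0 y y Hy Hy); intros j; apply ord_ge_0.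
        - unfold rem, pval; ring. }
      destruct (V e1) as [u1 [U1 E1]], (V e2) as [u2 [U2 E2]].
      split.
      + apply ord_ge_add.
        * replace k with (k + 0)%nat by lia.
          apply ord_ge_mul; [assumption|apply ord_ge_0].
        * apply (ord_ge_mul 0 k); [apply ord_ge_0|assumption].
      + rewrite E1, E2.
        match goal with |- ord_ge _
          (?p * (?c2 + ?u2) + (?c1 + ?u1) * ?q - (?r * ?c2 + ?c1 * ?s))%ps =>
          replace (p * (c2 + u2) + (c1 + u1) * q - (r * c2 + c1 * s))%ps
            with (((p - r) * c2 + c1 * (q - s)) + (p * u2 + u1 * q))%ps by ring
        end.
        replace (S k) with (k + 1)%nat by lia.
        repeat apply ord_ge_add.
        * replace (k + 1)%nat with (S k + 0)%nat by lia.
          apply ord_ge_mul; [assumption|apply ord_ge_0].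
        * replace (k + 1)%nat with (0 + S k)%nat by lia.
          apply ord_ge_mul; [apply ord_ge_0|assumption].
        * apply ord_ge_mul; assumption.
        * rewrite Nat.add_comm; apply ord_ge_mul; assumption. }
  assert (Main : forall k i, ord_ge k (Z i)).
  { induction k as [|k IH]; intros i; [apply ord_ge_0|].
    intros m n Hmn.
    destruct (Nat.eq_dec (m + n) k) as [Ek|Ek]; [|apply IH; lia].
    revert i; apply (res_uniq _ _ HR (a * m + b * n)); intros j; unfold M.
    rewrite <- lin_coef.
    rewrite <- (psub_eq0 _ _ m n (proj2 (D k (H j) IH) m n Hmn)).
    rewrite <- HZ, euler_op_coef, pS_theta_s.
    destruct n as [|n']; [ring|].
    rewrite (IH j m n') by lia; ring. }
  intros i; apply ps_ext; intros m n.
  rewrite pcst_zero; apply (Main (S (m + n))); lia.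
Qed.
End Nonresonant.


(** * The nonresonance condition *)

(** Beyond [2 |mu|] the distance to [mu] grows like [k]; the finitely many other
    values are not zero. *)
Lemma nonint_gap mu : ~ is_int mu ->
  exists eps, (0 < eps)%R /\
    forall k : nat, (eps * (INR k + 1) <= Cmod (RtoC (INR k) - mu))%R.
Proof.
  intros Hmu.
  assert (Hk : forall k : nat, (0 < Cmod (RtoC (INR k) - mu))%R).
  { intros k; apply Cmod_gt_0; intros E; apply Hmu; exists (Z.of_nat k).
    rewrite <- INR_IZR_INZ.
    replace mu with (RtoC (INR k) - (RtoC (INR k) - mu)) by ring.
    rewrite E; ring. }
  assert (Hfin : forall N : nat, exists eps, (0 < eps)%R /\
    forall k : nat, (k < N)%nat ->
      (eps * (INR k + 1) <= Cmod (RtoC (INR k) - mu))%R).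
  { induction N as [|N [eps [He IH]]].
    - exists 1%R; split; [lra|]; intros k Hk0; lia.
    - specialize (Hk N).
      assert (HN : (0 < INR N + 1)%R) by (pose proof (pos_INR N); lra).
      exists (Rmin eps (Cmod (RtoC (INR N) - mu) / (INR N + 1))); split.
      + apply Rmin_glb_lt; [exact He|apply Rdiv_lt_0_compat; assumption].
      + intros k Hkn; pose proof (pos_INR k).
        destruct (Nat.eq_dec k N) as [->|Hne].
        * apply Rle_trans with
            (Cmod (RtoC (INR N) - mu) / (INR N + 1) * (INR N + 1))%R.
          -- apply Rmult_le_compat_r; [lra|apply Rmin_r].
          -- right; field; lra.
        * apply Rle_trans with (eps * (INR k + 1))%R; [|apply IH; lia].
          apply Rmult_le_compat_r; [lra|apply Rmin_l]. }
  destruct (Hfin (S (Z.to_nat (up (2 * Cmod mu + 1))))) as [eps [He Hf]].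
  exists (Rmin eps (1 / 4)); split; [apply Rmin_glb_lt; lra|]; intros k.
  pose proof (pos_INR k) as Hk0; pose proof (Cmod_ge_0 mu) as Hm0.
  destruct (Nat.lt_ge_cases k (S (Z.to_nat (up (2 * Cmod mu + 1)))))
    as [Hlt|Hge].
  - apply Rle_trans with (2 := Hf k Hlt).
    apply Rmult_le_compat_r; [lra|apply Rmin_l].
  - assert (Hbig : (2 * Cmod mu + 1 <= INR k)%R).
    { destruct (archimed (2 * Cmod mu + 1)) as [Hup _].
      apply Rle_trans with (IZR (up (2 * Cmod mu + 1))); [lra|].
      rewrite INR_IZR_INZ; apply IZR_le; lia. }
    assert (Htri : (INR k <= Cmod (RtoC (INR k) - mu) + Cmod mu)%R).
    { rewrite <- (Rabs_pos_eq (INR k)) at 1 by exact Hk0; rewrite <- Cmod_R.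
      replace (RtoC (INR k)) with ((RtoC (INR k) - mu) + mu) at 1 by ring.
      apply Cmod_triangle. }
    apply Rle_trans with (1 / 4 * (INR k + 1))%R; [|lra].
    apply Rmult_le_compat_r; [lra|apply Rmin_r].
Qed.

Lemma nonint_sqr_gap mu : ~ is_int mu ->
  exists eps, (0 < eps)%R /\ forall k : nat,
    (eps * (INR k + 1) ^ 2 <= Cmod (RtoC (INR k) ^ 2 - mu ^ 2))%R.
Proof.
  intros Hmu.
  destruct (nonint_gap mu Hmu) as [e1 [He1 H1]].
  destruct (nonint_gap (- mu)) as [e2 [He2 H2]].
  { intros [k Hk]; apply Hmu; exists (- k)%Z.
    rewrite opp_IZR, RtoC_opp, <- Hk; ring. }
  exists (e1 * e2)%R; split; [apply Rmult_lt_0_compat; assumption|].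
  intros k; specialize (H1 k); specialize (H2 k); pose proof (pos_INR k).
  replace (RtoC (INR k) ^ 2 - mu ^ 2)
    with ((RtoC (INR k) - mu) * (RtoC (INR k) - - mu)) by ring.
  rewrite Cmod_mult.
  replace (e1 * e2 * (INR k + 1) ^ 2)%R
    with ((e1 * (INR k + 1)) * (e2 * (INR k + 1)))%R by ring.
  apply Rmult_le_compat; try assumption; apply Rmult_le_pos; lra.
Qed.

Lemma Cmod_le_vnorm (v : unknown -> C) i : (Cmod (v i) <= vnorm v)%R.
Proof.
  unfold vnorm, sum4.
  pose proof (Cmod_ge_0 (v Q1)); pose proof (Cmod_ge_0 (v Q2)).
  pose proof (Cmod_ge_0 (v P1)); pose proof (Cmod_ge_0 (v P2)).
  destruct i; lra.
Qed.

Lemma vnorm_pos v : (0 <= vnorm v)%R.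
Proof. apply Rle_trans with (2 := Cmod_le_vnorm v Q1), Cmod_ge_0. Qed.

Lemma lin0_add Y0 (u v : unknown -> C) e :
  lin0 Y0 (fun i => u i + v i) e = lin0 Y0 u e + lin0 Y0 v e.
Proof.
  unfold lin0, cdiff; induction e; simpl; try ring;
    rewrite ?IHe1, ?IHe2, ?IHe; ring.
Qed.

Lemma lin0_scal Y0 (c : C) (v : unknown -> C) e : lin0 Y0 (fun i => c * v i) e = c * lin0 Y0 v e.
Proof.
  unfold lin0, cdiff; induction e; simpl; try ring;
    rewrite ?IHe1, ?IHe2, ?IHe; ring.
Qed.

Lemma lin0_bound Y0 e :
  exists B, (0 <= B)%R /\
    forall v, (Cmod (lin0 Y0 v e) <= B * vnorm v)%R.
Proof.
  induction e.
  1-3: exists 0%R; split; [lra|]; intros v; unfold lin0, cdiff; simpl;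
    rewrite Cmod_0; lra.
  - exists 1%R; split; [lra|]; intros v; rewrite Rmult_1_l.
    apply Cmod_le_vnorm.
  - destruct IHe1 as [B1 [H1 maximal_ideal]], IHe2 as [B2 [H2 L2]].
    exists (B1 + B2)%R; split; [lra|]; intros v.
    specialize (maximal_ideal v); specialize (L2 v).
    change (lin0 Y0 v (Add e1 e2)) with (lin0 Y0 v e1 + lin0 Y0 v e2).
    pose proof (Cmod_triangle (lin0 Y0 v e1) (lin0 Y0 v e2)); lra.
  - destruct IHe as [B [H1 L]]; exists B; split; [exact H1|]; intros v.
    change (lin0 Y0 v (Opp e)) with (- lin0 Y0 v e); rewrite Cmod_opp; auto.
  - destruct IHe1 as [B1 [H1 maximal_ideal]], IHe2 as [B2 [H2 L2]].
    pose proof (Cmod_ge_0 (val0 Y0 e1)); pose proof (Cmod_ge_0 (val0 Y0 e2)).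
    exists (B1 * Cmod (val0 Y0 e2) + Cmod (val0 Y0 e1) * B2)%R.
    split; [nra|]; intros v; specialize (maximal_ideal v); specialize (L2 v).
    change (lin0 Y0 v (Mul e1 e2))
      with (lin0 Y0 v e1 * val0 Y0 e2 + val0 Y0 e1 * lin0 Y0 v e2).
    apply Rle_trans with (1 := Cmod_triangle _ _); rewrite !Cmod_mult.
    apply Rmult_le_compat_r with (r := Cmod (val0 Y0 e2)) in maximal_ideal; [|assumption].
    apply Rmult_le_compat_l with (r := Cmod (val0 Y0 e1)) in L2; [|assumption].
    lra.
Qed.

Section Resolvent.
Variables (Y0 : unknown -> C) (H : unknown -> poly).
Let M (v : unknown -> C) : unknown -> C := fun i => lin0 Y0 v (H i).
Variables mu1 mu2 : C.
Hypotheses (Hmu1 : ~ is_int mu1) (Hmu2 : ~ is_int mu2).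
(** For the linear part of a Hamiltonian system this is the theorem of Cayley
    and Hamilton, the spectrum being symmetric: [mu1], [- mu1], [mu2],
    [- mu2]. *)
Hypothesis Hchar : forall v i,
  M (M (M (M v))) i - (mu1 ^ 2 + mu2 ^ 2) * M (M v) i
  + mu1 ^ 2 * mu2 ^ 2 * v i = 0.

Let denom (k : nat) : C :=
  (RtoC (INR k) ^ 2 - mu1 ^ 2) * (RtoC (INR k) ^ 2 - mu2 ^ 2).

Let quadratic (k : nat) (r : unknown -> C) : unknown -> C := fun i =>
  (RtoC (INR k) ^ 2 - (mu1 ^ 2 + mu2 ^ 2)) * r i + M (M r) i.

(** From [k - M] dividing [k ^ 2 - M ^ 2], which divides the characteristic
    polynomial at [k] minus the one at [M]. *)
Definition char_resolvent (k : nat) (r : unknown -> C) : unknown -> C :=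
  fun i => / denom k * (RtoC (INR k) * quadratic k r i + M (quadratic k r) i).

Lemma M_ext u v : (forall i, u i = v i) -> M u = M v.
Proof.
  intros E; replace u with v; [reflexivity|].
  apply functional_extensionality; intros i; symmetry; apply E.
Qed.

Lemma M_add (u v : unknown -> C) i : M (fun j => u j + v j) i = M u i + M v i.
Proof. apply lin0_add. Qed.

Lemma M_scal (c : C) (v : unknown -> C) i : M (fun j => c * v j) i = c * M v i.
Proof. apply lin0_scal. Qed.

Lemma M_bound : exists B, (0 <= B)%R /\
  forall v, (vnorm (M v) <= B * vnorm v)%R.
Proof.
  destruct (lin0_bound Y0 (H Q1)) as [B1 [H1 maximal_ideal]].
  destruct (lin0_bound Y0 (H Q2)) as [B2 [H2 L2]].
  destruct (lin0_bound Y0 (H P1)) as [B3 [H3 L3]].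
  destruct (lin0_bound Y0 (H P2)) as [B4 [H4 L4]].
  exists (B1 + B2 + B3 + B4)%R; split; [lra|]; intros v.
  specialize (maximal_ideal v); specialize (L2 v); specialize (L3 v); specialize (L4 v).
  unfold vnorm at 1, sum4; cbv beta; unfold M; lra.
Qed.

Lemma vnorm_add (u v : unknown -> C) : (vnorm (fun i => (u i + v i)%C) <= vnorm u + vnorm v)%R.
Proof.
  unfold vnorm, sum4.
  pose proof (Cmod_triangle (u Q1) (v Q1)).
  pose proof (Cmod_triangle (u Q2) (v Q2)).
  pose proof (Cmod_triangle (u P1) (v P1)).
  pose proof (Cmod_triangle (u P2) (v P2)).
  lra.
Qed.

Lemma vnorm_scal (c : C) (v : unknown -> C) : vnorm (fun i => c * v i) = (Cmod c * vnorm v)%R.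
Proof. unfold vnorm, sum4; rewrite !Cmod_mult; ring. Qed.

Lemma denom_gap : exists eps, (0 < eps)%R /\
  forall k, (eps * (INR k + 1) ^ 4 <= Cmod (denom k))%R.
Proof.
  destruct (nonint_sqr_gap mu1 Hmu1) as [e1 [He1 G1]].
  destruct (nonint_sqr_gap mu2 Hmu2) as [e2 [He2 G2]].
  exists (e1 * e2)%R; split; [apply Rmult_lt_0_compat; assumption|].
  intros k; specialize (G1 k); specialize (G2 k).
  unfold denom; rewrite Cmod_mult.
  replace (e1 * e2 * (INR k + 1) ^ 4)%R
    with ((e1 * (INR k + 1) ^ 2) * (e2 * (INR k + 1) ^ 2))%R by ring.
  apply Rmult_le_compat; try assumption; apply Rmult_le_pos; try lra;
    apply pow2_ge_0.
Qed.

Lemma denom_neq0 k : denom k <> 0.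
Proof.
  destruct denom_gap as [eps [He G]]; specialize (G k); intros E.
  rewrite E, Cmod_0 in G; pose proof (pos_INR k).
  assert (0 < eps * (INR k + 1) ^ 4)%R
    by (apply Rmult_lt_0_compat; [exact He|apply pow_lt; lra]).
  lra.
Qed.

Lemma char_resolvent_sol k r i :
  RtoC (INR k) * char_resolvent k r i - M (char_resolvent k r) i = r i.
Proof.
  set (kk := RtoC (INR k)); set (w := quadratic k r).
  assert (E : M (char_resolvent k r) i = / denom k * (kk * M w i + M (M w) i)).
  { unfold char_resolvent; rewrite M_scal, M_add, M_scal; reflexivity. }
  assert (E2 : M w = fun j => (kk ^ 2 - (mu1 ^ 2 + mu2 ^ 2)) * M r j
                              + M (M (M r)) j).
  { apply functional_extensionality; intros j; unfold w, quadratic.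
    rewrite M_add, M_scal; reflexivity. }
  assert (E3 : M (M w) i = (kk ^ 2 - (mu1 ^ 2 + mu2 ^ 2)) * M (M r) i
                              + M (M (M (M r))) i).
  { rewrite E2, M_add, M_scal; reflexivity. }
  rewrite E, E3; unfold char_resolvent; fold w kk.
  unfold w at 1, quadratic; fold kk.
  pose proof (Hchar r i) as Hc.
  replace (M (M (M (M r))) i)
    with ((mu1 ^ 2 + mu2 ^ 2) * M (M r) i - mu1 ^ 2 * mu2 ^ 2 * r i).
  2:{ symmetry; rewrite <- (Cplus_0_r (_ - _)), <- Hc; ring. }
  pose proof (denom_neq0 k) as Hd; unfold denom in *; fold kk in Hd |- *.
  field; split; intros Z; apply Hd; rewrite Z; ring.
Qed.

Lemma char_resolvent_uniq k (v : unknown -> C) :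
  (forall i, RtoC (INR k) * v i = M v i) -> forall i, v i = 0.
Proof.
  intros E i; set (kk := RtoC (INR k)) in *.
  assert (S1 : forall u, (forall j, kk * u j = M u j) ->
    forall j, kk * M u j = M (M u) j).
  { intros u Hu j; rewrite <- M_scal.
    apply (f_equal (fun f => f j)), M_ext, Hu. }
  pose proof (S1 v E) as E1.
  pose proof (S1 _ E1) as E2; pose proof (S1 _ E2) as E3.
  pose proof (Hchar v i) as Hc.
  rewrite <- E3, <- E2, <- E1, <- E in Hc.
  pose proof (denom_neq0 k) as Hd; unfold denom in Hd; fold kk in Hd.
  destruct (Ceq_dec (v i) 0) as [|Hv]; [assumption|exfalso].
  apply (Cmult_neq_0 _ _ Hd Hv); rewrite <- Hc; ring.
Qed.

Lemma char_resolvent_spec : exists K, resolvent Y0 H char_resolvent K.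
Proof.
  destruct M_bound as [B [HB LB]].
  destruct denom_gap as [eps [He G]].
  set (sg := Cmod (mu1 ^ 2 + mu2 ^ 2)).
  assert (Hsg : (0 <= sg)%R) by apply Cmod_ge_0.
  exists ((1 + B) * (1 + sg + B * B) / eps)%R.
  constructor.
  - apply Rmult_le_pos; [nra|left; apply Rinv_0_lt_compat, He].
  - apply char_resolvent_sol.
  - apply char_resolvent_uniq.
  - intros k r i; apply Rle_trans with (1 := Cmod_le_vnorm _ i).
    unfold char_resolvent; rewrite vnorm_scal.
    rewrite Cmod_inv by apply denom_neq0.
    pose proof (pos_INR k) as Hk; pose proof (vnorm_pos r) as Hr.
    set (w := quadratic k r); set (x := (INR k + 1)%R).
    assert (Hx : (1 <= x)%R) by (unfold x; lra).
    assert (Hw : (vnorm w <= (1 + sg + B * B) * x ^ 2 * vnorm r)%R).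
    { unfold w, quadratic; apply Rle_trans with (1 := vnorm_add _ _).
      rewrite vnorm_scal.
      assert (H1 : (Cmod (RtoC (INR k) ^ 2 - (mu1 ^ 2 + mu2 ^ 2))
                    <= x ^ 2 + sg)%R).
      { apply Rle_trans with (1 := Cmod_triangle _ _).
        rewrite Cmod_opp, Cmod_pow, Cmod_R, Rabs_pos_eq by exact Hk.
        apply Rplus_le_compat_r, pow_incr; unfold x; lra. }
      assert (H2 : (vnorm (M (M r)) <= B * B * vnorm r)%R).
      { apply Rle_trans with (1 := LB _); rewrite Rmult_assoc.
        apply Rmult_le_compat_l; [exact HB|apply LB]. }
      apply Rmult_le_compat_r with (r := vnorm r) in H1; [|exact Hr].
      assert (H3 : (1 <= x ^ 2)%R) by nra.
      assert (H4 : ((sg + B * B) * 1 <= (sg + B * B) * x ^ 2)%R)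
        by (apply Rmult_le_compat_l; [nra|exact H3]).
      apply Rmult_le_compat_r with (r := vnorm r) in H4; [|exact Hr].
      lra. }
    assert (Hn : (vnorm (fun j => (RtoC (INR k) * w j + M w j)%C)
      <= (1 + B) * (1 + sg + B * B) * x ^ 3 * vnorm r)%R).
    { apply Rle_trans with (1 := vnorm_add _ _); rewrite vnorm_scal.
      rewrite Cmod_R, Rabs_pos_eq by exact Hk.
      pose proof (LB w) as H1; pose proof (vnorm_pos w) as Hw0.
      assert (H2 : (INR k * vnorm w + vnorm (M w) <= (1 + B) * x * vnorm w)%R).
      { assert (H3 : ((INR k + B) * vnorm w <= (1 + B) * x * vnorm w)%R)
          by (apply Rmult_le_compat_r; [exact Hw0|unfold x; nra]).
        lra. }
      apply Rle_trans with (1 := H2).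
      replace ((1 + B) * (1 + sg + B * B) * x ^ 3 * vnorm r)%R
        with ((1 + B) * x * ((1 + sg + B * B) * x ^ 2 * vnorm r))%R by ring.
      apply Rmult_le_compat_l; [nra|exact Hw]. }
    assert (Hi : (/ Cmod (denom k) <= / (eps * x ^ 4))%R).
    { apply Rinv_le_contravar; [|apply G].
      apply Rmult_lt_0_compat; [exact He|apply pow_lt; lra]. }
    apply Rle_trans with (/ (eps * x ^ 4)
       * ((1 + B) * (1 + sg + B * B) * x ^ 3 * vnorm r))%R.
    + apply Rmult_le_compat; [|apply vnorm_pos|exact Hi|exact Hn].
      left; apply Rinv_0_lt_compat, Cmod_gt_0, denom_neq0.
    + right; field; split; lra.
Qed.
End Resolvent.

(** * Completely integrable systems *)

(** The right-hand side of the equation along [a * theta_t + b * delta_s]. *)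
Definition combine (a b : nat) (F G : unknown -> poly) : unknown -> poly :=
  fun i => Add (Mul (Cst (RtoC (INR a))) (F i)) (Mul (Cst (RtoC (INR b))) (G i)).

(** Nonresonant equilibria of commuting fields. The last condition is the
    vanishing of the Lie bracket of [theta_t + F] and [delta_s + G], over the
    ring of series itself. *)
Record regular_system (F G : unknown -> poly) (Y0 : unknown -> C)
    (a b : nat) (mu1 mu2 : C) : Prop := {
  rs_base : forall i, val0 Y0 (combine a b F G i) = 0;
  rs_mu1 : ~ is_int mu1;
  rs_mu2 : ~ is_int mu2;
  rs_char : forall v i,
    let M (u : unknown -> C) := fun j => lin0 Y0 u (combine a b F G j) in
    M (M (M (M v))) i - (mu1 ^ 2 + mu2 ^ 2) * M (M v) i
    + mu1 ^ 2 * mu2 ^ 2 * v i = 0;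
  rs_comm : forall Y i,
    pdiff Y pT (pcst 0) (fun j => pval Y (F j)) (G i)
    = pdiff Y (pcst 0) (pS * (pcst 1 - pS))%ps (fun j => pval Y (G j)) (F i) }.

(** Applying [delta_s] to the defect [Z] of the first equation and [theta_t] to
    the defect [W] of the second, and using that the fields commute, gives
    [delta_s Z + F' W = theta_t W + G' Z]. Since [a Z + b W = 0], both defects
    solve the linearized equation along [Y], so they vanish. *)
Theorem regular_system_solution F G Y0 a b mu1 mu2 :
  regular_system F G Y0 a b mu1 mu2 ->
  exists (Y : unknown -> ps) (rho delta : R),
    (0 < rho)%R /\ (forall i, majorized rho delta (Y i)) /\
    (forall i, Y i O O = Y0 i) /\
    (forall i, theta_t (Y i) = pval Y (F i)) /\
    (forall i, delta_s (Y i) = pval Y (G i)).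
Proof.
  intros [Hbase Hmu1 Hmu2 Hchar Hcomm].
  destruct (char_resolvent_spec Y0 _ mu1 mu2 Hmu1 Hmu2 Hchar)
    as [K HR].
  set (H := combine a b F G) in *.
  set (Rk := char_resolvent Y0 H mu1 mu2) in *.
  set (y := limit Y0 a b H Rk).
  destruct (limit_majorized Y0 a b H Rk K HR) as [rho [delta [Hrho Hy]]].
  assert (Hy1 : forall i, ord_ge 1 (y i)) by apply (limit_ord1 Y0 a b H Rk K HR).
  pose proof (limit_solves Y0 a b H Rk K HR Hbase) as HL.
  fold y in Hy, HL; set (Y := around Y0 y) in *.
  set (ca := pcst (RtoC (INR a))) in *; set (cb := pcst (RtoC (INR b))) in *.
  set (Z := fun i => (theta_t (Y i) - pval Y (F i))%ps).
  set (W := fun i => (delta_s (Y i) - pval Y (G i))%ps).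
  pose proof theta_t_derivation as Dt; pose proof delta_s_derivation as Ds.
  assert (HZW : forall i, (ca * Z i)%ps = (- (cb * W i))%ps).
  { intros i; specialize (HL i).
    change (pval Y (H i)) with (ca * pval Y (F i) + cb * pval Y (G i))%ps in HL.
    unfold euler_op in HL; fold ca cb in HL.
    replace (ca * Z i)%ps with ((ca * theta_t (Y i) + cb * delta_s (Y i))
      - ca * pval Y (F i) - cb * delta_s (Y i))%ps by (unfold Z; ring).
    rewrite HL; unfold W; ring. }
  assert (Cross : forall i,
    (delta_s (Z i) + pdiff Y (pcst 0) (pcst 0) W (F i))%ps
    = (theta_t (W i) + pdiff Y (pcst 0) (pcst 0) Z (G i))%ps).
  { intros i.
    assert (E1 : delta_s (pval Y (F i)) =
      (pdiff Y (pcst 0) (pS * (pcst 1 - pS)) (fun j => pval Y (G j)) (F i)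
       + pdiff Y (pcst 0) (pcst 0) W (F i))%ps).
    { rewrite (pval_derivation _ Ds), delta_s_T, delta_s_S, <- pdiff_add.
      f_equal; [ring|ring|].
      apply functional_extensionality; intros j; unfold W; ring. }
    assert (E2 : theta_t (pval Y (G i)) =
      (pdiff Y pT (pcst 0) (fun j => pval Y (F j)) (G i)
       + pdiff Y (pcst 0) (pcst 0) Z (G i))%ps).
    { rewrite (pval_derivation _ Dt), theta_t_T, theta_t_S, <- pdiff_add.
      f_equal; [ring|ring|].
      apply functional_extensionality; intros j; unfold Z; ring. }
    assert (E3 : delta_s (theta_t (Y i))
                 = (delta_s (Z i) + delta_s (pval Y (F i)))%ps).
    { rewrite <- (der_add _ Ds); f_equal; unfold Z; ring. }
    assert (E4 : theta_t (delta_s (Y i))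
                 = (theta_t (W i) + theta_t (pval Y (G i)))%ps).
    { rewrite <- (der_add _ Dt); f_equal; unfold W; ring. }
    rewrite theta_delta_comm, E3, E1, E2, Hcomm in E4.
    set (x := pdiff Y (pcst 0) (pS * (pcst 1 - pS)) (fun j => pval Y (G j)) (F i))
      in E4.
    match goal with |- ?l = ?r =>
      replace l with ((l + x) - x)%ps by ring;
      replace r with ((r + x) - x)%ps by ring end.
    f_equal; etransitivity; [|etransitivity; [exact E4|]]; ring. }
  assert (Scal : forall c V e, pdiff Y (pcst 0) (pcst 0)
     (fun i => (c * V i)%ps) e = (c * pdiff Y (pcst 0) (pcst 0) V e)%ps).
  { intros; apply pdiff_scal. }
  assert (Hder : forall c d, derivation d -> forall x, d (pcst c * x)%ps
     = (pcst c * d x)%ps).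
  { intros c d Hd x; rewrite (der_mul _ Hd), (der_cst _ Hd); ring. }
  assert (HH : forall V i, pdiff Y (pcst 0) (pcst 0) V (H i)
     = (ca * pdiff Y (pcst 0) (pcst 0) V (F i)
        + cb * pdiff Y (pcst 0) (pcst 0) V (G i))%ps).
  { intros V i; unfold H, combine, pdiff; simpl; fold ca cb; ring. }
  assert (HZW' : (fun i => ca * Z i)%ps = (fun i => - pcst 1 * (cb * W i))%ps).
  { apply functional_extensionality; intros i; rewrite HZW; ring. }
  assert (Z0 : forall i, Z i = pcst 0).
  { apply (variational_unique Y0 a b H Rk K HR y Z Hy1); intros i.
    fold Y; rewrite HH; unfold euler_op; fold ca cb.
    assert (E : (cb * (delta_s (Z i) + pdiff Y (pcst 0) (pcst 0) W (F i))
       = cb * (theta_t (W i) + pdiff Y (pcst 0) (pcst 0) Z (G i)))%ps)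
      by (rewrite Cross; reflexivity).
    assert (E1 : (ca * pdiff Y (pcst 0) (pcst 0) Z (F i)
      = - (cb * pdiff Y (pcst 0) (pcst 0) W (F i)))%ps).
    { rewrite <- Scal, HZW'.
      replace (fun i0 : unknown => (- pcst 1 * (cb * W i0))%ps)
        with (fun i0 : unknown => ((- cb) * W i0)%ps)
        by (apply functional_extensionality; intros j; ring).
      rewrite Scal; ring. }
    assert (E2 : (ca * theta_t (Z i) = - (cb * theta_t (W i)))%ps).
    { unfold ca, cb; rewrite <- !(Hder _ _ Dt), <- (der_opp _ Dt).
      f_equal; apply HZW. }
    rewrite E1, E2.
    replace (cb * delta_s (Z i))%ps with
      (cb * (delta_s (Z i) + pdiff Y (pcst 0) (pcst 0) W (F i))
       - cb * pdiff Y (pcst 0) (pcst 0) W (F i))%ps by ring.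
    rewrite E; ring. }
  assert (W0 : forall i, W i = pcst 0).
  { apply (variational_unique Y0 a b H Rk K HR y W Hy1); intros i.
    fold Y; rewrite HH; unfold euler_op; fold ca cb.
    assert (HcW : forall j, (cb * W j)%ps = pcst 0).
    { intros j; replace (cb * W j)%ps with (- (- (cb * W j)))%ps by ring.
      rewrite <- HZW, Z0; ring. }
    assert (Hzero : forall e, pdiff Y (pcst 0) (pcst 0) (fun _ => pcst 0) e
                              = pcst 0).
    { intros e; replace (fun _ : unknown => pcst 0)
        with (fun _ : unknown => (pcst 0 * pcst 0)%ps)
        by (apply functional_extensionality; intros j; ring).
      rewrite Scal; ring. }
    assert (E1 : (cb * pdiff Y (pcst 0) (pcst 0) W (G i))%ps = pcst 0).
    { rewrite <- Scal; etransitivity; [|apply (Hzero (G i))]; f_equal.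
      apply functional_extensionality; exact HcW. }
    assert (E2 : (cb * delta_s (W i))%ps = pcst 0).
    { unfold cb; rewrite <- (Hder _ _ Ds); fold cb; rewrite HcW.
      apply (der_cst _ Ds). }
    assert (E3 : theta_t (W i) = pdiff Y (pcst 0) (pcst 0) W (F i)).
    { pose proof (Cross i) as E; rewrite Z0, (der_cst _ Ds) in E.
      replace Z with (fun _ : unknown => pcst 0) in E
        by (apply functional_extensionality; intros j; rewrite Z0; reflexivity).
      rewrite Hzero in E.
      replace (theta_t (W i)) with (theta_t (W i) + pcst 0)%ps by ring.
      rewrite <- E; ring. }
    rewrite E1, E2, E3; reflexivity. }
  assert (Hr0 : (0 <= rho)%R) by lra.
  exists Y, rho, (sum4 (fun i => Cmod (Y0 i)) + delta)%R.
  split; [apply Hrho|split; [|split; [|split]]]; intros i.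
  - apply majorized_le with (Cmod (Y0 i) + delta)%R.
    + pose proof (Cmod_le_vnorm Y0 i) as E; unfold vnorm in E; lra.
    + apply majorized_add; [exact Hr0|apply majorized_cst|apply Hy].
  - change (Y i O O) with (pcst (Y0 i) O O + y i O O).
    rewrite Hy1 by lia; unfold pcst; simpl; ring.
  - replace (theta_t (Y i)) with (Z i + pval Y (F i))%ps by (unfold Z; ring).
    rewrite Z0; ring.
  - replace (delta_s (Y i)) with (W i + pval Y (G i))%ps by (unfold W; ring).
    rewrite W0; ring.
Qed.


(** * Summation of absolutely convergent complex series *)

(** Total, with junk value on divergent series. *)
Definition csum (x : nat -> C) : C :=
  (Series (fun n => Re (x n)), Series (fun n => Im (x n))).

Definition summable (B : R) (x : nat -> C) : Prop :=
  forall K, (sum_n (fun n => Cmod (x n)) K <= B)%R.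

Lemma im_le_Cmod c : (Rabs (Im c) <= Cmod c)%R.
Proof. apply Rle_trans with (2 := Rmax_Cmod c), Rmax_r. Qed.

Lemma summable_ex B x : summable B x -> ex_series (fun n => Cmod (x n)).
Proof.
  intros H.
  destruct (ex_finite_lim_seq_incr (sum_n (fun n => Cmod (x n))) B) as [l Hl].
  - intros n; rewrite sum_Sn; unfold plus; simpl.
    pose proof (Cmod_ge_0 (x (S n))); lra.
  - exact H.
  - exists l; exact Hl.
Qed.

Lemma summable_re B x :
  summable B x -> ex_series (fun n => Rabs (Re (x n))).
Proof.
  intros H; apply (ex_series_le (K := R_AbsRing) (V := R_CompleteNormedModule))
    with (fun n => Cmod (x n)); [|apply (summable_ex B), H].
  intros n; unfold norm; simpl; unfold abs; simpl.
  rewrite Rabs_Rabsolu; apply re_le_Cmod.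
Qed.

Lemma summable_im B x :
  summable B x -> ex_series (fun n => Rabs (Im (x n))).
Proof.
  intros H; apply (ex_series_le (K := R_AbsRing) (V := R_CompleteNormedModule))
    with (fun n => Cmod (x n)); [|apply (summable_ex B), H].
  intros n; unfold norm; simpl; unfold abs; simpl.
  rewrite Rabs_Rabsolu; apply im_le_Cmod.
Qed.

Lemma sum_n_C (x : nat -> C) n :
  sum_n (G := C_AbelianMonoid) x n
  = (sum_n (fun k => Re (x k)) n, sum_n (fun k => Im (x k)) n).
Proof.
  induction n as [|n IH]; [rewrite !sum_O; apply surjective_pairing|].
  rewrite !sum_Sn, IH; reflexivity.
Qed.

Lemma csum_is_series B x : summable B x ->
  is_series (K := C_AbsRing) (V := C_NormedModule) x (csum x).
Proof.
  intros H.
  pose proof (Series_correct _ (ex_series_Rabs _ (summable_re B x H))) as HR.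
  pose proof (Series_correct _ (ex_series_Rabs _ (summable_im B x H))) as HI.
  unfold is_series in *.
  apply filterlim_locally; intros eps.
  pose proof (proj1 (filterlim_locally _ _) HR eps) as ER.
  pose proof (proj1 (filterlim_locally _ _) HI eps) as EI.
  generalize (filter_and _ _ ER EI); apply filter_imp; intros n [A1 A2].
  pose proof (sum_n_C x n) as E.
  change (ball (M := C_UniformSpace) (csum x) eps (sum_n (G := C_AbelianMonoid) x n)).
  rewrite E; split; assumption.
Qed.

Lemma csum_unique B x l : summable B x ->
  is_series (K := C_AbsRing) (V := C_NormedModule) x l -> csum x = l.
Proof.
  intros H Hl.
  refine (filterlim_locally_unique (K := C_AbsRing) (V := C_NormedModule)
            (F := eventually) (sum_n x) (csum x) l _ Hl).
  apply (csum_is_series B), H.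
Qed.

Lemma summable_scal B c x :
  summable B x -> summable (Cmod c * B) (fun n => c * x n).
Proof.
  intros H K.
  rewrite (sum_n_ext _ (fun n => scal (Cmod c) (Cmod (x n))))
    by (intros n; apply Cmod_mult).
  rewrite sum_n_scal_l; apply Rmult_le_compat_l; [apply Cmod_ge_0|apply H].
Qed.

Lemma summable_plus B B' x y :
  summable B x -> summable B' y -> summable (B + B') (fun n => x n + y n).
Proof.
  intros H H' K.
  apply Rle_trans with
    (sum_n (fun n => plus (Cmod (x n)) (Cmod (y n))) K).
  - rewrite !sum_n_Reals; apply sum_Rle; intros n _; apply Cmod_triangle.
  - rewrite sum_n_plus; apply Rplus_le_compat; [apply H|apply H'].
Qed.

Lemma csum_scal B c x : summable B x -> csum (fun n => c * x n) = c * csum x.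
Proof.
  intros H; apply (csum_unique (Cmod c * B)); [apply summable_scal, H|].
  apply (is_series_scal (K := C_AbsRing) (V := C_NormedModule) c x).
  apply (csum_is_series B), H.
Qed.

Lemma csum_plus B B' x y : summable B x -> summable B' y ->
  csum (fun n => x n + y n) = csum x + csum y.
Proof.
  intros H H'; apply (csum_unique (B + B')); [apply summable_plus; assumption|].
  apply (is_series_plus (K := C_AbsRing) (V := C_NormedModule) x y).
  - apply (csum_is_series B), H.
  - apply (csum_is_series B'), H'.
Qed.

Lemma csum_bound B x : summable B x -> (Cmod (csum x) <= B)%R.
Proof.
  intros H; pose proof (csum_is_series B x H) as Hs.
  assert (HL : is_lim_seq
    (fun n => norm (K := C_AbsRing) (V := C_NormedModule) (sum_n x n))
    (norm (K := C_AbsRing) (V := C_NormedModule) (csum x))).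
  { unfold is_lim_seq, Rbar_locally.
    eapply filterlim_comp; [exact Hs|].
    apply (filterlim_norm (K := C_AbsRing) (V := C_NormedModule)). }
  apply (is_lim_seq_le _ (fun _ => B) _ B) in HL; [|clear HL|apply is_lim_seq_const].
  - exact HL.
  - intros n; apply Rle_trans with (2 := H n).
    induction n as [|n IH]; [rewrite !sum_O; apply Rle_refl|].
    rewrite !sum_Sn; apply Rle_trans with (1 := Cmod_triangle _ _).
    apply Rplus_le_compat; [exact IH|apply Rle_refl].
Qed.

Lemma conv_sum_f_R0 a b n :
  conv Rplus Rmult a b n = sum_f_R0 (fun k => a k * b (n - k)%nat)%R n.
Proof.
  revert a; induction n as [|n IH]; intros a; [reflexivity|].
  rewrite decomp_sum by lia; simpl; rewrite IH; reflexivity.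
Qed.

Lemma conv_re x y n :
  Re (conv Cplus Cmult x y n)
  = (conv Rplus Rmult (fun k => Re (x k)) (fun k => Re (y k)) n
     - conv Rplus Rmult (fun k => Im (x k)) (fun k => Im (y k)) n)%R.
Proof.
  revert x; induction n as [|n IH]; intros x; [reflexivity|].
  specialize (IH (shift x)); simpl.
  change (shift (fun k => Re (x k))) with (fun k => Re (shift x k)).
  change (shift (fun k => Im (x k))) with (fun k => Im (shift x k)).
  unfold Re, Im in *; rewrite IH; ring.
Qed.

Lemma conv_im x y n :
  Im (conv Cplus Cmult x y n)
  = (conv Rplus Rmult (fun k => Re (x k)) (fun k => Im (y k)) n
     + conv Rplus Rmult (fun k => Im (x k)) (fun k => Re (y k)) n)%R.
Proof.
  revert x; induction n as [|n IH]; intros x; [reflexivity|].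
  specialize (IH (shift x)); simpl.
  change (shift (fun k => Re (x k))) with (fun k => Re (shift x k)).
  change (shift (fun k => Im (x k))) with (fun k => Im (shift x k)).
  unfold Re, Im in *; rewrite IH; ring.
Qed.

Lemma Series_conv a b :
  ex_series (fun n => Rabs (a n)) -> ex_series (fun n => Rabs (b n)) ->
  is_series (conv Rplus Rmult a b) (Series a * Series b)%R.
Proof.
  intros Ha Hb.
  apply is_series_ext with
    (fun n => sum_f_R0 (fun k => a k * b (n - k)%nat)%R n).
  - intros n; symmetry; apply conv_sum_f_R0.
  - apply is_series_mult; try assumption;
      apply Series_correct, ex_series_Rabs; assumption.
Qed.

Lemma csum_conv B B' x y : summable B x -> summable B' y ->
  csum (conv Cplus Cmult x y) = csum x * csum y.
Proof.
  intros H H'.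
  pose proof (summable_re B x H) as X1; pose proof (summable_im B x H) as X2.
  pose proof (summable_re B' y H') as Y1; pose proof (summable_im B' y H') as Y2.
  unfold csum, Cmult; simpl; f_equal; apply is_series_unique.
  - eapply is_series_ext; [intros n; symmetry; apply conv_re|].
    apply (is_series_minus (K := R_AbsRing) (V := R_NormedModule));
      apply Series_conv; assumption.
  - eapply is_series_ext; [intros n; symmetry; apply conv_im|].
    apply (is_series_plus (K := R_AbsRing) (V := R_NormedModule));
      apply Series_conv; assumption.
Qed.

(** * Evaluation of convergent double series *)

(** The weights [w m n] stand for the monomials [t ^ m * s ^ n], or for
    difference quotients of these. *)
Definition weigh (w a : ps) : ps := fun m n => a m n * w m n.

Definition evalw (w a : ps) : C := csum (diag Cplus (weigh w a)).

Definition powers (t s : C) : ps := fun m n => t ^ m * s ^ n.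

Definition eval (t s : C) (a : ps) : C := evalw (powers t s) a.

Definition evaluable (t s : C) (a : ps) : Prop :=
  exists B, summable B (diag Cplus (weigh (powers t s) a)).

Lemma sum_n_head {G : AbelianMonoid} (u : nat -> G) n :
  sum_n u (S n) = plus (u O) (sum_n (fun k => u (S k)) n).
Proof.
  unfold sum_n; rewrite sum_Sn_m by lia; rewrite <- sum_n_m_S; reflexivity.
Qed.

Lemma diag_sum_n (x : ps) k :
  diag Cplus x k
  = sum_n (G := C_AbelianMonoid) (fun m => x m (k - m)%nat) k.
Proof.
  revert x; induction k as [|k IH]; intros x; [rewrite sum_O; reflexivity|].
  rewrite sum_n_head; simpl; rewrite IH; reflexivity.
Qed.

Lemma sum_n_norm1 rho (c : nat -> C) K :
  sum_n (fun n => (Cmod (c n) * rho ^ n)%R) K = norm1 Cmod rho c K.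
Proof.
  revert c; induction K as [|K IH]; intros c; [rewrite sum_O; simpl; ring|].
  rewrite sum_n_head; simpl; rewrite <- IH; unfold plus; simpl.
  rewrite <- (sum_n_mult_l (K := R_Ring) rho).
  rewrite Rmult_1_r; f_equal; apply sum_n_ext; intros n; unfold mult, shift; simpl; ring.
Qed.

Lemma diag_scal_R (c : R) x k :
  diag Rplus (fun m n => c * x m n)%R k = (c * diag Rplus x k)%R.
Proof.
  revert x; induction k as [|k IH]; intros x; [reflexivity|].
  simpl; change (shift (fun m n => (c * x m n)%R))
    with (fun m n => (c * shift x m n)%R).
  rewrite IH; ring.
Qed.

(** The triangle [m + n <= K] lies in the square of side [K]. *)
Lemma sum_diag_le rho a K : (0 <= rho)%R ->
  (sum_n (diag Rplus (fun m n => Cmod (a m n) * rho ^ (m + n))%R) K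
   <= norm2 rho a K)%R.
Proof.
  intros Hrho; unfold norm2.
  enough (E : forall L K, (K <= L)%nat -> forall a,
    (sum_n (diag Rplus (fun m n => Cmod (a m n) * rho ^ (m + n))%R) K
     <= norm1 (fun c => norm1 Cmod rho c L) rho a K)%R) by (apply E; lia).
  clear a K; intros L.
  assert (mono : forall c K, (K <= L)%nat ->
    (norm1 Cmod rho c K <= norm1 Cmod rho c L)%R).
  { intros c K HK; induction HK as [|L' HK IH]; [apply Rle_refl|].
    apply Rle_trans with (1 := IH), norm1_S; [exact Cmod_ge_0|exact Hrho]. }
  induction K as [|K IH]; intros HK a.
  - rewrite sum_O; simpl; apply Rle_trans with (2 := mono (a O) O HK).
    simpl; lra.
  - rewrite (sum_n_ext _ (fun k => plus (Cmod (a O k) * rho ^ k)%R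
      (match k with O => 0 | S k' => rho * diag Rplus
         (fun m n => Cmod (shift a m n) * rho ^ (m + n)) k' end)%R)).
    2:{ intros [|k]; [unfold plus; simpl; ring|].
        unfold plus; simpl; f_equal.
        clear IH mono.
        rewrite <- diag_scal_R; f_equal.
        apply functional_extensionality; intros m.
        apply functional_extensionality; intros n; unfold shift; simpl; ring. }
    rewrite sum_n_plus, sum_n_norm1; simpl.
    apply Rplus_le_compat; [exact (mono (a O) (S K) HK)|].
    rewrite sum_n_head; unfold plus; simpl.
    rewrite Rplus_0_l, (sum_n_mult_l (K := R_Ring) rho).
    apply Rmult_le_compat_l; [exact Hrho|apply IH; lia].
Qed.

Lemma diag_le (x : ps) (y : nat -> nat -> R) k :
  (forall m n, Cmod (x m n) <= y m n)%R ->
  (Cmod (diag Cplus x k) <= diag Rplus y k)%R.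
Proof.
  revert x y; induction k as [|k IH]; intros x y H; [apply H|].
  simpl; apply Rle_trans with (1 := Cmod_triangle _ _).
  apply Rplus_le_compat; [apply H|apply IH]; intros m n; apply H.
Qed.

Lemma weigh_summable rho delta a c w :
  (0 <= rho)%R -> majorized rho delta a ->
  (forall m n, (Cmod (w m n) <= c * rho ^ (m + n))%R) ->
  summable (c * delta) (diag Cplus (weigh w a)).
Proof.
  intros Hrho Ha Hw K.
  assert (Hc : (0 <= c)%R).
  { specialize (Hw O O); pose proof (Cmod_ge_0 (w O O)); simpl in Hw; lra. }
  apply Rle_trans with (c * norm2 rho a K)%R;
    [|apply Rmult_le_compat_l; [exact Hc|apply Ha]].
  apply Rle_trans with (c *
    sum_n (diag Rplus (fun m n => Cmod (a m n) * rho ^ (m + n))%R) K)%R;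
    [|apply Rmult_le_compat_l; [exact Hc|apply sum_diag_le, Hrho]].
  rewrite <- (sum_n_mult_l (K := R_Ring)), !sum_n_Reals.
  apply sum_Rle; intros k _.
  apply Rle_trans with
    (diag Rplus (fun m n => c * (Cmod (a m n) * rho ^ (m + n)))%R k).
  - apply diag_le; intros m n; unfold weigh; rewrite Cmod_mult.
    replace (c * (Cmod (a m n) * rho ^ (m + n)))%R
      with (Cmod (a m n) * (c * rho ^ (m + n)))%R by ring.
    apply Rmult_le_compat_l; [apply Cmod_ge_0|apply Hw].
  - right; apply (diag_scal_R c (fun m n => Cmod (a m n) * rho ^ (m + n))%R).
Qed.

Lemma Cmod_pow_le t rho m : (Cmod t <= rho)%R -> (Cmod (t ^ m) <= rho ^ m)%R.
Proof.
  intros H; rewrite Cmod_pow; apply pow_incr.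
  split; [apply Cmod_ge_0|exact H].
Qed.

Lemma powers_le t s rho m n : (Cmod t <= rho)%R -> (Cmod s <= rho)%R ->
  (Cmod (powers t s m n) <= 1 * rho ^ (m + n))%R.
Proof.
  intros Ht Hs; unfold powers; rewrite Rmult_1_l, Cmod_mult, pow_add.
  apply Rmult_le_compat; try apply Cmod_ge_0; apply Cmod_pow_le; assumption.
Qed.

Lemma eval_summable rho delta a t s :
  majorized rho delta a -> (Cmod t <= rho)%R -> (Cmod s <= rho)%R ->
  summable (1 * delta) (diag Cplus (weigh (powers t s) a)).
Proof.
  intros Ha Ht Hs; apply weigh_summable with rho; [|exact Ha|].
  - apply Rle_trans with (2 := Ht), Cmod_ge_0.
  - intros m n; apply powers_le; assumption.
Qed.

Lemma majorized_evaluable rho delta a t s :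
  majorized rho delta a -> (Cmod t <= rho)%R -> (Cmod s <= rho)%R ->
  evaluable t s a.
Proof.
  intros Ha Ht Hs; exists (1 * delta)%R; now apply eval_summable with rho.
Qed.

(** Evaluating is summing after the substitution [X -> t X], [X' -> s X'], and
    each of these substitutions is a ring morphism. *)
Lemma weigh_mul t s a b :
  weigh (powers t s) (a * b)%ps
  = (weigh (powers t s) a * weigh (powers t s) b)%ps.
Proof.
  set (E := fun (c : nat -> C) n => s ^ n * c n).
  assert (Emul : forall c d, E (conv Cplus Cmult c d)
    = conv Cplus Cmult (E c) (E d)).
  { intros c d; apply functional_extensionality; intros n; symmetry.
    apply (conv_scale _ _ _ _ _ _ _ C_ring_theory s (Cpow s));
      reflexivity. }
  assert (Eadd : forall c d, E (sadd Cplus c d) = sadd Cplus (E c) (E d)).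
  { intros c d; apply functional_extensionality; intros n; unfold E; simpl; ring. }
  set (p := fun m => scst (RtoC 0) (t ^ m)).
  assert (W : forall c, weigh (powers t s) c
     = fun m => conv Cplus Cmult (p m) (E (c m))).
  { intros c; apply ps_ext; intros m n; unfold p.
    rewrite (conv_scst_l _ _ _ _ _ _ _ C_ring_theory).
    unfold weigh, powers, E; ring. }
  rewrite !W; apply functional_extensionality; intros m; symmetry.
  unfold pmul; etransitivity;
    [apply (conv_scale _ _ _ _ _ _ _ ps1_ring (scst (RtoC 0) t) p)|].
  - reflexivity.
  - intros n; apply functional_extensionality; intros k; unfold p.
    rewrite (conv_scst_l _ _ _ _ _ _ _ C_ring_theory).
    destruct k; simpl; ring.
  - f_equal.
    rewrite (conv_map _ _ _ E Eadd Emul); reflexivity.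
Qed.

Lemma diag_scal (c : C) (x : ps) k :
  diag Cplus (fun m n => c * x m n) k = c * diag Cplus x k.
Proof.
  revert x; induction k as [|k IH]; intros x; [reflexivity|].
  simpl; change (shift (fun m n => c * x m n)) with (fun m n => c * shift x m n).
  rewrite IH; ring.
Qed.

Lemma diag_plus (x y : ps) k :
  diag Cplus (fun m n => x m n + y m n) k = diag Cplus x k + diag Cplus y k.
Proof. apply (diag_sadd _ _ _ _ _ _ _ C_ring_theory). Qed.

Section Evaluation.
Variables t s : C.

Lemma eval_mul a b : evaluable t s a -> evaluable t s b ->
  eval t s (a * b)%ps = eval t s a * eval t s b.
Proof.
  intros [d Ha] [d' Hb]; unfold eval, evalw; rewrite weigh_mul.
  rewrite <- (csum_conv d d') by assumption.
  f_equal; apply functional_extensionality; intros k.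
  apply (diag_conv _ _ _ _ _ _ C_ring_theory).
Qed.

Lemma eval_add a b : evaluable t s a -> evaluable t s b ->
  eval t s (a + b)%ps = eval t s a + eval t s b.
Proof.
  intros [d Ha] [d' Hb]; unfold eval, evalw.
  rewrite <- (csum_plus d d') by assumption.
  f_equal; apply functional_extensionality; intros k.
  rewrite <- diag_plus; f_equal.
  apply ps_ext; intros m n; unfold weigh, padd; simpl; ring.
Qed.

Lemma eval_opp a : evaluable t s a -> eval t s (- a)%ps = - eval t s a.
Proof.
  intros [d Ha]; unfold eval, evalw.
  replace (- csum (diag Cplus (weigh (powers t s) a)))
    with (- (1) * csum (diag Cplus (weigh (powers t s) a))) by ring.
  rewrite <- (csum_scal d) by assumption.
  f_equal; apply functional_extensionality; intros k.
  rewrite <- diag_scal; f_equal.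
  apply ps_ext; intros m n; unfold weigh, popp; simpl; ring.
Qed.

Lemma diag_zero (x : ps) k : (forall m n, x m n = 0) -> diag Cplus x k = 0.
Proof.
  revert x; induction k as [|k IH]; intros x H; simpl; [apply H|].
  rewrite H, IH; [ring|intros m n; apply H].
Qed.

Lemma csum_head c (x : nat -> C) : (forall n, x (S n) = 0) -> x O = c -> csum x = c.
Proof.
  intros H Hc; apply (csum_unique (Cmod c)).
  - intros K; induction K as [|K IH]; [rewrite sum_O, Hc; apply Rle_refl|].
    rewrite sum_Sn, H, Cmod_0; unfold plus; simpl; lra.
  - assert (E : forall n, sum_n (G := C_AbelianMonoid) x n = c).
    { induction n as [|n IH]; [rewrite sum_O; exact Hc|].
      rewrite sum_Sn, IH, H; apply Cplus_0_r. }
    apply filterlim_ext with (fun _ : nat => c); [intros n; symmetry; apply E|].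
    apply filterlim_const.
Qed.

Lemma eval_cst c : eval t s (pcst c) = c.
Proof.
  apply csum_head; [intros n|simpl; unfold weigh, powers, pcst; simpl; ring].
  simpl; rewrite diag_zero.
  - unfold weigh, powers, pcst; simpl; ring.
  - intros m k; unfold weigh, powers, shift, pcst, z1; destruct k; simpl; ring.
Qed.

Lemma csum_second c (x : nat -> C) : x O = 0 -> x 1%nat = c ->
  (forall n, x (S (S n)) = 0) -> csum x = c.
Proof.
  intros H0 Hc H; apply (csum_unique (Cmod c)).
  - intros K; destruct K as [|K]; [rewrite sum_O, H0, Cmod_0; apply Cmod_ge_0|].
    induction K as [|K IH].
    + rewrite sum_Sn, sum_O, H0, Hc, Cmod_0; unfold plus; simpl; lra.
    + rewrite sum_Sn, H, Cmod_0; unfold plus; simpl; lra.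
  - assert (E : forall n, sum_n (G := C_AbelianMonoid) x (S n) = c).
    { induction n as [|n IH].
      - rewrite sum_Sn, sum_O, H0, Hc; apply Cplus_0_l.
      - rewrite sum_Sn, IH, H; apply Cplus_0_r. }
    apply filterlim_ext_loc with (fun _ : nat => c); [|apply filterlim_const].
    exists 1%nat; intros [|n] Hn; [lia|symmetry; apply E].
Qed.

Lemma eval_T : eval t s pT = t.
Proof.
  apply csum_second.
  - unfold weigh, powers, pT, z1; simpl; ring.
  - simpl; unfold weigh, powers, pT, shift, pcst, z1; simpl; ring.
  - intros n; simpl; rewrite diag_zero.
    + unfold weigh, powers, shift, pT, pcst, z1; simpl; ring.
    + intros m k; unfold weigh, powers, shift, pT, pcst, z1.
      destruct k; simpl; ring.
Qed.

Lemma eval_S : eval t s pS = s.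
Proof.
  apply csum_second.
  - unfold weigh, powers, pS; simpl; ring.
  - simpl; unfold weigh, powers, pS, shift, pcst, z1; simpl; ring.
  - intros n; simpl; rewrite diag_zero.
    + unfold weigh, powers, shift, pS, pcst, z1; simpl; ring.
    + intros m k; unfold weigh, powers, shift, pS, pcst, z1.
      destruct k; simpl; ring.
Qed.
End Evaluation.

Lemma pval_majorized rho delta Y e : (0 <= rho)%R ->
  (forall i, majorized rho delta (Y i)) ->
  exists d, majorized rho d (pval Y e).
Proof.
  intros Hr HY; unfold pval; induction e; simpl.
  - exists (Cmod c); apply majorized_cst.
  - exists rho; apply majorized_T, Hr.
  - exists rho; apply majorized_S, Hr.
  - exists delta; apply HY.
  - destruct IHe1 as [d1 H1], IHe2 as [d2 H2]; exists (d1 + d2)%R.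
    apply majorized_add; assumption.
  - destruct IHe as [d H]; exists d; apply majorized_opp; assumption.
  - destruct IHe1 as [d1 H1], IHe2 as [d2 H2]; exists (d1 * d2)%R.
    apply majorized_mul; assumption.
Qed.

Lemma eval_pval rho delta Y e t s :
  (forall i, majorized rho delta (Y i)) ->
  (Cmod t <= rho)%R -> (Cmod s <= rho)%R ->
  eval t s (pval Y e) = cval t s (fun i => eval t s (Y i)) e.
Proof.
  intros HY Ht Hs.
  assert (Hr : (0 <= rho)%R) by (apply Rle_trans with (2 := Ht), Cmod_ge_0).
  assert (HE : forall f, evaluable t s (pval Y f)).
  { intros f; destruct (pval_majorized rho delta Y f Hr HY) as [d Hd].
    now apply majorized_evaluable with rho d. }
  unfold cval; induction e; simpl.
  - apply eval_cst.
  - apply eval_T.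
  - apply eval_S.
  - reflexivity.
  - rewrite <- IHe1, <- IHe2; apply eval_add; apply HE.
  - rewrite <- IHe; apply eval_opp, HE.
  - rewrite <- IHe1, <- IHe2; apply eval_mul; apply HE.
Qed.

Lemma eval_convergent rho delta a : (0 < rho)%R -> majorized rho delta a ->
  convergent (fun t s => eval t s a).
Proof.
  intros Hr Ha; exists a, rho, delta; split; [exact Hr|split].
  - intros m n; apply majorized_coef; [lra|exact Ha].
  - intros t s Ht Hs.
    apply is_series_ext with (diag Cplus (weigh (powers t s) a)).
    + intros k; rewrite diag_sum_n; apply sum_n_ext; intros m.
      apply Cmult_assoc.
    + apply (csum_is_series (1 * delta)), eval_summable with rho; auto; lra.
Qed.

(** ** Partial derivatives *)

Lemma evalw_scal rho delta a c w x : (0 <= rho)%R -> majorized rho delta a ->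
  (forall m n, (Cmod (w m n) <= c * rho ^ (m + n))%R) ->
  evalw (fun m n => x * w m n) a = x * evalw w a.
Proof.
  intros Hr Ha Hw; unfold evalw.
  rewrite <- (csum_scal (c * delta))
    by (apply weigh_summable with rho; assumption).
  f_equal; apply functional_extensionality; intros k.
  rewrite <- diag_scal; f_equal.
  apply ps_ext; intros m n; unfold weigh; ring.
Qed.

Lemma evalw_plus rho delta a c c' w w' : (0 <= rho)%R -> majorized rho delta a ->
  (forall m n, (Cmod (w m n) <= c * rho ^ (m + n))%R) ->
  (forall m n, (Cmod (w' m n) <= c' * rho ^ (m + n))%R) ->
  evalw (fun m n => w m n + w' m n) a = evalw w a + evalw w' a.
Proof.
  intros Hr Ha Hw Hw'; unfold evalw.
  rewrite <- (csum_plus (c * delta) (c' * delta))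
    by (apply weigh_summable with rho; assumption).
  f_equal; apply functional_extensionality; intros k.
  rewrite <- diag_plus; f_equal.
  apply ps_ext; intros m n; unfold weigh; ring.
Qed.

Lemma is_derive_quadratic (f : C -> C) (z l : C) (r L : R) :
  (0 < r)%R -> (0 <= L)%R ->
  (forall x, (Cmod (x - z) < r)%R ->
     (Cmod (f x - f z - (x - z) * l) <= L * Cmod (x - z) ^ 2)%R) ->
  is_derive (K := C_AbsRing) (V := C_NormedModule) f z l.
Proof.
  intros Hr HL Hf; split; [apply is_linear_scal_l|].
  intros y Hy.
  apply (is_filter_lim_locally_unique (K := C_AbsRing)
    (V := AbsRing_NormedModule C_AbsRing)) in Hy.
  subst y; intros eps; pose proof (cond_pos eps) as He.
  assert (Hpos : (0 < Rmin r (eps / (L + 1)))%R).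
  { apply Rmin_glb_lt; [exact Hr|apply Rdiv_lt_0_compat; lra]. }
  exists (mkposreal _ Hpos); intros x Hx.
  change (Cmod (x - z) < Rmin r (eps / (L + 1)))%R in Hx.
  change (Cmod (f x - f z - (x - z) * l) <= eps * Cmod (x - z))%R.
  apply Rle_trans with (1 := Hf x (Rlt_le_trans _ _ _ Hx (Rmin_l _ _))).
  replace (L * Cmod (x - z) ^ 2)%R
    with (L * Cmod (x - z) * Cmod (x - z))%R by ring.
  apply Rmult_le_compat_r; [apply Cmod_ge_0|].
  pose proof (Rlt_le_trans _ _ _ Hx (Rmin_r _ _)) as Hxe.
  apply Rle_trans with (L * (eps / (L + 1)))%R;
    [apply Rmult_le_compat_l; lra|].
  apply Rle_trans with ((L + 1) * (eps / (L + 1)))%R.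
  - apply Rmult_le_compat_r; [|lra].
    left; apply Rdiv_lt_0_compat; lra.
  - right; field; lra.
Qed.

(** A second-order Taylor estimate on the weights, uniform against
    [rho ^ (m + n)], can be summed against any series majorized at [rho]. *)
Lemma evalw_derive rho delta a (W : C -> ps) (W' : ps) z r c :
  (0 <= rho)%R -> majorized rho delta a -> (0 < r)%R ->
  (forall x m n, (Cmod (x - z) < r)%R ->
     (Cmod (W x m n) <= 1 * rho ^ (m + n))%R) ->
  (forall m n, (Cmod (W' m n) <= c * rho ^ (m + n))%R) ->
  (forall x m n, (Cmod (x - z) < r)%R ->
     (Cmod (W x m n - W z m n - (x - z) * W' m n)
      <= c * c * Cmod (x - z) ^ 2 * rho ^ (m + n))%R) ->
  is_derive (K := C_AbsRing) (V := C_NormedModule)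
    (fun x => evalw (W x) a) z (evalw W' a).
Proof.
  intros Hr Ha Hr0 HW HW' HT.
  assert (Hd : (0 <= delta)%R) by (eapply majorized_pos; eassumption).
  assert (Main : forall x, (Cmod (x - z) < r)%R ->
    (Cmod (evalw (W x) a - evalw (W z) a - (x - z) * evalw W' a)
     <= c * c * Cmod (x - z) ^ 2 * delta)%R).
  { intros x Hx.
    assert (Hz : (Cmod (z - z) < r)%R)
      by (replace (z - z) with (RtoC 0) by ring; rewrite Cmod_0; exact Hr0).
    set (h := x - z) in *.
    assert (Hs : forall w k y, (forall m n, (Cmod (w m n) <= k * rho ^ (m + n))%R) ->
      forall m n, (Cmod (y * w m n) <= Cmod y * k * rho ^ (m + n))%R).
    { intros w k y Hw m n; rewrite Cmod_mult, Rmult_assoc.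
      apply Rmult_le_compat_l; [apply Cmod_ge_0|apply Hw]. }
    pose proof (fun m n => HW x m n Hx) as H1.
    pose proof (Hs _ _ (- (1)) (fun m n => HW z m n Hz)) as H2.
    pose proof (Hs _ _ (- h) HW') as H3.
    assert (E : evalw (W x) a - evalw (W z) a - h * evalw W' a
      = evalw (fun m n => W x m n - W z m n - h * W' m n) a).
    { transitivity (evalw (fun m n => W x m n +
        (- (1) * W z m n + - h * W' m n)) a).
      - rewrite (evalw_plus rho delta a 1 (Cmod (- (1)) * 1 + Cmod (- h) * c));
          try assumption.
        2:{ intros m n; apply Rle_trans with (1 := Cmod_triangle _ _).
            rewrite Rmult_plus_distr_r; apply Rplus_le_compat; auto. }
        rewrite (evalw_plus rho delta a (Cmod (- (1)) * 1) (Cmod (- h) * c));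
          try assumption.
        rewrite (evalw_scal rho delta a 1 (W z)), (evalw_scal rho delta a c W');
          try assumption; [ring|intros m n; apply HW; exact Hz].
      - f_equal; apply ps_ext; intros m n; ring. }
    rewrite E; apply csum_bound, weigh_summable with rho; try assumption.
    intros m n; apply HT; exact Hx. }
  apply is_derive_quadratic with r (c * c * delta)%R; [exact Hr0| |].
  - apply Rmult_le_pos; [apply Rle_0_sqr|exact Hd].
  - intros x Hx; apply Rle_trans with (1 := Main x Hx); right; ring.
Qed.

Definition dpow (z : C) (m : nat) : C :=
  match m with O => 0 | S m' => RtoC (INR m) * z ^ m' end.

Lemma dpow_mul z m : z * dpow z m = RtoC (INR m) * z ^ m.
Proof. destruct m; simpl; ring. Qed.

Lemma dpow_S z m : dpow z (S m) = z * dpow z m + z ^ m.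
Proof.
  rewrite dpow_mul; unfold dpow; rewrite S_INR, RtoC_plus; ring.
Qed.

(** Both estimates are inductions on [m] along [x ^ (m+1) = x * x ^ m]; the
    constants are forced by [R * c + 1 = rho * c]. *)
Lemma dpow_le z R0 rho m : (Cmod z <= R0)%R -> (R0 < rho)%R ->
  (Cmod (dpow z m) <= / (rho - R0) * rho ^ m)%R.
Proof.
  intros Hz HR; set (c := (/ (rho - R0))%R).
  assert (Hc : (0 < c)%R) by (apply Rinv_0_lt_compat; lra).
  assert (Ec : (R0 * c + 1 = rho * c)%R) by (unfold c; field; lra).
  pose proof (Cmod_ge_0 z) as Hz0.
  induction m as [|m IH]; [simpl; rewrite Cmod_0; lra|].
  rewrite dpow_S; apply Rle_trans with (1 := Cmod_triangle _ _).
  rewrite Cmod_mult.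
  apply Rle_trans with (R0 * (c * rho ^ m) + rho ^ m)%R.
  - apply Rplus_le_compat; [|apply Cmod_pow_le; lra].
    apply Rmult_le_compat; try assumption; apply Cmod_ge_0.
  - right; transitivity ((R0 * c + 1) * rho ^ m)%R; [ring|].
    rewrite Ec; simpl; ring.
Qed.

Lemma pow_taylor z x R0 rho m :
  (Cmod z <= R0)%R -> (Cmod x <= R0)%R -> (R0 < rho)%R ->
  (Cmod (x ^ m - z ^ m - (x - z) * dpow z m)
   <= / (rho - R0) * / (rho - R0) * Cmod (x - z) ^ 2 * rho ^ m)%R.
Proof.
  intros Hz Hx HR; set (c := (/ (rho - R0))%R).
  assert (Hc : (0 < c)%R) by (apply Rinv_0_lt_compat; lra).
  assert (Ec : (R0 * c + 1 = rho * c)%R) by (unfold c; field; lra).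
  pose proof (Cmod_ge_0 x) as Hx0; pose proof (Cmod_ge_0 (x - z)) as Hh.
  set (h := Cmod (x - z)) in *.
  induction m as [|m IH].
  - simpl; replace (1 - 1 - (x - z) * 0) with (RtoC 0) by ring.
    rewrite Cmod_0; apply Rmult_le_pos; [|lra].
    apply Rmult_le_pos; [nra|apply pow2_ge_0].
  - replace (x ^ S m - z ^ S m - (x - z) * dpow z (S m))
      with (x * (x ^ m - z ^ m - (x - z) * dpow z m)
            + (x - z) ^ 2 * dpow z m) by (rewrite dpow_S; simpl; ring).
    apply Rle_trans with (1 := Cmod_triangle _ _).
    rewrite !Cmod_mult, Cmod_pow; fold h.
    apply Rle_trans with
      (R0 * (c * c * h ^ 2 * rho ^ m) + h ^ 2 * (c * rho ^ m))%R.
    + apply Rplus_le_compat.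
      * apply Rmult_le_compat; try assumption; apply Cmod_ge_0.
      * apply Rmult_le_compat_l; [apply pow2_ge_0|].
        apply dpow_le; assumption.
    + right; transitivity (c * h ^ 2 * ((R0 * c + 1) * rho ^ m))%R; [ring|].
      rewrite Ec; simpl; ring.
Qed.

Section Derivatives.
Variables (rho delta : R) (a : ps) (t s : C).
Hypotheses (Ha : majorized rho delta a) (Ht : (Cmod t < rho)%R)
  (Hs : (Cmod s < rho)%R).

Let rho_pos : (0 <= rho)%R.
Proof. left; apply Rle_lt_trans with (2 := Ht), Cmod_ge_0. Qed.

Let near z (Hz : (Cmod z < rho)%R) x :
  (Cmod (x - z) < (rho - Cmod z) / 2 -> Cmod x <= (Cmod z + rho) / 2)%R.
Proof.
  intros Hx; replace x with ((x - z) + z) by ring.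
  apply Rle_trans with (1 := Cmod_triangle _ _); lra.
Qed.

Lemma eval_derive_t :
  is_derive (K := C_AbsRing) (V := C_NormedModule)
    (fun x => eval x s a) t (evalw (fun m n => dpow t m * s ^ n) a).
Proof.
  set (R0 := ((Cmod t + rho) / 2)%R).
  apply (evalw_derive rho delta a (fun x => powers x s) _ t
           ((rho - Cmod t) / 2) (/ (rho - R0))); try assumption.
  - lra.
  - intros x m n Hx; apply powers_le; [|lra].
    apply Rle_trans with (1 := near t Ht x Hx); lra.
  - intros m n; rewrite Cmod_mult, pow_add, <- Rmult_assoc.
    apply Rmult_le_compat; try apply Cmod_ge_0; [|apply Cmod_pow_le; lra].
    apply dpow_le; unfold R0; lra.
  - intros x m n Hx; unfold powers.
    replace (x ^ m * s ^ n - t ^ m * s ^ n - (x - t) * (dpow t m * s ^ n))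
      with ((x ^ m - t ^ m - (x - t) * dpow t m) * s ^ n) by ring.
    rewrite Cmod_mult, pow_add, <- Rmult_assoc.
    apply Rmult_le_compat; try apply Cmod_ge_0; [|apply Cmod_pow_le; lra].
    apply pow_taylor; [unfold R0; lra|apply near; assumption|unfold R0; lra].
Qed.

Lemma eval_derive_s :
  is_derive (K := C_AbsRing) (V := C_NormedModule)
    (fun x => eval t x a) s (evalw (fun m n => t ^ m * dpow s n) a).
Proof.
  set (R0 := ((Cmod s + rho) / 2)%R).
  apply (evalw_derive rho delta a (fun x => powers t x) _ s
           ((rho - Cmod s) / 2) (/ (rho - R0))); try assumption.
  - lra.
  - intros x m n Hx; apply powers_le; [lra|].
    apply Rle_trans with (1 := near s Hs x Hx); lra.
  - intros m n; rewrite Cmod_mult, pow_add.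
    replace (/ (rho - R0) * (rho ^ m * rho ^ n))%R
      with (rho ^ m * (/ (rho - R0) * rho ^ n))%R by ring.
    apply Rmult_le_compat; try apply Cmod_ge_0; [apply Cmod_pow_le; lra|].
    apply dpow_le; unfold R0; lra.
  - intros x m n Hx; unfold powers.
    replace (t ^ m * x ^ n - t ^ m * s ^ n - (x - s) * (t ^ m * dpow s n))
      with (t ^ m * (x ^ n - s ^ n - (x - s) * dpow s n)) by ring.
    rewrite Cmod_mult, pow_add.
    match goal with |- (_ <= ?c * (?u * ?v))%R =>
      replace (c * (u * v))%R with (u * (c * v))%R by ring end.
    apply Rmult_le_compat; try apply Cmod_ge_0; [apply Cmod_pow_le; lra|].
    apply pow_taylor; [unfold R0; lra|apply near; assumption|unfold R0; lra].
Qed.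

Lemma eval_theta_t :
  eval t s (theta_t a) = t * evalw (fun m n => dpow t m * s ^ n) a.
Proof.
  rewrite <- (evalw_scal rho delta a (/ (rho - Cmod t))); try assumption.
  - unfold eval, evalw; f_equal; f_equal; apply ps_ext; intros m n.
    unfold weigh, powers, theta_t.
    transitivity (a m n * (t * dpow t m) * s ^ n); [rewrite dpow_mul; ring|ring].
  - intros m n; rewrite Cmod_mult, pow_add, <- Rmult_assoc.
    apply Rmult_le_compat; try apply Cmod_ge_0; [|apply Cmod_pow_le; lra].
    apply dpow_le; lra.
Qed.

Let theta_s_summable :
  exists B, summable B (diag Cplus (weigh (fun m n => t ^ m * dpow s n) a)).
Proof.
  exists (/ (rho - Cmod s) * delta)%R.
  apply weigh_summable with rho; try assumption.
  intros m n; rewrite Cmod_mult, pow_add.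
  replace (/ (rho - Cmod s) * (rho ^ m * rho ^ n))%R
    with (rho ^ m * (/ (rho - Cmod s) * rho ^ n))%R by ring.
  apply Rmult_le_compat; try apply Cmod_ge_0; [apply Cmod_pow_le; lra|].
  apply dpow_le; lra.
Qed.

Let theta_s_weigh :
  diag Cplus (weigh (powers t s) (theta_s a))
  = fun k => s * diag Cplus (weigh (fun m n => t ^ m * dpow s n) a) k.
Proof.
  apply functional_extensionality; intros k; rewrite <- diag_scal; f_equal.
  apply ps_ext; intros m n; unfold weigh, powers, theta_s.
  transitivity (a m n * t ^ m * (s * dpow s n)); [rewrite dpow_mul; ring|ring].
Qed.

(** The series [theta_s a] is not majorized at [rho] itself, only summable at
    each interior point, which is all that multiplicativity of [eval] needs. *)
Lemma eval_delta_s :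
  eval t s (delta_s a)
  = s * (1 - s) * evalw (fun m n => t ^ m * dpow s n) a.
Proof.
  destruct theta_s_summable as [B HB].
  assert (E1 : evaluable t s (theta_s a)).
  { exists (Cmod s * B)%R; rewrite theta_s_weigh; apply summable_scal, HB. }
  assert (E2 : evaluable t s (- pS)%ps).
  { apply majorized_evaluable with rho rho; try lra.
    apply majorized_opp, majorized_S; exact rho_pos. }
  assert (E3 : evaluable t s (pcst 1)).
  { apply majorized_evaluable with rho (Cmod 1); try lra.
    apply majorized_cst. }
  assert (E4 : evaluable t s (pcst 1 + - pS)%ps).
  { apply majorized_evaluable with rho (Cmod 1 + rho)%R; try lra.
    apply majorized_add; [exact rho_pos|apply majorized_cst|].
    apply majorized_opp, majorized_S; exact rho_pos. }
  replace (delta_s a) with ((pcst 1 + - pS) * theta_s a)%ps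
    by (unfold delta_s; ring).
  rewrite eval_mul, eval_add, eval_opp, eval_cst, eval_S; try assumption.
  - unfold eval, evalw at 1; rewrite theta_s_weigh, (csum_scal B) by exact HB.
    unfold evalw; ring.
  - apply majorized_evaluable with rho rho; try lra.
    apply majorized_S; exact rho_pos.
Qed.
End Derivatives.


(** * Closed polynomial expressions *)

Inductive param : Type := Pa0 | Pa2 | Poo | Pnu | Peta.

(** Polynomials whose coefficients are integer polynomials in named
    parameters: being closed data, they can be differentiated and compared by
    computation. *)
Inductive sym : Type :=
| Num (z : Z) | Par (p : param) | ST | SS | SU (i : unknown)
| SAdd (e1 e2 : sym) | SOpp (e : sym) | SMul (e1 e2 : sym).

Fixpoint realize (env : param -> C) (e : sym) : poly :=
  match e with
  | Num z => Cst (RtoC (IZR z))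
  | Par p => Cst (env p)
  | ST => Tvar
  | SS => Svar
  | SU i => Var i
  | SAdd e1 e2 => Add (realize env e1) (realize env e2)
  | SOpp e1 => Opp (realize env e1)
  | SMul e1 e2 => Mul (realize env e1) (realize env e2)
  end.

Definition sadd0 (a b : sym) : sym :=
  match a, b with
  | Num Z0, _ => b
  | _, Num Z0 => a
  | _, _ => SAdd a b
  end.

Definition smul0 (a b : sym) : sym :=
  match a, b with
  | Num Z0, _ => Num 0
  | _, Num Z0 => Num 0
  | Num (Zpos xH), _ => b
  | _, Num (Zpos xH) => a
  | _, _ => SMul a b
  end.

Definition sopp0 (a : sym) : sym :=
  match a with Num Z0 => Num 0 | _ => SOpp a end.

Fixpoint sderiv (dt ds : sym) (du : unknown -> sym) (e : sym) : sym :=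
  match e with
  | Num _ | Par _ => Num 0
  | ST => dt
  | SS => ds
  | SU i => du i
  | SAdd e1 e2 => sadd0 (sderiv dt ds du e1) (sderiv dt ds du e2)
  | SOpp e1 => sopp0 (sderiv dt ds du e1)
  | SMul e1 e2 =>
      sadd0 (smul0 (sderiv dt ds du e1) e2) (smul0 e1 (sderiv dt ds du e2))
  end.

Definition unknown_eqb (i j : unknown) : bool :=
  match i, j with
  | Q1, Q1 | Q2, Q2 | P1, P1 | P2, P2 => true
  | _, _ => false
  end.

Definition spartial (i : unknown) : sym -> sym :=
  sderiv (Num 0) (Num 0) (fun j => if unknown_eqb i j then Num 1 else Num 0).

Section Semantics.
Context {A : Type} {zero one : A} {add mul sub : A -> A -> A} {opp : A -> A}.
Hypothesis Ath : ring_theory zero one add mul sub opp eq.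
Add Ring semantics : Ath.
Variable cst : C -> A.
Hypotheses (cst0 : cst 0 = zero) (cst1 : cst 1 = one).
Variables (t s : A) (Y : unknown -> A) (env : param -> C).

Let sem (e : sym) : A := interp add mul opp cst t s Y (realize env e).

Lemma sem_sadd0 a b : sem (sadd0 a b) = add (sem a) (sem b).
Proof.
  unfold sem; destruct a as [[]| | | | | | |]; simpl; rewrite ?cst0; try ring;
    destruct b as [[]| | | | | | |]; simpl; rewrite ?cst0; try ring; reflexivity.
Qed.

Lemma sem_sopp0 a : sem (sopp0 a) = opp (sem a).
Proof.
  unfold sem; destruct a as [[]| | | | | | |]; simpl; rewrite ?cst0; try ring;
    reflexivity.
Qed.

Lemma sem_smul0 a b : sem (smul0 a b) = mul (sem a) (sem b).
Proof.
  unfold sem; destruct a as [[|[]|]| | | | | | |]; simpl;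
    rewrite ?cst0, ?cst1; try ring;
    destruct b as [[|[]|]| | | | | | |]; simpl; rewrite ?cst0, ?cst1; try ring;
    reflexivity.
Qed.

Lemma sem_sderiv dt ds du e :
  sem (sderiv dt ds du e)
  = dinterp add mul opp cst t s Y (sem dt) (sem ds) (fun i => sem (du i))
      (realize env e).
Proof.
  induction e; simpl; try reflexivity.
  - rewrite sem_sadd0, IHe1, IHe2; reflexivity.
  - rewrite sem_sopp0, IHe; reflexivity.
  - rewrite sem_sadd0, !sem_smul0, IHe1, IHe2; reflexivity.
Qed.
End Semantics.

Definition index (e : sym) : positive :=
  match e with
  | SU Q1 => 1 | SU Q2 => 2 | SU P1 => 3 | SU P2 => 4 | ST => 5 | SS => 6
  | Par Pa0 => 7 | Par Pa2 => 8 | Par Poo => 9 | Par Pnu => 10 | _ => 11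
  end.

Fixpoint to_pexpr (e : sym) : PExpr Z :=
  match e with
  | Num z => PEc z
  | SAdd e1 e2 => PEadd (to_pexpr e1) (to_pexpr e2)
  | SOpp e1 => PEopp (to_pexpr e1)
  | SMul e1 e2 => PEmul (to_pexpr e1) (to_pexpr e2)
  | _ => PEX Z (index e)
  end.

Definition normal_form (e : sym) : Pol Z :=
  norm_subst 0%Z 1%Z Z.add Z.mul Z.sub Z.opp Z.eqb (fun a _ => (0%Z, a)) 0 []
    (to_pexpr e).

Lemma ps_power_theory :
  power_theory (pcst 1) pmul eq (fun n : N => n) (pow_N (pcst 1) pmul).
Proof. constructor; reflexivity. Qed.

Lemma pcst_IZR_morph :
  ring_morph (pcst 0) (pcst 1) padd pmul psub popp eq
    0%Z 1%Z Z.add Z.mul Z.sub Z.opp Z.eqb (fun z => pcst (RtoC (IZR z))).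
Proof.
  constructor; try reflexivity.
  - intros x y; rewrite plus_IZR, RtoC_plus; apply pcst_add.
  - intros x y; rewrite minus_IZR, RtoC_minus.
    unfold Cminus; rewrite pcst_add, pcst_opp; ring.
  - intros x y; rewrite mult_IZR, RtoC_mult; apply pcst_pcst.
  - intros x; rewrite opp_IZR, RtoC_opp; apply pcst_opp.
  - intros x y E; apply Z.eqb_eq in E; rewrite E; reflexivity.
Qed.

(** Equal normal forms give equal values in the ring of series, by the
    correctness theorem behind the [ring] tactic. *)
Lemma normal_form_correct env Y e e' :
  Peq Z.eqb (normal_form e) (normal_form e') = true ->
  pval Y (realize env e) = pval Y (realize env e').
Proof.
  intros E.
  set (l := [Y Q1; Y Q2; Y P1; Y P2; pT; pS; pcst (env Pa0); pcst (env Pa2);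
             pcst (env Poo); pcst (env Pnu); pcst (env Peta)]).
  assert (S : forall f, pval Y (realize env f)
    = PEeval (pcst 0) (pcst 1) padd pmul psub popp
        (fun z => pcst (RtoC (IZR z))) (fun n : N => n) (pow_N (pcst 1) pmul)
        l (to_pexpr f)).
  { intros f; unfold pval; induction f; simpl;
      rewrite <- ?IHf, <- ?IHf1, <- ?IHf2; try reflexivity.
    - destruct p; reflexivity.
    - destruct i; reflexivity. }
  rewrite !S.
  apply (ring_correct (Eqsth ps) (Eq_ext padd pmul popp)
    (Rth_ARth (Eqsth ps) (Eq_ext padd pmul popp) ps_ring)
    pcst_IZR_morph ps_power_theory (cdiv := fun a _ => (0%Z, a))
    ltac:(constructor; intros a b; simpl; rewrite Z.mul_0_r; reflexivity)
    0 l [] _ _ I E).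
Qed.

(** * The Garnier system in blown-up coordinates *)

Declare Scope sym_scope.
Delimit Scope sym_scope with sym.
Bind Scope sym_scope with sym.
Infix "+" := SAdd : sym_scope.
Infix "*" := SMul : sym_scope.
Notation "- x" := (SOpp x) : sym_scope.
Notation "x - y" := (SAdd x (SOpp y)) : sym_scope.

Section Garnier.
(** [e] and [d] say whether [q1] has a pole along [t = 0], and [q2] a zero and
    [p2] a pole along [s = 0]: the unknowns are [A], [u], [B], [v] with
    [q1 = A / t ^ e], [q2 = u * s ^ d], [p1 = B * t ^ e], [p2 = v / s ^ d]. *)
Variables e d : bool.

Let a0 := Par Pa0.
Let a2 := Par Pa2.
Let n := Par Pnu.
Let aoo := Par Poo.
Let eps := Par Peta.
Let one := Num 1.
Let two := Num 2.
Let a1 := (one - two * n - a0 - a2 - aoo)%sym.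
Let A := SU Q1.
Let u := SU Q2.
Let B := SU P1.
Let v := SU P2.
(* t ^ (1 - e), t ^ e, s ^ d and s ^ (1 - d) *)
Let te' := if e then one else ST.
Let te := if e then ST else one.
Let sd := if d then SS else one.
Let sd' := if d then one else SS.

(** [s1 * H1] *)
Definition K1 : sym := (
  A * A * (te' * A - one) * B * B + two * te' * A * A * B * u * v
  + te' * A * u * (u - sd') * v * v
  - ((a0 + a2 - one) * te' * A * A + a1 * A * (te' * A - one)
     + eps * te * (te' * A - one) + eps * sd * u * te) * B
  - ((a0 + a1 - one) * te' * A * u + a2 * te' * A * (u - sd')
     - eps * ST * (SS - one) * u) * v
  + n * (n + aoo) * te' * A)%sym.

(** [s2 * (s2 - 1) * H2] *)
Definition K2 : sym := (
  A * A * B * B * sd * u + two * A * B * sd * u * (u - sd') * v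
  + (u * (sd * u - one) * (u - sd') + sd' * (SS - one) * te' * A * u) * v * v
  - ((a0 + a1 - one) * sd * u * A + a2 * A * sd * (u - sd')
     - eps * (SS - one) * sd * u * te) * B
  - ((a0 - one) * u * (sd * u - one) + a1 * u * sd * (u - sd')
     + a2 * (sd * u - one) * (u - sd')
     + sd' * (SS - one) * te' * a2 * A + SS * (SS - one) * ST * eps * u) * v
  + n * (n + aoo) * sd * u)%sym.

Let when (b : bool) (x : sym) : sym := if b then x else Num 0.

(** The vector field of [t * d/dt]. *)
Definition field_t (i : unknown) : sym :=
  match i with
  | Q1 => sadd0 (- spartial P1 K1) (when e A)
  | Q2 => - spartial P2 K1
  | P1 => sadd0 (spartial Q1 K1) (- when e B)
  | P2 => spartial Q2 K1
  end%sym.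

(** The vector field of [s * (1 - s) * d/ds]. *)
Definition field_s (i : unknown) : sym :=
  match i with
  | Q1 => - spartial P1 K2
  | Q2 => sadd0 (- spartial P2 K2) (- when d ((one - SS) * u))
  | P1 => spartial Q1 K2
  | P2 => sadd0 (spartial Q2 K2) (when d ((one - SS) * v))
  end%sym.

End Garnier.

(** Complete integrability of the Garnier system, in all charts at once. *)
Lemma bracket_zero e d i :
  Peq Z.eqb (normal_form (sderiv ST (Num 0) (field_t e d) (field_s e d i)))
    (normal_form (sderiv (Num 0) (SS * (Num 1 - SS)) (field_s e d) (field_t e d i)))
  = true.
Proof.
  destruct e, d, i; vm_compute; reflexivity.
Qed.

Lemma fields_commute e d env Y i :
  pdiff Y pT (pcst 0) (fun j => pval Y (realize env (field_t e d j)))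
    (realize env (field_s e d i))
  = pdiff Y (pcst 0) (pS * (pcst 1 - pS))%ps
      (fun j => pval Y (realize env (field_s e d j))) (realize env (field_t e d i)).
Proof.
  pose proof (normal_form_correct env Y _ _ (bracket_zero e d i)) as E.
  unfold pval in E.
  rewrite !(sem_sderiv ps_ring pcst eq_refl eq_refl) in E.
  unfold pdiff, pval; simpl in E |- *.
  rewrite E; f_equal; ring.
Qed.


(** ** Blowing down *)

Definition Cderiv (f : C -> C) (z l : C) : Prop :=
  is_derive (K := C_AbsRing) (V := C_NormedModule) f z l.

(** The two normed module structures on the complex numbers have the same norm
    but different, equivalent, uniform structures. *)
Lemma Cderiv_of_AbsRing f z l :
  is_derive (K := C_AbsRing) (V := AbsRing_NormedModule C_AbsRing) f z l ->
  Cderiv f z l.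
Proof.
  intros [_ H]; split; [apply is_linear_scal_l|exact H].
Qed.

Lemma AbsRing_of_Cderiv f z l : Cderiv f z l ->
  is_derive (K := C_AbsRing) (V := AbsRing_NormedModule C_AbsRing) f z l.
Proof.
  intros [_ H]; split; [apply is_linear_scal_l|exact H].
Qed.

Lemma Cderiv_id z : Cderiv (fun x => x) z 1.
Proof. apply Cderiv_of_AbsRing, (is_derive_id (K := C_AbsRing)). Qed.

Lemma Cderiv_const c z : Cderiv (fun _ => c) z 0.
Proof. apply (is_derive_const (K := C_AbsRing) (V := C_NormedModule)). Qed.

Lemma Cderiv_add f g z l m : Cderiv f z l -> Cderiv g z m ->
  Cderiv (fun x => f x + g x) z (l + m).
Proof. apply (is_derive_plus (K := C_AbsRing) (V := C_NormedModule) f g). Qed.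

Lemma Cderiv_opp f z l : Cderiv f z l -> Cderiv (fun x => - f x) z (- l).
Proof. apply (is_derive_opp (K := C_AbsRing) (V := C_NormedModule) f). Qed.

Lemma Cderiv_mul f g z l m : Cderiv f z l -> Cderiv g z m ->
  Cderiv (fun x => f x * g x) z (l * g z + f z * m).
Proof.
  intros Hf Hg.
  apply Cderiv_of_AbsRing, (is_derive_mult (K := C_AbsRing) f g);
    [apply AbsRing_of_Cderiv, Hf|apply AbsRing_of_Cderiv, Hg|exact Cmult_comm].
Qed.

Lemma Cderiv_inv (z : C) : z <> 0 -> Cderiv (fun x => / x) z (- / (z * z)).
Proof.
  intros Hz; assert (Hm : (0 < Cmod z)%R) by (apply Cmod_gt_0; exact Hz).
  set (m := Cmod z) in *.
  apply is_derive_quadratic with (m / 2)%R (2 / (m * m * m))%R.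
  - lra.
  - left; apply Rdiv_lt_0_compat; [lra|].
    repeat apply Rmult_lt_0_compat; exact Hm.
  - intros x Hx.
    assert (Hxm : (m / 2 <= Cmod x)%R).
    { assert (E : (m <= Cmod x + Cmod (x - z))%R); [|lra].
      unfold m; replace z with (x + - (x - z)) at 1 by ring.
      apply Rle_trans with (1 := Cmod_triangle _ _).
      rewrite Cmod_opp; lra. }
    assert (Hx0 : x <> 0) by (intros E; rewrite E, Cmod_0 in Hxm; lra).
    replace (/ x - / z - (x - z) * - / (z * z))
      with ((x - z) ^ 2 * (/ x * / (z * z))) by (field; split; assumption).
    rewrite Cmod_mult, Cmod_pow, Rmult_comm.
    apply Rmult_le_compat_r; [apply pow2_ge_0|].
    rewrite Cmod_mult, !Cmod_inv, Cmod_mult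
      by (try assumption; apply Cmult_neq_0; assumption).
    fold m.
    replace (2 / (m * m * m))%R with (/ (m / 2) * / (m * m))%R by (field; lra).
    apply Rmult_le_compat_r.
    + left; apply Rinv_0_lt_compat; nra.
    + apply Rinv_le_contravar; lra.
Qed.

Lemma Cderiv_eq f z l l' : l = l' -> Cderiv f z l -> Cderiv f z l'.
Proof. intros ->; auto. Qed.

Definition upd (Y : unknown -> C) (i : unknown) (x : C) : unknown -> C :=
  fun j => if unknown_eqb i j then x else Y j.

Lemma cval_partial t s Y env i x e :
  Cderiv (fun y => cval t s (upd Y i y) (realize env e)) x
    (cval t s (upd Y i x) (realize env (spartial i e))).
Proof.
  unfold cval, spartial.
  rewrite (sem_sderiv C_ring_theory (fun c => c) eq_refl eq_refl).
  induction e; simpl; try apply Cderiv_const.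
  - unfold upd; destruct (unknown_eqb i i0); simpl;
      [apply Cderiv_id|apply Cderiv_const].
  - apply Cderiv_add; assumption.
  - apply Cderiv_opp; assumption.
  - eapply Cderiv_eq; [|apply Cderiv_mul; eassumption]; simpl; ring.
Qed.

(** The partial derivative of a Hamiltonian [h] read off from its expression
    [c * K] in blown-up coordinates. *)
Lemma C_derive_blowup h (c k t s : C) Y env i (x : C) e :
  (forall y, h y = c * cval t s (upd Y i (y * k)) (realize env e)) ->
  x * k = Y i ->
  C_derive h x = c * k * cval t s Y (realize env (spartial i e)).
Proof.
  intros Hh Hx; apply is_C_derive_unique.
  assert (EY : upd Y i (x * k) = Y).
  { apply functional_extensionality; intros j; rewrite Hx; unfold upd.
    destruct i, j; reflexivity. }
  apply (is_derive_ext (K := C_AbsRing) (V := C_NormedModule)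
    (fun y => c * cval t s (upd Y i (y * k)) (realize env e))).
  - intros y; symmetry; apply Hh.
  - assert (H1 : Cderiv (fun y => y * k) x k).
    { eapply Cderiv_eq; [|apply Cderiv_mul; [apply Cderiv_id|apply Cderiv_const]].
      cbv beta; ring. }
    pose proof (cval_partial t s Y env i (x * k) e) as H2.
    pose proof (is_derive_comp (K := C_AbsRing) (V := C_NormedModule)
      (fun y => cval t s (upd Y i y) (realize env e)) (fun y => y * k) x _ _
      H2 (AbsRing_of_Cderiv _ _ _ H1)) as H3.
    rewrite EY in H3.
    eapply Cderiv_eq; [|apply Cderiv_mul; [apply Cderiv_const|exact H3]].
    unfold scal; simpl; unfold mult; simpl; ring.
Qed.

Definition tpow (e : bool) (t : C) : C := if e then t else 1.

Lemma tpow_neq0 e (t : C) : t <> 0 -> tpow e t <> 0.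
Proof. intros H; destruct e; [exact H|exact C1_nz]. Qed.

Lemma Cderiv_div_tpow e f (z l : C) : z <> 0 -> Cderiv f z l ->
  Cderiv (fun x => f x / tpow e x) z
    ((l - (if e then f z / z else 0)) / tpow e z).
Proof.
  intros Hz Hf; destruct e; simpl.
  - eapply Cderiv_eq; [|apply Cderiv_mul; [exact Hf|apply Cderiv_inv, Hz]].
    simpl; field; exact Hz.
  - eapply Cderiv_eq; [|apply Cderiv_mul; [exact Hf|apply Cderiv_const]].
    cbv beta; field; apply C1_nz.
Qed.

Lemma Cderiv_mul_tpow e f z l : Cderiv f z l ->
  Cderiv (fun x => f x * tpow e x) z (l * tpow e z + (if e then f z else 0)).
Proof.
  intros Hf; destruct e; simpl.
  - eapply Cderiv_eq; [|apply Cderiv_mul; [exact Hf|apply Cderiv_id]]; cbv beta; ring.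
  - eapply Cderiv_eq; [|apply Cderiv_mul; [exact Hf|apply Cderiv_const]]; cbv beta; ring.
Qed.

Lemma Cderiv_mul_const c f z l : Cderiv f z l -> Cderiv (fun x => f x * c) z (l * c).
Proof.
  intros Hf; eapply Cderiv_eq; [|apply Cderiv_mul; [exact Hf|apply Cderiv_const]].
  cbv beta; ring.
Qed.

Definition coords (A u B v : C) (i : unknown) : C :=
  match i with Q1 => A | Q2 => u | P1 => B | P2 => v end.

Lemma partials_blowup (h : C -> C -> C -> C -> C) (c k1 k2 t s : C) Y env e :
  k1 <> 0 -> k2 <> 0 ->
  (forall A u B v, h (A / k1) (u * k2) (B * k1) (v / k2)
     = c * cval t s (coords A u B v) (realize env e)) ->
  let q1 := Y Q1 / k1 in let q2 := Y Q2 * k2 in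
  let p1 := Y P1 * k1 in let p2 := Y P2 / k2 in
  C_derive (fun x => h x q2 p1 p2) q1
    = c * k1 * cval t s Y (realize env (spartial Q1 e)) /\
  C_derive (fun x => h q1 x p1 p2) q2
    = c * / k2 * cval t s Y (realize env (spartial Q2 e)) /\
  C_derive (fun x => h q1 q2 x p2) p1
    = c * / k1 * cval t s Y (realize env (spartial P1 e)) /\
  C_derive (fun x => h q1 q2 p1 x) p2
    = c * k2 * cval t s Y (realize env (spartial P2 e)).
Proof.
  intros Hk1 Hk2 Hh; cbv zeta.
  assert (EU : forall i x, upd Y i x
    = coords (upd Y i x Q1) (upd Y i x Q2) (upd Y i x P1) (upd Y i x P2))
    by (intros i x; apply functional_extensionality; intros []; reflexivity).
  repeat split; apply C_derive_blowup;
    try (intros x; rewrite EU, <- Hh; unfold upd; simpl; f_equal; field; assumption);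
    field; assumption.
Qed.

Lemma field_values e d env t s Y :
  let val (f : sym) := cval t s Y (realize env f) in
  val (field_t e d Q1) = - val (spartial P1 (K1 e d)) + (if e then Y Q1 else 0) /\
  val (field_t e d Q2) = - val (spartial P2 (K1 e d)) /\
  val (field_t e d P1) = val (spartial Q1 (K1 e d)) + - (if e then Y P1 else 0) /\
  val (field_t e d P2) = val (spartial Q2 (K1 e d)) /\
  val (field_s e d Q1) = - val (spartial P1 (K2 e d)) /\
  val (field_s e d Q2) = - val (spartial P2 (K2 e d))
                         + - (if d then (1 - s) * Y Q2 else 0) /\
  val (field_s e d P1) = val (spartial Q1 (K2 e d)) /\
  val (field_s e d P2) = val (spartial Q2 (K2 e d))
                         + (if d then (1 - s) * Y P2 else 0).
Proof.
  assert (S : forall a b, cval t s Y (realize env (sadd0 a b))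
     = cval t s Y (realize env a) + cval t s Y (realize env b))
    by apply (sem_sadd0 C_ring_theory (fun c => c) eq_refl).
  cbv zeta; unfold field_t, field_s.
  generalize (K1 e d) (K2 e d); intros k1 k2.
  repeat split; try reflexivity;
    (etransitivity; [apply S|]); f_equal; destruct e, d; reflexivity.
Qed.

Section BlowDown.
Variables alpha0 alpha1 alpha2 alphaoo nu eta : C.
Hypothesis Hsum : alpha0 + alpha1 + alpha2 + alphaoo = 1 - 2 * nu.

Definition environment (p : param) : C :=
  match p with
  | Pa0 => alpha0 | Pa2 => alpha2 | Poo => alphaoo | Pnu => nu | Peta => eta
  end.

Lemma alpha1_eq : alpha1 = 1 - 2 * nu - alpha0 - alpha2 - alphaoo.
Proof. rewrite <- Hsum; ring. Qed.

Lemma H1_blowup e d (A u B v t s : C) : t <> 0 -> s <> 0 ->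
  H1 alpha0 alpha1 alpha2 alphaoo nu eta
    (A / tpow e t) (u * tpow d s) (B * tpow e t) (v / tpow d s) (/ t) s
  = t * cval t s (coords A u B v) (realize environment (K1 e d)).
Proof.
  intros Ht Hs; rewrite alpha1_eq; unfold H1, cval; destruct e, d; simpl; field;
    auto.
Qed.

Lemma H2_blowup e d (A u B v t s : C) : t <> 0 -> s <> 0 -> s <> 1 ->
  H2 alpha0 alpha1 alpha2 alphaoo nu eta
    (A / tpow e t) (u * tpow d s) (B * tpow e t) (v / tpow d s) (/ t) s
  = / (s * (s - 1)) * cval t s (coords A u B v) (realize environment (K2 e d)).
Proof.
  intros Ht Hs Hs1.
  assert (Hs1' : s - 1 <> 0).
  { intros E; apply Hs1; replace s with ((s - 1) + 1) by ring; rewrite E; ring. }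
  rewrite alpha1_eq; unfold H2, cval; destruct e, d; simpl; field; auto.
Qed.

Variables (e d : bool) (y : unknown -> C -> C -> C).

Definition down_q1 (t s : C) : C := y Q1 t s / tpow e t.
Definition down_q2 (t s : C) : C := y Q2 t s * tpow d s.
Definition down_p1 (t s : C) : C := y P1 t s * tpow e t.
Definition down_p2 (t s : C) : C := y P2 t s / tpow d s.

Lemma hamiltonian_blowdown (t s : C) Dt Ds :
  t <> 0 -> s <> 0 -> s <> 1 ->
  (forall i, Cderiv (fun x => y i x s) t (Dt i)) ->
  (forall i, Cderiv (fun x => y i t x) s (Ds i)) ->
  (forall i, t * Dt i =
     cval t s (fun j => y j t s) (realize environment (field_t e d i))) ->
  (forall i, s * (1 - s) * Ds i =
     cval t s (fun j => y j t s) (realize environment (field_s e d i))) ->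
  hamiltonian_system alpha0 alpha1 alpha2 alphaoo nu eta
    down_q1 down_q2 down_p1 down_p2 t s.
Proof.
  intros Ht Hs Hs1 HDt HDs Ft Fs.
  pose proof (tpow_neq0 e t Ht) as Hte; pose proof (tpow_neq0 d s Hs) as Hsd.
  assert (Hs1' : s - 1 <> 0).
  { intros E; apply Hs1; replace s with ((s - 1) + 1) by ring; rewrite E; ring. }
  assert (Hs1'' : 1 - s <> 0).
  { intros E; apply Hs1'; replace (s - 1) with (- (1 - s)) by ring; rewrite E; ring. }
  set (Y := fun j => y j t s) in *.
  assert (EY : coords (Y Q1) (Y Q2) (Y P1) (Y P2) = Y)
    by (apply functional_extensionality; intros []; reflexivity).
  pose proof (Cderiv_div_tpow e _ t _ Ht (HDt Q1)) as T1.
  pose proof (Cderiv_mul_const (tpow d s) _ t _ (HDt Q2)) as T2.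
  pose proof (Cderiv_mul_tpow e _ t _ (HDt P1)) as T3.
  pose proof (Cderiv_mul_const (/ tpow d s) _ t _ (HDt P2)) as T4.
  pose proof (Cderiv_mul_const (/ tpow e t) _ s _ (HDs Q1)) as S1.
  pose proof (Cderiv_mul_tpow d _ s _ (HDs Q2)) as S2.
  pose proof (Cderiv_mul_const (tpow e t) _ s _ (HDs P1)) as S3.
  pose proof (Cderiv_div_tpow d _ s _ Hs (HDs P2)) as S4.
  destruct (partials_blowup
    (fun q1 q2 p1 p2 => H1 alpha0 alpha1 alpha2 alphaoo nu eta q1 q2 p1 p2 (/ t) s)
    t (tpow e t) (tpow d s) t s Y environment (K1 e d) Hte Hsd)
    as [A1 [A2 [A3 A4]]].
  { intros A u B v; apply H1_blowup; assumption. }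
  destruct (partials_blowup
    (fun q1 q2 p1 p2 => H2 alpha0 alpha1 alpha2 alphaoo nu eta q1 q2 p1 p2 (/ t) s)
    (/ (s * (s - 1))) (tpow e t) (tpow d s) t s Y environment (K2 e d) Hte Hsd)
    as [B1 [B2 [B3 B4]]].
  { intros A u B v; apply H2_blowup; assumption. }
  unfold hamiltonian_system, has_partials, ex_Cderive, d_t1, d_s2; cbv zeta.
  change (down_q1 t s) with (Y Q1 / tpow e t).
  change (down_q2 t s) with (Y Q2 * tpow d s).
  change (down_p1 t s) with (Y P1 * tpow e t).
  change (down_p2 t s) with (Y P2 / tpow d s).
  rewrite A1, A2, A3, A4, B1, B2, B3, B4.
  pose proof (is_C_derive_unique (fun x => down_q1 x s) _ _ T1) as D1.
  pose proof (is_C_derive_unique (fun x => down_q2 x s) _ _ T2) as D2.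
  pose proof (is_C_derive_unique (fun x => down_p1 x s) _ _ T3) as D3.
  pose proof (is_C_derive_unique (fun x => down_p2 x s) _ _ T4) as D4.
  pose proof (is_C_derive_unique (fun x => down_q1 t x) _ _ S1) as D5.
  pose proof (is_C_derive_unique (fun x => down_q2 t x) _ _ S2) as D6.
  pose proof (is_C_derive_unique (fun x => down_p1 t x) _ _ S3) as D7.
  pose proof (is_C_derive_unique (fun x => down_p2 t x) _ _ S4) as D8.
  rewrite D1, D2, D3, D4, D5, D6, D7, D8.
  assert (Dt_eq : forall i, Dt i = cval t s Y (realize environment (field_t e d i)) / t)
    by (intros i; rewrite <- Ft; field; exact Ht).
  assert (Ds_eq : forall i, Ds i
      = cval t s Y (realize environment (field_s e d i)) / (s * (1 - s)))
    by (intros i; rewrite <- Fs; field; split; assumption).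
  destruct (field_values e d environment t s Y)
    as [V1 [V2 [V3 [V4 [V5 [V6 [V7 V8]]]]]]].
  rewrite !Dt_eq, !Ds_eq, V1, V2, V3, V4, V5, V6, V7, V8.
  change (y Q1 t s) with (Y Q1); change (y Q2 t s) with (Y Q2).
  change (y P1 t s) with (Y P1); change (y P2 t s) with (Y P2).
  split; [split; eexists; [exact T1|exact S1]|].
  split; [split; eexists; [exact T2|exact S2]|].
  split; [split; eexists; [exact T3|exact S3]|].
  split; [split; eexists; [exact T4|exact S4]|].
  clear - Ht Hs Hs1' Hs1''.
  generalize (cval t s Y (realize environment (spartial Q1 (K1 e d)))),
    (cval t s Y (realize environment (spartial Q2 (K1 e d)))),
    (cval t s Y (realize environment (spartial P1 (K1 e d)))),
    (cval t s Y (realize environment (spartial P2 (K1 e d)))),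
    (cval t s Y (realize environment (spartial Q1 (K2 e d)))),
    (cval t s Y (realize environment (spartial Q2 (K2 e d)))),
    (cval t s Y (realize environment (spartial P1 (K2 e d)))),
    (cval t s Y (realize environment (spartial P2 (K2 e d)))),
    (Y Q1), (Y Q2), (Y P1), (Y P2).
  clear Y; intros; destruct e, d; simpl; repeat split; field; auto using C1_nz.
Qed.
End BlowDown.


(** * Expansions modulo monomial ideals *)

Definition shift_s (a : ps) : ps := fun m => shift (a m).

Lemma majorized_shift_t rho delta a : (0 < rho)%R -> majorized rho delta a ->
  majorized rho (delta / rho) (shift a).
Proof.
  intros Hr Ha K.
  assert (H : (rho * norm2 rho (shift a) K <= delta)%R).
  { apply Rle_trans with (2 := Ha (S K)).
    apply Rle_trans with
      (norm1 (fun c => norm1 Cmod rho c K) rho a (S K)).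
    - simpl; pose proof (norm1_Cmod_pos rho (Rlt_le _ _ Hr) (a O) K).
      unfold norm2; lra.
    - apply norm1_le; [lra|]; intros m _.
      apply norm1_S; [exact Cmod_ge_0|lra]. }
  apply Rmult_le_reg_l with rho; [exact Hr|].
  replace (rho * (delta / rho))%R with delta by (field; lra); exact H.
Qed.

Lemma majorized_shift_s rho delta a : (0 < rho)%R -> majorized rho delta a ->
  majorized rho (delta / rho) (shift_s a).
Proof.
  intros Hr Ha K.
  assert (Hscal : forall (nu : (nat -> C) -> R) b L,
    norm1 (fun c => rho * nu c)%R rho b L = (rho * norm1 nu rho b L)%R).
  { intros nu b L; revert b; induction L as [|L IH]; intros b; simpl;
      [reflexivity|rewrite IH; ring]. }
  assert (H : (rho * norm2 rho (shift_s a) K <= delta)%R).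
  { apply Rle_trans with (2 := Ha (S K)).
    unfold norm2; rewrite <- Hscal.
    apply Rle_trans with (norm1 (fun c => norm1 Cmod rho c (S K)) rho a K).
    - apply norm1_le; [lra|]; intros m _; unfold shift_s; simpl.
      pose proof (Cmod_ge_0 (a m O)); lra.
    - apply norm1_S; [|lra].
      intros c; apply norm1_Cmod_pos; lra. }
  apply Rmult_le_reg_l with rho; [exact Hr|].
  replace (rho * (delta / rho))%R with delta by (field; lra); exact H.
Qed.

Lemma eval_zero t s (a : ps) : (forall m n, a m n = 0) -> eval t s a = 0.
Proof.
  intros H; replace a with (pcst 0); [apply eval_cst|].
  apply ps_ext; intros m n; rewrite H; apply pcst_zero.
Qed.

Lemma evaluable_T t s : evaluable t s pT.
Proof.
  pose proof (Cmod_ge_0 t); pose proof (Cmod_ge_0 s).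
  apply majorized_evaluable with (Cmod t + Cmod s)%R (Cmod t + Cmod s)%R;
    [apply majorized_T; lra|lra|lra].
Qed.

Lemma evaluable_S t s : evaluable t s pS.
Proof.
  pose proof (Cmod_ge_0 t); pose proof (Cmod_ge_0 s).
  apply majorized_evaluable with (Cmod t + Cmod s)%R (Cmod t + Cmod s)%R;
    [apply majorized_S; lra|lra|lra].
Qed.

Section Expansions.
Variable rho : R.
Hypothesis rho_pos : (0 < rho)%R.

Lemma eval_factor i j delta (a : ps) : majorized rho delta a ->
  (forall m n, (m < i)%nat \/ (n < j)%nat -> a m n = 0) ->
  let g : ps := fun m n => a (i + m)%nat (j + n)%nat in
  (exists d, majorized rho d g) /\
  forall t s, (Cmod t < rho)%R -> (Cmod s < rho)%R ->
    eval t s a = eval t s g * (t ^ i * s ^ j).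
Proof.
  cbv zeta; revert delta a; induction i as [|i IHi]; intros delta a Ha Hz.
  - revert delta a Ha Hz; induction j as [|j IHj]; intros delta a Ha Hz.
    + split; [exists delta; exact Ha|]; intros t s _ _.
      change (fun m n => a (0 + m)%nat (0 + n)%nat) with a; simpl; ring.
    + pose proof (majorized_shift_s rho delta a rho_pos Ha) as Hs.
      destruct (IHj _ _ Hs) as [Hg E].
      { intros m n [Hm|Hn]; [lia|]; apply Hz; lia. }
      split; [exact Hg|]; intros t s Ht Hs'.
      replace (eval t s a) with (eval t s (pS * shift_s a)%ps).
      2:{ f_equal; apply ps_ext; intros m n; rewrite pS_mul.
          destruct n as [|n]; [symmetry; apply Hz; lia|reflexivity]. }
      rewrite eval_mul, eval_S, E; try assumption;
        [unfold shift_s, shift; simpl; ring|apply evaluable_S|].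
      apply majorized_evaluable with rho (delta / rho)%R; [exact Hs|lra|lra].
  - pose proof (majorized_shift_t rho delta a rho_pos Ha) as Hs.
    destruct (IHi _ _ Hs) as [Hg E].
    { intros m n Hmn; apply Hz; lia. }
    split; [exact Hg|]; intros t s Ht Hs'.
    replace (eval t s a) with (eval t s (pT * shift a)%ps).
    2:{ f_equal; apply ps_ext; intros m n; rewrite pT_mul.
        destruct m as [|m]; [symmetry; apply Hz; lia|reflexivity]. }
    rewrite eval_mul, eval_T, E; try assumption;
      [unfold shift; simpl; ring|apply evaluable_T|].
    apply majorized_evaluable with rho (delta / rho)%R; [exact Hs|lra|lra].
Qed.

Definition mask (p : nat -> nat -> bool) (a : ps) : ps :=
  fun m n => if p m n then a m n else 0.

Lemma majorized_mask p delta a :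
  majorized rho delta a -> majorized rho delta (mask p a).
Proof.
  apply majorized_dominated; [lra|]; intros m n; unfold mask.
  destruct (p m n); [apply Rle_refl|rewrite Cmod_0; apply Cmod_ge_0].
Qed.

Lemma eval_mask p delta a t s : majorized rho delta a ->
  (Cmod t < rho)%R -> (Cmod s < rho)%R ->
  eval t s a = eval t s (mask p a) + eval t s (mask (fun m n => negb (p m n)) a).
Proof.
  intros Ha Ht Hs; rewrite <- eval_add.
  - f_equal; apply ps_ext; intros m n; unfold padd, mask; simpl.
    destruct (p m n); simpl; ring.
  - apply majorized_evaluable with rho delta; [apply majorized_mask, Ha|lra|lra].
  - apply majorized_evaluable with rho delta; [apply majorized_mask, Ha|lra|lra].
Qed.

Definition above (ij : nat * nat) (m n : nat) : bool :=
  ((fst ij <=? m) && (snd ij <=? n))%bool%nat.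

(** Peel off the multiples of the first generator and recurse on the rest. *)
Lemma in_ideal_monomials L delta (a : ps) : majorized rho delta a ->
  (forall m n, existsb (fun ij => above ij m n) L = false -> a m n = 0) ->
  in_ideal (map (fun ij => mon (fst ij) (snd ij)) L) (fun t s => eval t s a).
Proof.
  revert delta a; induction L as [|[i j] L IH]; intros delta a Ha Hz.
  - exists 1%R; split; [lra|]; intros t s _ _; apply eval_zero.
    intros m n; apply Hz; reflexivity.
  - destruct (eval_factor i j delta (mask (above (i, j)) a)) as [[d Hg] E].
    + apply majorized_mask, Ha.
    + intros m n Hmn; unfold mask, above; simpl.
      destruct (Nat.leb_spec i m), (Nat.leb_spec j n); simpl; auto; lia.
    + exists (fun t s => eval t s
          (fun m n => mask (above (i, j)) a (i + m)%nat (j + n)%nat)),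
        (fun t s => eval t s (mask (fun m n => negb (above (i, j) m n)) a)).
      split; [apply eval_convergent with rho d; assumption|split].
      * apply (IH delta); [apply majorized_mask, Ha|].
        intros m n Hmn; unfold mask.
        destruct (above (i, j) m n) eqn:Eab; simpl; [reflexivity|].
        apply Hz; simpl; rewrite Eab; exact Hmn.
      * exists rho; split; [exact rho_pos|]; intros t s Ht Hs.
        rewrite (eval_mask (above (i, j)) delta a t s Ha Ht Hs).
        rewrite (E t s Ht Hs); reflexivity.
Qed.

(** Expansions are reduced to the finitely many coefficients outside a monomial
    ideal. *)
Lemma expands_coef f pref lead L delta (a : ps) i j :
  majorized rho delta a ->
  near0 (fun t s => t <> 0 -> s <> 0 -> f t s = pref t s * eval t s a) ->
  (forall t s, lead t s = a i j * (t ^ i * s ^ j)) ->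
  (forall m n, existsb (fun ij => above ij m n) L = false ->
     (m, n) <> (i, j) -> a m n = 0) ->
  existsb (fun ij => above ij i j) L = false ->
  expands f pref lead (map (fun ij => mon (fst ij) (snd ij)) L).
Proof.
  intros Ha [r [Hr Hf]] Hlead Hz Hij.
  set (p := fun m n => ((m =? i) && (n =? j))%bool%nat).
  exists (fun t s => eval t s (mask (fun m n => negb (p m n)) a)); split.
  - apply in_ideal_monomials with delta; [apply majorized_mask, Ha|].
    intros m n Hmn; unfold mask, p.
    destruct (Nat.eqb_spec m i), (Nat.eqb_spec n j); simpl; try reflexivity;
      apply Hz; congruence.
  - assert (Emask : forall t s, (Cmod t < rho)%R -> (Cmod s < rho)%R ->
      eval t s (mask p a) = a i j * (t ^ i * s ^ j)).
    { intros t s Ht Hs.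
      destruct (eval_factor i j delta (mask p a)) as [_ E].
      - apply majorized_mask, Ha.
      - intros m n Hmn; unfold mask, p.
        destruct (Nat.eqb_spec m i), (Nat.eqb_spec n j); simpl; try reflexivity; lia.
      - rewrite E by assumption; f_equal.
        rewrite <- (eval_cst t s (a i j)); f_equal.
        apply ps_ext; intros m n; unfold mask, p, pcst, z1.
        destruct (Nat.eqb_spec (i + m) i), (Nat.eqb_spec (j + n) j);
          destruct m, n; simpl; try lia; rewrite ?Nat.add_0_r; reflexivity. }
    exists (Rmin r rho); split; [apply Rmin_glb_lt; assumption|].
    intros t s Ht Hs Ht0 Hs0.
    assert (Ht' : (Cmod t < rho)%R) by (apply Rlt_le_trans with (1 := Ht), Rmin_r).
    assert (Hs' : (Cmod s < rho)%R) by (apply Rlt_le_trans with (1 := Hs), Rmin_r).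
    rewrite Hf; try assumption;
      [|apply Rlt_le_trans with (1 := Ht), Rmin_l
       |apply Rlt_le_trans with (1 := Hs), Rmin_l].
    rewrite (eval_mask p delta a t s Ha Ht' Hs'), Emask, Hlead by assumption.
    reflexivity.
Qed.
End Expansions.

(** * From formal to meromorphic solutions *)

Lemma near0_true (P : C -> C -> Prop) : (forall t s, P t s) -> near0 P.
Proof. intros H; exists 1%R; split; [lra|auto]. Qed.

Definition psT (e : bool) : ps := if e then pT else pcst 1.
Definition psS (d : bool) : ps := if d then pS else pcst 1.

Lemma eval_psT e t s : eval t s (psT e) = tpow e t.
Proof. destruct e; [apply eval_T|apply eval_cst]. Qed.

Lemma eval_psS d t s : eval t s (psS d) = tpow d s.
Proof. destruct d; [apply eval_S|apply eval_cst]. Qed.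

Lemma psT_majorized rho e : (0 <= rho)%R -> exists d, majorized rho d (psT e).
Proof.
  intros Hr; destruct e; [exists rho; apply majorized_T, Hr|].
  exists (Cmod 1); apply majorized_cst.
Qed.

Lemma psS_majorized rho d : (0 <= rho)%R -> exists d', majorized rho d' (psS d).
Proof.
  intros Hr; destruct d; [exists rho; apply majorized_S, Hr|].
  exists (Cmod 1); apply majorized_cst.
Qed.

Lemma tpow_not_null e : ~ near0 (fun t s => tpow e t = 0) /\
                        ~ near0 (fun t s => tpow e s = 0).
Proof.
  assert (K : forall r : R, (0 < r)%R ->
    (Cmod (RtoC (r / 2)) < r)%R /\ RtoC (r / 2) <> 0).
  { intros r Hr; split; [rewrite Cmod_R, Rabs_pos_eq; lra|].
    intros E; apply RtoC_inj in E; lra. }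
  split; intros [r [Hr H]]; destruct (K r Hr) as [K1 K2];
    exact (tpow_neq0 e _ K2 (H _ _ K1 K1)).
Qed.

Lemma one_not_null : ~ near0 (fun t s => RtoC 1 = 0).
Proof.
  intros [r [Hr H]]; apply C1_nz, (H 0 0); rewrite Cmod_0; exact Hr.
Qed.

Lemma eval_meromorphic_mul rho delta delta' a b f :
  (0 < rho)%R -> majorized rho delta a -> majorized rho delta' b ->
  (forall t s, f t s = eval t s a * eval t s b) -> meromorphic f.
Proof.
  intros Hr Ha Hb Hf.
  exists (fun t s => eval t s (a * b)%ps), (fun t s => 1).
  split; [|split; [|split; [exact one_not_null|]]].
  - apply eval_convergent with rho (delta * delta')%R; [exact Hr|].
    apply majorized_mul; [lra|assumption|assumption].
  - pose proof (eval_convergent rho _ _ Hr (majorized_cst rho 1)) as H.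
    replace (fun _ _ : C => RtoC 1) with (fun t s => eval t s (pcst 1));
      [exact H|].
    apply functional_extensionality; intros t.
    apply functional_extensionality; intros s; apply eval_cst.
  - exists rho; split; [exact Hr|]; intros t s Ht Hs _; rewrite Hf, eval_mul.
    + field; apply C1_nz.
    + apply majorized_evaluable with rho delta; [assumption|lra|lra].
    + apply majorized_evaluable with rho delta'; [assumption|lra|lra].
Qed.

Lemma eval_meromorphic_div rho delta delta' a b f :
  (0 < rho)%R -> majorized rho delta a -> majorized rho delta' b ->
  ~ near0 (fun t s => eval t s b = 0) ->
  (forall t s, f t s = eval t s a / eval t s b) -> meromorphic f.
Proof.
  intros Hr Ha Hb Hn Hf.
  exists (fun t s => eval t s a), (fun t s => eval t s b).
  split; [|split; [|split; [exact Hn|]]].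
  - apply eval_convergent with rho delta; assumption.
  - apply eval_convergent with rho delta'; assumption.
  - apply near0_true; intros t s _; apply Hf.
Qed.

Section Solutions.
Variables alpha0 alpha1 alpha2 alphaoo nu eta : C.
Hypothesis Hsum : alpha0 + alpha1 + alpha2 + alphaoo = 1 - 2 * nu.

Let env := environment alpha0 alpha2 alphaoo nu eta.

Definition garnier_t (e d : bool) (i : unknown) : poly := realize env (field_t e d i).
Definition garnier_s (e d : bool) (i : unknown) : poly := realize env (field_s e d i).

Definition germs (Y : unknown -> ps) (i : unknown) (t s : C) : C := eval t s (Y i).

(** All conditions of the analytic statement follow from the formal equations by
    evaluation. *)
Theorem garnier_solution e d Y rho delta :
  (0 < rho)%R -> (forall i, majorized rho delta (Y i)) ->
  (forall i, theta_t (Y i) = pval Y (garnier_t e d i)) ->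
  (forall i, delta_s (Y i) = pval Y (garnier_s e d i)) ->
  meromorphic_solution alpha0 alpha1 alpha2 alphaoo nu eta
    (down_q1 e (germs Y)) (down_q2 d (germs Y))
    (down_p1 e (germs Y)) (down_p2 d (germs Y)).
Proof.
  intros Hr HY HT HS.
  destruct (psT_majorized rho e) as [dT HdT]; [lra|].
  destruct (psS_majorized rho d) as [dS HdS]; [lra|].
  split; [|split; [|split; [|split]]].
  - apply (eval_meromorphic_div rho delta dT (Y Q1) (psT e)); auto.
    + intros [r [Hr' H]]; apply (proj1 (tpow_not_null e)); exists r.
      split; [exact Hr'|]; intros t s Ht Hs.
      rewrite <- (eval_psT e t s); apply H; assumption.
    + intros t s; rewrite eval_psT; reflexivity.
  - apply (eval_meromorphic_mul rho delta dS (Y Q2) (psS d)); auto.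
    intros t s; rewrite eval_psS; reflexivity.
  - apply (eval_meromorphic_mul rho delta dT (Y P1) (psT e)); auto.
    intros t s; rewrite eval_psT; reflexivity.
  - apply (eval_meromorphic_div rho delta dS (Y P2) (psS d)); auto.
    + intros [r [Hr' H]]; apply (proj2 (tpow_not_null d)); exists r.
      split; [exact Hr'|]; intros t s Ht Hs.
      rewrite <- (eval_psS d t s); apply H; assumption.
    + intros t s; rewrite eval_psS; reflexivity.
  - exists (Rmin rho 1); split; [apply Rmin_glb_lt; lra|].
    intros t s Ht Hs Ht0 Hs0.
    assert (Ht' : (Cmod t < rho)%R) by (apply Rlt_le_trans with (1 := Ht), Rmin_l).
    assert (Hs' : (Cmod s < rho)%R) by (apply Rlt_le_trans with (1 := Hs), Rmin_l).
    assert (Hs1 : s <> 1).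
    { intros E; pose proof (Rlt_le_trans _ _ _ Hs (Rmin_r _ _)) as H.
      rewrite E, Cmod_1 in H; lra. }
    apply (hamiltonian_blowdown alpha0 alpha1 alpha2 alphaoo nu eta Hsum e d
      (germs Y) t s
      (fun i => evalw (fun m n => dpow t m * s ^ n) (Y i))
      (fun i => evalw (fun m n => t ^ m * dpow s n) (Y i)));
      try assumption; intros i.
    + apply eval_derive_t with rho delta; auto.
    + apply eval_derive_s with rho delta; auto.
    + rewrite <- (eval_theta_t rho delta) by auto.
      rewrite HT; apply (eval_pval rho delta); auto; lra.
    + rewrite <- (eval_delta_s rho delta) by auto.
      rewrite HS; apply (eval_pval rho delta); auto; lra.
Qed.
End Solutions.


(** * The solutions *)

Lemma nonint_neq z (k : Z) : ~ is_int z -> z <> RtoC (IZR k).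
Proof. intros H E; apply H; exists k; exact E. Qed.

Lemma nonint_affine z w (k : Z) : ~ is_int z ->
  w = RtoC (IZR k) + z \/ w = RtoC (IZR k) - z -> w <> 0.
Proof.
  intros H [E|E] E0; rewrite E0 in E; apply H.
  - exists (- k)%Z; rewrite opp_IZR, RtoC_opp.
    transitivity (RtoC (IZR k) + z - RtoC (IZR k)); [ring|rewrite <- E; ring].
  - exists k; transitivity (RtoC (IZR k) - (RtoC (IZR k) - z));
      [ring|rewrite <- E; ring].
Qed.

Lemma nonint_opp z : ~ is_int z -> ~ is_int (- z).
Proof.
  intros H [k E]; apply H; exists (- k)%Z.
  rewrite opp_IZR, RtoC_opp, <- E; ring.
Qed.

Lemma mul_coef00 (a b : ps) : (a * b)%ps 0%nat 0%nat = a 0%nat 0%nat * b 0%nat 0%nat.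
Proof. reflexivity. Qed.
Lemma mul_coef10 (a b : ps) :
  (a * b)%ps 1%nat 0%nat
  = a 0%nat 0%nat * b 1%nat 0%nat + a 1%nat 0%nat * b 0%nat 0%nat.
Proof. reflexivity. Qed.
Lemma mul_coef01 (a b : ps) :
  (a * b)%ps 0%nat 1%nat
  = a 0%nat 0%nat * b 0%nat 1%nat + a 0%nat 1%nat * b 0%nat 0%nat.
Proof. reflexivity. Qed.
Lemma mul_coef11 (a b : ps) :
  (a * b)%ps 1%nat 1%nat
  = a 0%nat 0%nat * b 1%nat 1%nat + a 0%nat 1%nat * b 1%nat 0%nat
    + (a 1%nat 0%nat * b 0%nat 1%nat + a 1%nat 1%nat * b 0%nat 0%nat).
Proof. reflexivity. Qed.

Lemma add_coef (a b : ps) m n : (a + b)%ps m n = a m n + b m n.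
Proof. reflexivity. Qed.
Lemma sub_coef (a b : ps) m n : (a - b)%ps m n = a m n - b m n.
Proof. reflexivity. Qed.

(** Simplifying at [t = s = 0] before taking values keeps the Jacobians small
    enough for [field]. *)
Fixpoint at0 (e : sym) : sym :=
  match e with
  | ST | SS => Num 0
  | SAdd e1 e2 => sadd0 (at0 e1) (at0 e2)
  | SOpp e1 => sopp0 (at0 e1)
  | SMul e1 e2 => smul0 (at0 e1) (at0 e2)
  | _ => e
  end.

Lemma val0_at0 Y0 env e : val0 Y0 (realize env e) = val0 Y0 (realize env (at0 e)).
Proof.
  unfold val0, cval; induction e; simpl; try reflexivity.
  - rewrite IHe1, IHe2; symmetry.
    apply (sem_sadd0 C_ring_theory (fun c => c) eq_refl).
  - rewrite IHe; symmetry.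
    apply (sem_sopp0 C_ring_theory (fun c => c) eq_refl).
  - rewrite IHe1, IHe2; symmetry.
    apply (sem_smul0 C_ring_theory (fun c => c) eq_refl eq_refl).
Qed.

Lemma lin0_partials Y0 env e v :
  let J i := val0 Y0 (realize env (at0 (spartial i e))) in
  lin0 Y0 v (realize env e) = J Q1 * v Q1 + J Q2 * v Q2 + J P1 * v P1 + J P2 * v P2.
Proof.
  cbv zeta beta; rewrite <- !val0_at0; unfold val0, cval, spartial.
  rewrite !(sem_sderiv C_ring_theory (fun c => c) eq_refl eq_refl).
  unfold lin0, cdiff; induction e; simpl in *; try ring.
  - destruct i; simpl; ring.
  - rewrite IHe1, IHe2; ring.
  - rewrite IHe; ring.
  - rewrite IHe1, IHe2; ring.
Qed.

Lemma lin0_combine Y0 a b F G v i :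
  lin0 Y0 v (combine a b F G i)
  = RtoC (INR a) * lin0 Y0 v (F i) + RtoC (INR b) * lin0 Y0 v (G i).
Proof. unfold combine, lin0, cdiff; simpl; ring. Qed.

Lemma val0_combine Y0 a b F G i :
  val0 Y0 (combine a b F G i)
  = RtoC (INR a) * val0 Y0 (F i) + RtoC (INR b) * val0 Y0 (G i).
Proof. reflexivity. Qed.

(** The characteristic equation of a Hamiltonian matrix, applied to [M]. *)
Definition quartic (mu1 mu2 : C) (M : (unknown -> C) -> unknown -> C) : Prop :=
  forall v i, M (M (M (M v))) i - (mu1 ^ 2 + mu2 ^ 2) * M (M v) i
    + mu1 ^ 2 * mu2 ^ 2 * v i = 0.

Lemma quartic_of_square mu M :
  (forall v i, M (M v) i = mu ^ 2 * v i) -> quartic mu mu M.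
Proof. intros HM v i; rewrite (HM (M (M v))), HM; ring. Qed.

Lemma quartic_ext mu1 mu2 (M M' : (unknown -> C) -> unknown -> C) :
  (forall v i, M v i = M' v i) -> quartic mu1 mu2 M' -> quartic mu1 mu2 M.
Proof.
  intros E H.
  replace M with M'; [exact H|].
  apply functional_extensionality; intros v; apply functional_extensionality;
    intros i; symmetry; apply E.
Qed.

Lemma pcst_two : pcst 2 = (pcst 1 + pcst 1)%ps.
Proof. rewrite <- pcst_add; f_equal; ring. Qed.

Lemma mul_axis (a b : ps) m :
  (a * b)%ps m 0%nat
  = conv Cplus Cmult (fun k => a k 0%nat) (fun k => b k 0%nat) m.
Proof.
  revert a; induction m as [|m IH]; intros a; [reflexivity|].
  change (((a * b)%ps (S m) 0%nat))
    with (a 0%nat 0%nat * b (S m) 0%nat + (shift a * b)%ps m 0%nat).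
  rewrite IH; reflexivity.
Qed.

Lemma conv_cancel (x : nat -> C) : x O <> 0 -> forall m (a : nat -> C),
  (forall k, (k <= m)%nat -> conv Cplus Cmult a x k = 0) -> a m = 0.
Proof.
  intros Hx; induction m as [|m IH]; intros a H.
  - destruct (Ceq_dec (a O) 0) as [|Ha]; [assumption|exfalso].
    apply (Cmult_neq_0 _ _ Ha Hx), (H O); lia.
  - assert (Ha : a O = 0).
    { destruct (Ceq_dec (a O) 0) as [|Ha]; [assumption|exfalso].
      apply (Cmult_neq_0 _ _ Ha Hx), (H O); lia. }
    apply (IH (shift a)); intros k Hk.
    rewrite <- (H (S k)) by lia; simpl; rewrite Ha; ring.
Qed.

(** On [s = 0] the equation reads [0 = a * X] with [X] invertible. *)
Lemma axis_zero (a X W : ps) :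
  delta_s a = (a * X + pS * W)%ps -> X 0%nat 0%nat <> 0 ->
  forall m, a m 0%nat = 0.
Proof.
  intros E HX m.
  apply (conv_cancel (fun k => X k 0%nat) HX m (fun k => a k 0%nat)).
  intros k _; rewrite <- mul_axis.
  pose proof (f_equal (fun f => f k 0%nat) E) as Ek; cbv beta in Ek.
  rewrite delta_s_coef, add_coef, pS_mul in Ek.
  transitivity ((a * X)%ps k 0%nat + 0); [ring|rewrite <- Ek; simpl; ring].
Qed.

Lemma one_sub_neq0 (k : C) : k <> 1 -> 1 - k <> 0.
Proof.
  intros Hk H; apply Hk; replace k with (1 - (1 - k)) by ring; rewrite H; ring.
Qed.

Lemma linear_solve (x k c : C) : k <> 1 -> x = x * k + c -> x = c / (1 - k).
Proof.
  intros Hk E; pose proof (one_sub_neq0 k Hk) as H.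
  assert (Ec : c = x * (1 - k)).
  { transitivity (x * k + c - x * k); [ring|rewrite <- E; ring]. }
  rewrite Ec; field; exact H.
Qed.

Ltac constant_term :=
  repeat first [rewrite mul_coef00 | rewrite add_coef | rewrite sub_coef].

(** Exponents of the generators [t] and [s]. *)
Definition maximal_ideal : list (nat * nat) := [(1, 0); (0, 1)]%nat.

Definition expands_constant (f pref : C -> C -> C) (c : C) : Prop :=
  expands f pref (fun _ _ => c) [mon 1 0; mon 0 1].

Section Cases.
Variables alpha0 alpha1 alpha2 alphaoo nu eta : C.
Hypothesis Hsum : alpha0 + alpha1 + alpha2 + alphaoo = 1 - 2 * nu.
Hypothesis Hgen : generic alpha0 alpha1 alpha2 alphaoo.

Let gt := garnier_t alpha0 alpha2 alphaoo nu eta.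
Let gs := garnier_s alpha0 alpha2 alphaoo nu eta.

Lemma alpha0_eq : alpha0 = 1 - 2 * nu - alpha1 - alpha2 - alphaoo.
Proof. rewrite <- Hsum; ring. Qed.

Lemma alphaoo_eq : alphaoo = 1 - 2 * nu - alpha0 - alpha1 - alpha2.
Proof. rewrite <- Hsum; ring. Qed.

Lemma solution_at e d Y0 a b mu1 mu2 :
  regular_system (gt e d) (gs e d) Y0 a b mu1 mu2 ->
  exists Y rho delta,
    (0 < rho)%R /\ (forall i, majorized rho delta (Y i)) /\
    (forall i, Y i O O = Y0 i) /\
    (forall i, theta_t (Y i) = pval Y (gt e d i)) /\
    (forall i, delta_s (Y i) = pval Y (gs e d i)) /\
    meromorphic_solution alpha0 alpha1 alpha2 alphaoo nu eta
      (down_q1 e (germs Y)) (down_q2 d (germs Y))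
      (down_p1 e (germs Y)) (down_p2 d (germs Y)).
Proof.
  intros H.
  destruct (regular_system_solution _ _ _ _ _ _ _ H)
    as [Y [rho [delta [Hr [HY [H0 [HT HS]]]]]]].
  exists Y, rho, delta; repeat (split; [assumption|]).
  apply (garnier_solution alpha0 alpha1 alpha2 alphaoo nu eta Hsum e d Y rho delta);
    assumption.
Qed.

Ltac linear_part :=
  intros v i; rewrite lin0_combine; unfold gt, gs, garnier_t, garnier_s;
  rewrite !lin0_partials; cbv zeta beta;
  destruct i;
  repeat match goal with |- context [at0 ?e] =>
    let x := eval vm_compute in (at0 e) in change (at0 e) with x end;
  unfold val0, cval; simpl.

Ltac base_point :=
  intros i; rewrite val0_combine; unfold gt, gs, garnier_t, garnier_s;
  match goal with |- context [field_t ?e ?d i] =>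
    rewrite (val0_at0 _ _ (field_t e d i)), (val0_at0 _ _ (field_s e d i)) end;
  destruct i;
  repeat match goal with |- context [at0 ?e] =>
    let x := eval vm_compute in (at0 e) in change (at0 e) with x end;
  unfold val0, cval; simpl.

Ltac field_component :=
  unfold gt, gs, garnier_t, garnier_s, pval;
  match goal with |- context [realize _ ?e] =>
    let x := eval vm_compute in e in change e with x end;
  cbn [realize interp].

(** Runs through the finitely many monomials outside the ideal at hand, leaving
    the coefficients which are not known to vanish. *)
Ltac outside :=
  let m := fresh "m" in let n := fresh "n" in
  let Hc := fresh "Hc" in let Hne := fresh "Hne" in
  intros m n Hc Hne;
  destruct m as [|[|[|m]]], n as [|[|n]]; simpl in Hc; try discriminate Hc;
  try (exfalso; apply Hne; reflexivity); try assumption.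

Ltac expand rho Hr L delta a Ha i j :=
  apply (expands_coef rho Hr _ _ _ L delta a i j Ha); [| | |reflexivity];
  [apply near0_true; intros; unfold down_q1, down_q2, down_p1, down_p2, germs;
   simpl; fold a; field; auto using C1_nz
  |intros; simpl
  |outside].

Ltac name_unknowns Y H0 :=
  pose proof (H0 Q1) as A0; pose proof (H0 Q2) as U0;
  pose proof (H0 P1) as B0; pose proof (H0 P2) as V0;
  simpl in A0, U0, B0, V0;
  set (A := Y Q1) in *; set (u := Y Q2) in *;
  set (B := Y P1) in *; set (v := Y P2) in *.

Ltac name_parameters :=
  set (n := pcst nu); set (aoo := pcst alphaoo); set (a2 := pcst alpha2);
  set (a0 := pcst alpha0); set (one := pcst 1); set (two := (one + one)%ps);
  set (a1 := (one - two * n - a0 - a2 - aoo)%ps); set (eps := pcst eta).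

(** ** Solutions holomorphic at the origin *)

(** Here [p1 = 0] along [s = 0], and the eigenvalues along [s] alone, [alphaoo +
    alpha1] and its opposite, both double, already avoid the integers: [a = 0]. *)
Definition base_holomorphic : unknown -> C :=
  coords (eta / alphaoo) ((alphaoo + alpha1) / alphaoo) 0
    (- nu * alphaoo / (alphaoo + alpha1)).

Definition linear_holomorphic (v : unknown -> C) : unknown -> C :=
  let q := eta / alphaoo in let Q := (alphaoo + alpha1) / alphaoo in
  let P := - nu * alphaoo / (alphaoo + alpha1) in
  let beta := alphaoo + alpha1 in let kappa := 2 * nu * (Q - 1) - beta in
  coords
    (- beta * v Q1 + 2 * nu * q * v Q2 - 2 * q ^ 2 * Q * v P1 - 2 * q * Q ^ 2 * v P2)
    (kappa * v Q2 - 2 * q * Q ^ 2 * v P1 - 2 * Q ^ 2 * (Q - 1) * v P2)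
    (beta * v P1)
    (((6 * Q - 2) * P ^ 2 + 2 * (2 * nu + alphaoo) * P) * v Q2
     - 2 * nu * q * v P1 - kappa * v P2).

Lemma regular_holomorphic : regular_system (gt false false) (gs false false) base_holomorphic 0 1
  (alphaoo + alpha1) (alphaoo + alpha1).
Proof.
  destruct Hgen as [Ha1 [Hoo [Hp _]]].
  pose proof (nonint_neq _ 0 Hoo) as Hoo0.
  rewrite Cplus_comm in Hp; pose proof (nonint_neq _ 0 Hp) as Hp0.
  constructor.
  - base_point; rewrite ?alpha0_eq; field; auto.
  - exact Hp.
  - exact Hp.
  - apply (quartic_ext _ _ _ linear_holomorphic).
    + linear_part; unfold linear_holomorphic; simpl; rewrite ?alpha0_eq; field; auto.
    + apply quartic_of_square; intros v i; unfold linear_holomorphic.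
      destruct i; simpl; field; auto.
  - intros Y i; apply fields_commute.
Qed.

Lemma solution_holomorphic : exists q1 q2 p1 p2 : C -> C -> C,
  meromorphic_solution alpha0 alpha1 alpha2 alphaoo nu eta q1 q2 p1 p2 /\
  expands_constant q1 (fun t s => 1)
    (eta / alphaoo) /\
  expands_constant q2 (fun t s => 1)
    ((alphaoo + alpha1) / alphaoo) /\
  expands p1 (fun t s => 1)
    (fun t s => - nu * alphaoo * (nu + alpha2)
        / ((alphaoo + alpha1) * (1 - alphaoo - alpha1)) * t * s)
    [mon 3 0; mon 2 1; mon 0 2] /\
  expands_constant p2 (fun t s => 1)
    (- nu * alphaoo / (alphaoo + alpha1)).
Proof.
  destruct (solution_at _ _ _ _ _ _ _ regular_holomorphic)
    as [Y [rho [delta [Hr [HY [H0 [HT [HS Hsol]]]]]]]].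
  destruct Hgen as [_ [Hoo [Hp _]]].
  pose proof (nonint_neq _ 0 Hoo) as Hoo0.
  rewrite Cplus_comm in Hp; pose proof (nonint_neq _ 0 Hp) as Hp0.
  pose proof (nonint_neq _ 1 Hp) as Hp1.
  pose proof (one_sub_neq0 _ Hp1) as Hd.
  assert (Hd' : 1 - alphaoo - alpha1 <> 0)
    by (apply (nonint_affine _ _ 1 Hp); right; ring).
  name_unknowns Y H0.
  name_parameters.
  set (X := (two * A * B * u + two * u * (u - pS) * v
             + (two * n + aoo + a2) * u - a2 * (u - pS))%ps).
  set (W := ((pS - one) * (u * v * v - a2 * v))%ps).
  assert (E : delta_s B = (B * X + pS * (pT * W))%ps).
  { unfold B at 1; rewrite HS; field_component; fold A u B v.
    rewrite pcst_two; unfold X, W, two, one, n, aoo, a0, a2, environment; ring. }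
  assert (X0 : X 0%nat 0%nat = alphaoo + alpha1).
  { unfold X, two; constant_term; rewrite A0, U0, B0, V0; unfold one, n, aoo, a2, pcst, pS; simpl; field; auto. }
  pose proof (axis_zero _ _ _ E) as Baxis; rewrite X0 in Baxis.
  specialize (Baxis Hp0).
  assert (B01 : B 0%nat 1%nat = 0).
  { pose proof (f_equal (fun f => f 0%nat 1%nat) E) as E1; cbv beta in E1.
    rewrite delta_s_coef, add_coef, mul_coef01, pS_mul, pT_mul, X0, !Baxis in E1.
    rewrite (linear_solve (B 0%nat 1%nat) (alphaoo + alpha1) 0 Hp1).
    - unfold Cdiv; ring.
    - transitivity (RtoC (INR 1) * B 0%nat 1%nat - RtoC (INR 0) * 0);
        [simpl; ring|rewrite E1; ring]. }
  assert (B11 : B 1%nat 1%nat = (nu + alpha2) * (- nu * alphaoo / (alphaoo + alpha1))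
                                / (1 - (alphaoo + alpha1))).
  { pose proof (f_equal (fun f => f 1%nat 1%nat) E) as E1; cbv beta in E1.
    rewrite delta_s_coef, add_coef, mul_coef11, pS_mul, pT_mul, X0, !Baxis, B01 in E1.
    apply linear_solve; [exact Hp1|].
    assert (W0 : W 0%nat 0%nat = (nu + alpha2) * (- nu * alphaoo / (alphaoo + alpha1))).
    { unfold W; constant_term; rewrite U0, V0.
      unfold a2, pcst, pS; simpl; field; auto. }
    rewrite W0 in E1.
    transitivity (RtoC (INR 1) * B 1%nat 1%nat - RtoC (INR 0) * 0);
      [simpl; ring|rewrite E1; ring]. }
  exists (down_q1 false (germs Y)), (down_q2 false (germs Y)),
    (down_p1 false (germs Y)), (down_p2 false (germs Y)).
  split; [exact Hsol|split; [|split; [|split]]].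
  - expand rho Hr maximal_ideal delta A (HY Q1) 0%nat 0%nat; rewrite A0; ring.
  - expand rho Hr maximal_ideal delta u (HY Q2) 0%nat 0%nat; rewrite U0; ring.
  - expand rho Hr [(3, 0); (2, 1); (0, 2)]%nat delta B (HY P1) 1%nat 1%nat;
      [rewrite B11; field; auto|apply Baxis..].
  - expand rho Hr maximal_ideal delta v (HY P2) 0%nat 0%nat; rewrite V0; ring.
Qed.

(** ** Solutions with [q2] vanishing and [p2] polar along [s = 0] *)

(** The equation of [v = s * p2] modulo its own multiples: what remains is
    divisible by [s]. *)
Lemma p2_near_axis e Y A0 B0 :
  (forall i, delta_s (Y i) = pval Y (gs e true i)) ->
  ~ is_int (alpha0 + alpha2) ->
  Y Q1 0%nat 0%nat = A0 -> Y P1 0%nat 0%nat = B0 -> Y P2 0%nat 0%nat = 0 ->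
  (forall m, Y P2 m 0%nat = 0) /\
  Y P2 0%nat 1%nat = (A0 ^ 2 * B0 ^ 2
    - ((alpha0 + alpha1 + alpha2 - 1) * A0 + (if e then 0 else eta)) * B0
    + nu * (nu + alphaoo)) / (1 - (alpha0 + alpha2)).
Proof.
  intros HS Hs EA EB EV.
  pose proof (nonint_neq _ 0 Hs) as Hs0; pose proof (nonint_neq _ 1 Hs) as Hs1.
  set (A := Y Q1) in *; set (u := Y Q2) in *.
  set (B := Y P1) in *; set (v := Y P2) in *.
  name_parameters.
  assert (E : exists X W, delta_s v = (v * X + pS * W)%ps /\
    X 0%nat 0%nat = alpha0 + alpha2 /\
    W 0%nat 0%nat = A0 ^ 2 * B0 ^ 2
      - ((alpha0 + alpha1 + alpha2 - 1) * A0 + (if e then 0 else eta)) * B0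
      + nu * (nu + alphaoo)).
  { exists (two * A * B * pS * (two * u - one)
       + ((pS * u - one) * (u - one) + u * pS * (u - one) + u * (pS * u - one)
          + (pS - one) * (if e then one else pT) * A) * v
       - ((a0 - one) * (two * pS * u - one) + a1 * pS * (two * u - one)
          + a2 * (pS * (u - one) + (pS * u - one)) + pS * (pS - one) * pT * eps)
       + (one - pS))%ps.
    exists (A * A * B * B
       - ((a0 + a1 - one) * A + a2 * A - eps * (pS - one) * (if e then pT else one))
         * B + n * (n + aoo))%ps.
    split; [|split].
    - unfold v at 1; rewrite HS; destruct e; field_component; fold A u B v;
        rewrite pcst_two;
        unfold a1, two, one, n, aoo, a0, a2, eps, environment; ring.
    - unfold a1, two; constant_term; rewrite EV.
      unfold one, n, aoo, a0, a2, eps, pcst, pT, pS; simpl; ring.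
    - unfold a1, two; destruct e; constant_term; rewrite EA, EB;
        unfold one, n, aoo, a0, a2, eps, pcst, pT, pS; simpl;
        rewrite (alpha1_eq _ _ _ _ _ Hsum); ring. }
  destruct E as [X [W [E [X0 W0]]]].
  pose proof (axis_zero _ _ _ E) as Vaxis; rewrite X0 in Vaxis.
  specialize (Vaxis Hs0); split; [exact Vaxis|].
  pose proof (f_equal (fun f => f 0%nat 1%nat) E) as E1; cbv beta in E1.
  rewrite delta_s_coef, add_coef, mul_coef01, pS_mul, X0, W0, !Vaxis in E1.
  apply linear_solve; [exact Hs1|].
  transitivity (RtoC (INR 1) * v 0%nat 1%nat - RtoC (INR 0) * 0);
    [simpl; ring|rewrite E1; ring].
Qed.

(** Along [t] the exponents are [alpha1], [- alpha1] and twice [0], along [s] they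
    are twice [0] and [mu], [- mu]: neither equation is nonresonant by itself,
    but their sum is. The two solutions are the two zeros [(u0, v0)] of the field
    along [s]. *)
Section ZeroQ2.
Variables u0 v0 mu : C.

Let q := - eta / alpha1.
Let kappa := 2 * (2 * u0 - 1) * v0 - (alpha0 + alpha2).

Hypothesis Hu : 2 * u0 * (u0 - 1) * v0 - alpha0 * u0 - alpha2 * (u0 - 1) = 0.
Hypothesis Hv : - (2 * u0 - 1) * v0 ^ 2 + (alpha0 + alpha2) * v0 = 0.
Hypothesis Hmu : kappa ^ 2 - 4 * u0 * (u0 - 1) * v0 ^ 2 = mu ^ 2.
Hypothesis Hmu_nonint : ~ is_int mu.

(** Two blocks, (Q1, P1) and (Q2, P2), with squares [alpha1 ^ 2] and [mu ^ 2]. *)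
Definition linear_q2_zero (v : unknown -> C) : unknown -> C :=
  coords (- alpha1 * v Q1 + 2 * q ^ 2 * v P1)
    (kappa * v Q2 + 2 * u0 * (u0 - 1) * v P2)
    (alpha1 * v P1)
    (- 2 * v0 ^ 2 * v Q2 - kappa * v P2).

Lemma regular_q2_zero :
  regular_system (gt false true) (gs false true) (coords q u0 0 v0) 1 1 alpha1 mu.
Proof.
  destruct Hgen as [Ha1 _].
  pose proof (nonint_neq _ 0 Ha1) as Ha10.
  constructor.
  - base_point.
    + unfold q; rewrite ?alphaoo_eq; field; auto.
    + etransitivity; [|exact Hu]; rewrite ?alphaoo_eq; ring.
    + rewrite ?alphaoo_eq; ring.
    + etransitivity; [|exact Hv]; rewrite ?alphaoo_eq; ring.
  - exact Ha1.
  - exact Hmu_nonint.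
  - apply (quartic_ext _ _ _ linear_q2_zero).
    + linear_part; unfold linear_q2_zero; simpl; unfold q, kappa;
        rewrite ?alphaoo_eq; field; auto.
    + assert (E : forall v, linear_q2_zero (linear_q2_zero v)
        = coords (alpha1 ^ 2 * v Q1) (mu ^ 2 * v Q2)
            (alpha1 ^ 2 * v P1) (mu ^ 2 * v P2)).
      { intros v; rewrite <- Hmu; unfold linear_q2_zero; simpl; f_equal; ring. }
      intros v i; rewrite !E; destruct i; simpl; ring.
  - intros Y i; apply fields_commute.
Qed.

Lemma solutions_q2_zero : exists Y rho delta,
  (0 < rho)%R /\ (forall i, majorized rho delta (Y i)) /\
  (forall i, Y i O O = coords q u0 0 v0 i) /\
  (forall i, delta_s (Y i) = pval Y (gs false true i)) /\
  meromorphic_solution alpha0 alpha1 alpha2 alphaoo nu eta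
    (down_q1 false (germs Y)) (down_q2 true (germs Y))
    (down_p1 false (germs Y)) (down_p2 true (germs Y)) /\
  expands_constant (down_q1 false (germs Y)) (fun t s => 1)
    (- eta / alpha1) /\
  expands_constant (down_q2 true (germs Y)) (fun t s => s)
    (u0) /\
  expands (down_p1 false (germs Y)) (fun t s => 1)
    (fun t s => (u0 * (u0 - 1) * v0 ^ 2
        - ((alpha0 + alpha1 - 1) * u0 + alpha2 * (u0 - 1)) * v0
        + nu * (nu + alphaoo)) / (1 - alpha1) * t)
    [mon 0 1; mon 2 0].
Proof.
  destruct (solution_at _ _ _ _ _ _ _ regular_q2_zero)
    as [Y [rho [delta [Hr [HY [H0 [HT [HS Hsol]]]]]]]].
  exists Y, rho, delta; repeat (split; [assumption|]).
  destruct Hgen as [Ha1 _].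
  pose proof (nonint_neq _ 0 Ha1) as Ha10.
  pose proof (nonint_neq _ 1 Ha1) as Ha11.
  pose proof (one_sub_neq0 _ Ha11) as Hd.
  name_unknowns Y H0.
  name_parameters.
  set (X := (two * A * (pT * A - one) * B + A * A * pT * B
             + (two + two) * pT * A * u * v
             - (two * (a0 + a2 - one) * pT * A + a1 * (two * pT * A - one)
                + eps * pT))%ps).
  set (W := (u * (u - one) * v * v
             - ((a0 + a1 - one) * u + a2 * (u - one)) * v + n * (n + aoo))%ps).
  assert (E : theta_t B = (B * X + pT * W)%ps).
  { unfold B at 1; rewrite HT; field_component; fold A u B v.
    rewrite pcst_two; unfold X, W, a1, two, one, n, aoo, a0, a2, eps, environment.
    ring. }
  assert (X0 : X 0%nat 0%nat = alpha1).
  { unfold X, a1, two; constant_term; rewrite A0, U0, B0, V0.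
    unfold one, n, aoo, a0, a2, eps, pcst, pT; simpl; rewrite ?alphaoo_eq.
    unfold q; field; auto. }
  assert (B10 : B 1%nat 0%nat = (u0 * (u0 - 1) * v0 ^ 2
        - ((alpha0 + alpha1 - 1) * u0 + alpha2 * (u0 - 1)) * v0
        + nu * (nu + alphaoo)) / (1 - alpha1)).
  { pose proof (f_equal (fun f => f 1%nat 0%nat) E) as E1; cbv beta in E1.
    unfold theta_t in E1; rewrite add_coef, mul_coef10, pT_mul, X0, B0 in E1.
    apply linear_solve; [exact Ha11|].
    assert (W0 : W 0%nat 0%nat = u0 * (u0 - 1) * v0 ^ 2
        - ((alpha0 + alpha1 - 1) * u0 + alpha2 * (u0 - 1)) * v0
        + nu * (nu + alphaoo)).
    { unfold W, a1, two; constant_term; rewrite U0, V0.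
      unfold one, n, aoo, a0, a2, pcst; simpl; rewrite ?alphaoo_eq; ring. }
    rewrite W0 in E1.
    transitivity (RtoC (INR 1) * B 1%nat 0%nat); [simpl; ring|rewrite E1; ring]. }
  split; [|split].
  - expand rho Hr maximal_ideal delta A (HY Q1) 0%nat 0%nat; rewrite A0; unfold q; ring.
  - expand rho Hr maximal_ideal delta u (HY Q2) 0%nat 0%nat; rewrite U0; ring.
  - expand rho Hr [(0, 1); (2, 0)]%nat delta B (HY P1) 1%nat 0%nat.
    rewrite B10; field; auto.
Qed.
End ZeroQ2.

Lemma solution_q2_zero : exists q1 q2 p1 p2 : C -> C -> C,
  meromorphic_solution alpha0 alpha1 alpha2 alphaoo nu eta q1 q2 p1 p2 /\
  expands_constant q1 (fun t s => 1)
    (- eta / alpha1) /\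
  expands_constant q2 (fun t s => s)
    (alpha2 / (alpha0 + alpha2)) /\
  expands p1 (fun t s => 1) (fun t s => nu * (nu + alphaoo) / (1 - alpha1) * t)
    [mon 0 1; mon 2 0] /\
  expands p2 (fun t s => / s)
    (fun t s => nu * (nu + alphaoo) / (1 - alpha0 - alpha2) * s)
    [mon 2 0; mon 1 1; mon 0 2].
Proof.
  destruct Hgen as [Ha1 [_ [_ [_ [Hs _]]]]].
  pose proof (nonint_neq _ 0 Hs) as Hs0; pose proof (nonint_neq _ 1 Hs) as Hs1.
  pose proof (one_sub_neq0 _ Hs1) as Hd.
  assert (Hd' : 1 - alpha0 - alpha2 <> 0)
    by (apply (nonint_affine _ _ 1 Hs); right; ring).
  pose proof (nonint_neq _ 0 Ha1) as Ha10.
  pose proof (one_sub_neq0 _ (nonint_neq _ 1 Ha1)) as Hd1.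
  destruct (solutions_q2_zero (alpha2 / (alpha0 + alpha2)) 0 (alpha0 + alpha2))
    as [Y [rho [delta [Hr [HY [H0 [HS [Hsol [E1 [E2 E3]]]]]]]]]];
    try (field; auto); [exact Hs|].
  exists (down_q1 false (germs Y)), (down_q2 true (germs Y)),
    (down_p1 false (germs Y)), (down_p2 true (germs Y)).
  split; [exact Hsol|split; [exact E1|split; [exact E2|split]]].
  { match goal with |- expands _ _ ?f _ => replace f with
      (fun t s : C => (alpha2 / (alpha0 + alpha2) * (alpha2 / (alpha0 + alpha2) - 1)
        * 0 ^ 2 - ((alpha0 + alpha1 - 1) * (alpha2 / (alpha0 + alpha2))
        + alpha2 * (alpha2 / (alpha0 + alpha2) - 1)) * 0
        + nu * (nu + alphaoo)) / (1 - alpha1) * t); [exact E3|] end.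
    apply functional_extensionality; intros t.
    apply functional_extensionality; intros s; field; auto. }
  clear E1 E2 E3 Hsol.
  destruct (p2_near_axis false Y _ _ HS Hs (H0 Q1) (H0 P1) (H0 P2))
    as [Vaxis V01]; simpl in V01.
  set (v := Y P2) in *.
  expand rho Hr [(2, 0); (1, 1); (0, 2)]%nat delta v (HY P2) 0%nat 1%nat;
    [rewrite V01; field; auto|apply Vaxis..].
Qed.

Lemma solution_p2_polar : exists q1 q2 p1 p2 : C -> C -> C,
  meromorphic_solution alpha0 alpha1 alpha2 alphaoo nu eta q1 q2 p1 p2 /\
  expands_constant q1 (fun t s => 1)
    (- eta / alpha1) /\
  expands_constant q2 (fun t s => s)
    (alpha2 / (alpha2 - alpha0)) /\
  expands p1 (fun t s => 1)
    (fun t s => (nu + alpha2) * (nu + alpha2 + alphaoo) / (1 - alpha1) * t)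
    [mon 0 1; mon 2 0] /\
  expands_constant p2 (fun t s => / s)
    (alpha2 - alpha0).
Proof.
  destruct Hgen as [Ha1 [_ [_ [_ [_ [Hs _]]]]]].
  pose proof (nonint_neq _ 0 Hs) as Hs0.
  assert (Hs0' : alpha2 - alpha0 <> 0)
    by (apply (nonint_affine _ _ 0 Hs); right; ring).
  pose proof (one_sub_neq0 _ (nonint_neq _ 1 Ha1)) as Hd1.
  destruct (solutions_q2_zero (alpha2 / (alpha2 - alpha0)) (alpha2 - alpha0)
    (alpha0 - alpha2))
    as [Y [rho [delta [Hr [HY [H0 [HS [Hsol [E1 [E2 E3]]]]]]]]]];
    try (field; auto); [exact Hs|].
  exists (down_q1 false (germs Y)), (down_q2 true (germs Y)),
    (down_p1 false (germs Y)), (down_p2 true (germs Y)).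
  split; [exact Hsol|split; [exact E1|split; [exact E2|split]]].
  { match type of E3 with expands _ _ ?f _ => match goal with
      |- expands _ _ ?g _ => replace g with f; [exact E3|] end end.
    apply functional_extensionality; intros t.
    apply functional_extensionality; intros s; rewrite ?alphaoo_eq; field; auto. }
  pose proof (H0 P2) as V0; simpl in V0; set (v := Y P2) in *.
  expand rho Hr maximal_ideal delta v (HY P2) 0%nat 0%nat; rewrite V0; ring.
Qed.

(** ** Solutions with [q1] polar along [t = 0] *)

Section PolarQ1.
Variables A0 u0 B0 v0 : C.

(** [K_AB] and the other entries are the second derivatives of [K1 - A * B] at
    the base point. *)
Definition linear_q1_polar (v : unknown -> C) : unknown -> C :=
  let b := alpha0 + alpha2 - 1 in
  let K_AA := (6 * A0 - 2) * B0 ^ 2 + 4 * B0 * u0 * v0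
              - (2 * b + 2 * alpha1) * B0 in
  let K_AB := 2 * (3 * A0 ^ 2 - 2 * A0) * B0 + 4 * A0 * u0 * v0
              - (2 * b * A0 + alpha1 * (2 * A0 - 1)) - 1 in
  let K_BB := 2 * A0 ^ 2 * (A0 - 1) in
  let K_Au := 4 * A0 * B0 * v0 + (2 * u0 - 1) * v0 ^ 2 - (b + alpha1) * v0 in
  let K_Av := 4 * A0 * B0 * u0 + 2 * u0 * (u0 - 1) * v0
              - ((alpha0 + alpha1 - 1) * u0 + alpha2 * (u0 - 1)) in
  let K_Bu := 2 * A0 ^ 2 * v0 in
  let K_Bv := 2 * A0 ^ 2 * u0 in
  let K_uu := 2 * A0 * v0 ^ 2 in
  let K_uv := 2 * A0 ^ 2 * B0 + 2 * A0 * (2 * u0 - 1) * v0 - (b + alpha1) * A0 in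
  let K_vv := 2 * A0 * u0 * (u0 - 1) in
  coords
    (- (K_AB * v Q1 + K_Bu * v Q2 + K_BB * v P1 + K_Bv * v P2))
    (- (K_Av * v Q1 + K_uv * v Q2 + K_Bv * v P1 + K_vv * v P2))
    (K_AA * v Q1 + K_Au * v Q2 + K_AB * v P1 + K_Av * v P2)
    (K_Au * v Q1 + K_uu * v Q2 + K_Bu * v P1 + K_uv * v P2).

Lemma linear_q1_polar_correct : forall v i,
  lin0 (coords A0 u0 B0 v0) v (combine 1 0 (gt true true) (gs true true) i)
  = linear_q1_polar v i.
Proof.
  linear_part; unfold linear_q1_polar; simpl; rewrite ?alphaoo_eq; ring.
Qed.
End PolarQ1.

(** At the next two points the exponents along [t] are [mu] and [- mu], both
    double, with [mu] the numerator of [A]: hence [a = 1] and [b = 0]. *)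
Definition base_q1_polar : unknown -> C :=
  coords ((alphaoo + alpha0 + alpha2) / alphaoo) (- alpha2 / alphaoo)
    (- nu * alphaoo / (alphaoo + alpha0 + alpha2)) 0.

Lemma regular_q1_polar : ~ is_int (alphaoo + alpha0 + alpha2) ->
  regular_system (gt true true) (gs true true) base_q1_polar 1 0
    (alphaoo + alpha0 + alpha2) (alphaoo + alpha0 + alpha2).
Proof.
  intros Hp; pose proof (nonint_neq _ 0 Hp) as Hp0.
  destruct Hgen as [_ [Hoo _]]; pose proof (nonint_neq _ 0 Hoo) as Hoo0.
  constructor.
  - base_point; field; auto.
  - exact Hp.
  - exact Hp.
  - apply (quartic_ext _ _ _ (linear_q1_polar (base_q1_polar Q1) (base_q1_polar Q2) (base_q1_polar P1) (base_q1_polar P2))); [apply linear_q1_polar_correct|].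
    apply quartic_of_square; intros v i; unfold linear_q1_polar, base_q1_polar.
    rewrite (alpha1_eq _ _ _ _ _ Hsum); destruct i; simpl; field; auto.
  - intros Y i; apply fields_commute.
Qed.

Definition base_q1_p2_polar : unknown -> C :=
  coords ((alphaoo + alpha0 - alpha2) / alphaoo) (alpha2 / alphaoo)
    (- (nu + alpha2) * alphaoo / (alphaoo + alpha0 - alpha2)) alphaoo.

Lemma regular_q1_p2_polar : ~ is_int (alphaoo + alpha0 - alpha2) ->
  regular_system (gt true true) (gs true true) base_q1_p2_polar 1 0
    (alphaoo + alpha0 - alpha2) (alphaoo + alpha0 - alpha2).
Proof.
  intros Hp; pose proof (nonint_neq _ 0 Hp) as Hp0.
  destruct Hgen as [_ [Hoo _]]; pose proof (nonint_neq _ 0 Hoo) as Hoo0.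
  constructor.
  - base_point; field; auto.
  - exact Hp.
  - exact Hp.
  - apply (quartic_ext _ _ _ (linear_q1_polar (base_q1_p2_polar Q1) (base_q1_p2_polar Q2) (base_q1_p2_polar P1) (base_q1_p2_polar P2))); [apply linear_q1_polar_correct|].
    apply quartic_of_square; intros v i; unfold linear_q1_polar, base_q1_p2_polar.
    rewrite (alpha1_eq _ _ _ _ _ Hsum); destruct i; simpl; field; auto.
  - intros Y i; apply fields_commute.
Qed.

(** Here [v] vanishes along [s = 0], so that [p2 = v / s] is holomorphic; its
    coefficient at [t] is that of [v] at [t * s], given by the equation along
    [t]. *)
Lemma solution_q1_polar : exists q1 q2 p1 p2 : C -> C -> C,
  meromorphic_solution alpha0 alpha1 alpha2 alphaoo nu eta q1 q2 p1 p2 /\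
  expands_constant q1 (fun t s => / t)
    ((alphaoo + alpha0 + alpha2) / alphaoo) /\
  expands q2 (fun t s => 1) (fun t s => - alpha2 / alphaoo * s)
    [mon 2 0; mon 1 1; mon 0 2] /\
  expands_constant p1 (fun t s => t)
    (- nu * alphaoo / (alphaoo + alpha0 + alpha2)) /\
  expands p2 (fun t s => 1)
    (fun t s => eta * nu * alphaoo * t
        / ((alpha1 + 2 * nu) * (alphaoo + alpha0 + alpha2)))
    [mon 0 1; mon 2 0].
Proof.
  assert (Hp : ~ is_int (alphaoo + alpha0 + alpha2)).
  { destruct Hgen as [_ [_ [_ [_ [_ [_ [H _]]]]]]].
    replace (alphaoo + alpha0 + alpha2) with (alpha0 + alpha2 + alphaoo) by ring.
    exact H. }
  pose proof (nonint_neq _ 0 Hp) as Hp0; pose proof (nonint_neq _ 1 Hp) as Hp1.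
  pose proof (one_sub_neq0 _ Hp1) as Hd.
  destruct (solution_at _ _ _ _ _ _ _ (regular_q1_polar Hp))
    as [Y [rho [delta [Hr [HY [H0 [HT [HS Hsol]]]]]]]].
  destruct Hgen as [_ [Hoo [_ [_ [Hs _]]]]].
  pose proof (nonint_neq _ 0 Hoo) as Hoo0.
  pose proof (nonint_neq _ 0 Hs) as Hs0; pose proof (nonint_neq _ 1 Hs) as Hs1.
  exists (down_q1 true (germs Y)), (down_q2 true (germs Y)),
    (down_p1 true (germs Y)), (down_p2 true (germs Y)).
  split; [exact Hsol|clear Hsol].
  name_unknowns Y H0.
  name_parameters.
  destruct (p2_near_axis true Y _ _ HS Hs A0 B0 V0) as [Vaxis V01].
  fold v in Vaxis, V01.
  replace (_ / _) with (RtoC 0) in V01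
    by (rewrite (alpha1_eq _ _ _ _ _ Hsum); field; auto using one_sub_neq0).
  set (X' := (two * A * A * B + A * (two * u - one) * v
     - ((a0 + a1 - one) * A + a2 * A - eps * pT * (pS - one)))%ps).
  assert (E' : theta_t v = (v * X' - pS * (pT * (eps * B)))%ps).
  { unfold v at 1; rewrite HT; field_component; fold A u B v.
    rewrite pcst_two; unfold X', a1, two, one, n, aoo, a0, a2, eps, environment.
    ring. }
  assert (X0' : X' 0%nat 0%nat = alphaoo + alpha0 + alpha2).
  { unfold X', a1, two; constant_term; rewrite A0, U0, B0, V0.
    unfold one, n, aoo, a0, a2, eps, pcst, pT, pS; simpl; field; auto. }
  assert (V11 : v 1%nat 1%nat
    = - (eta * (- nu * alphaoo / (alphaoo + alpha0 + alpha2)))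
      / (1 - (alphaoo + alpha0 + alpha2))).
  { pose proof (f_equal (fun f => f 1%nat 1%nat) E') as E1; cbv beta in E1.
    unfold theta_t in E1.
    rewrite sub_coef, mul_coef11, pS_mul, pT_mul, mul_coef00, X0', !Vaxis, V01, B0
      in E1.
    apply linear_solve; [exact Hp1|].
    transitivity (RtoC (INR 1) * v 1%nat 1%nat); [simpl; ring|].
    rewrite E1; unfold eps, pcst; simpl; ring. }
  assert (MS : forall d a, majorized rho d a ->
    near0 (fun t s => eval t s (pS * a)%ps = s * eval t s a)).
  { intros d a Ha; exists rho; split; [exact Hr|]; intros t s Ht Hs'.
    rewrite eval_mul, eval_S; [reflexivity|apply evaluable_S|].
    apply majorized_evaluable with rho d; [exact Ha|lra|lra]. }
  split; [|split; [|split]].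
  - expand rho Hr maximal_ideal delta A (HY Q1) 0%nat 0%nat; rewrite A0; ring.
  - apply (expands_coef rho Hr _ _ _ [(2, 0); (1, 1); (0, 2)]%nat
      (rho * delta) (pS * u)%ps 0 1); [| | |outside|reflexivity].
    + apply majorized_mul; [lra|apply majorized_S; lra|apply HY].
    + destruct (MS _ _ (HY Q2)) as [r [Hr' Hu]]; exists r; split; [exact Hr'|].
      intros t s Ht Hs' _ _; fold u in Hu; rewrite Hu by assumption.
      unfold down_q2, germs; fold u; simpl; ring.
    + intros t s; rewrite pS_mul, U0; simpl; ring.
    + rewrite pS_mul; reflexivity.
    + rewrite pS_mul; reflexivity.
  - expand rho Hr maximal_ideal delta B (HY P1) 0%nat 0%nat; rewrite B0; ring.
  - assert (Ev : v = (pS * shift_s v)%ps).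
    { apply ps_ext; intros m k; rewrite pS_mul.
      destruct k as [|k]; [apply Vaxis|reflexivity]. }
    apply (expands_coef rho Hr _ _ _ [(0, 1); (2, 0)]%nat
      (delta / rho) (shift_s v) 1 0); [| | |outside|reflexivity].
    + apply majorized_shift_s; [exact Hr|apply HY].
    + destruct (MS (delta / rho)%R (shift_s v)) as [r [Hr' Hv]];
        [apply majorized_shift_s; [exact Hr|apply HY]|].
      exists r; split; [exact Hr'|]; intros t s Ht Hs' Ht0 Hs0'.
      unfold down_p2, germs; fold v.
      transitivity (eval t s (pS * shift_s v)%ps / s);
        [rewrite <- Ev; reflexivity|rewrite Hv by assumption; field; exact Hs0'].
    + intros t s; change (shift_s v 1%nat 0%nat) with (v 1%nat 1%nat).
      rewrite V11, (alpha1_eq _ _ _ _ _ Hsum).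
      replace (1 - 2 * nu - alpha0 - alpha2 - alphaoo + 2 * nu)
        with (1 - (alphaoo + alpha0 + alpha2)) by ring.
      simpl; field; auto.
Qed.

Lemma solution_q1_p2_polar : exists q1 q2 p1 p2 : C -> C -> C,
  meromorphic_solution alpha0 alpha1 alpha2 alphaoo nu eta q1 q2 p1 p2 /\
  expands_constant q1 (fun t s => / t)
    ((alphaoo + alpha0 - alpha2) / alphaoo) /\
  expands_constant q2 (fun t s => s)
    (alpha2 / alphaoo) /\
  expands_constant p1 (fun t s => t)
    (- (nu + alpha2) * alphaoo / (alphaoo + alpha0 - alpha2)) /\
  expands_constant p2 (fun t s => / s)
    (alphaoo).
Proof.
  assert (Hp : ~ is_int (alphaoo + alpha0 - alpha2)).
  { destruct Hgen as [_ [_ [_ [_ [_ [_ [_ [_ [H _]]]]]]]]].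
    replace (alphaoo + alpha0 - alpha2) with (alpha0 - alpha2 + alphaoo) by ring.
    exact H. }
  destruct (solution_at _ _ _ _ _ _ _ (regular_q1_p2_polar Hp))
    as [Y [rho [delta [Hr [HY [H0 [_ [_ Hsol]]]]]]]].
  exists (down_q1 true (germs Y)), (down_q2 true (germs Y)),
    (down_p1 true (germs Y)), (down_p2 true (germs Y)).
  split; [exact Hsol|clear Hsol].
  name_unknowns Y H0.
  split; [|split; [|split]].
  - expand rho Hr maximal_ideal delta A (HY Q1) 0%nat 0%nat; rewrite A0; ring.
  - expand rho Hr maximal_ideal delta u (HY Q2) 0%nat 0%nat; rewrite U0; ring.
  - expand rho Hr maximal_ideal delta B (HY P1) 0%nat 0%nat; rewrite B0; ring.
  - expand rho Hr maximal_ideal delta v (HY P2) 0%nat 0%nat; rewrite V0; ring.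
Qed.
End Cases.

(** ** The symmetry exchanging the roots of [x ^ 2 - alphaoo * x] *)

(** The Hamiltonians depend on [alphaoo] only through [nu * (nu + alphaoo)]. *)
Lemma meromorphic_solution_sym alpha0 alpha1 alpha2 alphaoo nu eta q1 q2 p1 p2 :
  meromorphic_solution alpha0 alpha1 alpha2 (- alphaoo) (nu + alphaoo) eta
    q1 q2 p1 p2 ->
  meromorphic_solution alpha0 alpha1 alpha2 alphaoo nu eta q1 q2 p1 p2.
Proof.
  assert (E : H1 alpha0 alpha1 alpha2 (- alphaoo) (nu + alphaoo) eta
            = H1 alpha0 alpha1 alpha2 alphaoo nu eta).
  { do 6 (apply functional_extensionality; intro); unfold H1.
    replace (nu + alphaoo + - alphaoo) with nu by ring.
    rewrite (Cmult_comm (nu + alphaoo) nu); reflexivity. }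
  assert (E' : H2 alpha0 alpha1 alpha2 (- alphaoo) (nu + alphaoo) eta
            = H2 alpha0 alpha1 alpha2 alphaoo nu eta).
  { do 6 (apply functional_extensionality; intro); unfold H2.
    replace (nu + alphaoo + - alphaoo) with nu by ring.
    rewrite (Cmult_comm (nu + alphaoo) nu); reflexivity. }
  unfold meromorphic_solution, hamiltonian_system; rewrite E, E'; auto.
Qed.

Lemma sum_sym alpha0 alpha1 alpha2 alphaoo nu :
  alpha0 + alpha1 + alpha2 + alphaoo = 1 - 2 * nu ->
  alpha0 + alpha1 + alpha2 + - alphaoo = 1 - 2 * (nu + alphaoo).
Proof.
  intros H; transitivity (1 - 2 * nu - 2 * alphaoo); [rewrite <- H; ring|ring].
Qed.

Lemma generic_sym alpha0 alpha1 alpha2 alphaoo :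
  generic alpha0 alpha1 alpha2 alphaoo ->
  generic alpha0 alpha1 alpha2 (- alphaoo).
Proof.
  intros [A1 [A2 [A3 [A4 [A5 [A6 [A7 [A8 [A9 A10]]]]]]]]].
  repeat split; first [apply nonint_opp; assumption | match goal with
    | H : ~ is_int ?z |- ~ is_int ?w =>
        replace w with z by ring; exact H
    end].
Qed.

Lemma expands_ext f pref lead lead' gens :
  (forall t s, lead t s = lead' t s) ->
  expands f pref lead gens -> expands f pref lead' gens.
Proof.
  intros E [e [He [r [Hr H]]]]; exists e; split; [exact He|].
  exists r; split; [exact Hr|]; intros t s Ht Hs Ht0 Hs0.
  rewrite <- E; apply H; assumption.
Qed.

Theorem theorem1 (alpha0 alpha1 alpha2 alphaoo nu eta : C)
  (Hsum : alpha0 + alpha1 + alpha2 + alphaoo = 1 - 2 * nu)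
  (Heta : eta <> 0)
  (Hgen : generic alpha0 alpha1 alpha2 alphaoo) :
  (exists q1 q2 p1 p2 : C -> C -> C,
     meromorphic_solution alpha0 alpha1 alpha2 alphaoo nu eta q1 q2 p1 p2 /\
     expands q1 (fun t s => 1)
       (fun t s => eta / alphaoo)
       [mon 1 0; mon 0 1] /\
     expands q2 (fun t s => 1)
       (fun t s => (alphaoo + alpha1) / alphaoo)
       [mon 1 0; mon 0 1] /\
     expands p1 (fun t s => 1)
       (fun t s => - nu * alphaoo * (nu + alpha2)
           / ((alphaoo + alpha1) * (1 - alphaoo - alpha1)) * t * s)
       [mon 3 0; mon 2 1; mon 0 2] /\
     expands p2 (fun t s => 1)
       (fun t s => - nu * alphaoo / (alphaoo + alpha1))
       [mon 1 0; mon 0 1]) /\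
  (exists q1 q2 p1 p2 : C -> C -> C,
     meromorphic_solution alpha0 alpha1 alpha2 alphaoo nu eta q1 q2 p1 p2 /\
     expands q1 (fun t s => 1)
       (fun t s => - eta / alphaoo)
       [mon 1 0; mon 0 1] /\
     expands q2 (fun t s => 1)
       (fun t s => (alphaoo - alpha1) / alphaoo)
       [mon 1 0; mon 0 1] /\
     expands p1 (fun t s => 1)
       (fun t s => - (alphaoo + nu) * alphaoo * (nu + alpha2 + alphaoo)
           / ((alphaoo - alpha1) * (1 + alphaoo - alpha1)) * t * s)
       [mon 3 0; mon 2 1; mon 0 2] /\
     expands p2 (fun t s => 1)
       (fun t s => - (alphaoo + nu) / (alphaoo - alpha1) * alphaoo)
       [mon 1 0; mon 0 1]) /\
  (exists q1 q2 p1 p2 : C -> C -> C,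
     meromorphic_solution alpha0 alpha1 alpha2 alphaoo nu eta q1 q2 p1 p2 /\
     expands q1 (fun t s => 1)
       (fun t s => - eta / alpha1)
       [mon 1 0; mon 0 1] /\
     expands q2 (fun t s => s)
       (fun t s => alpha2 / (alpha0 + alpha2))
       [mon 1 0; mon 0 1] /\
     expands p1 (fun t s => 1)
       (fun t s => nu * (nu + alphaoo) / (1 - alpha1) * t)
       [mon 0 1; mon 2 0] /\
     expands p2 (fun t s => / s)
       (fun t s => nu * (nu + alphaoo) / (1 - alpha0 - alpha2) * s)
       [mon 2 0; mon 1 1; mon 0 2]) /\
  (exists q1 q2 p1 p2 : C -> C -> C,
     meromorphic_solution alpha0 alpha1 alpha2 alphaoo nu eta q1 q2 p1 p2 /\
     expands q1 (fun t s => 1)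
       (fun t s => - eta / alpha1)
       [mon 1 0; mon 0 1] /\
     expands q2 (fun t s => s)
       (fun t s => alpha2 / (alpha2 - alpha0))
       [mon 1 0; mon 0 1] /\
     expands p1 (fun t s => 1)
       (fun t s => (nu + alpha2) * (nu + alpha2 + alphaoo) / (1 - alpha1) * t)
       [mon 0 1; mon 2 0] /\
     expands p2 (fun t s => / s)
       (fun t s => alpha2 - alpha0)
       [mon 1 0; mon 0 1]) /\
  (exists q1 q2 p1 p2 : C -> C -> C,
     meromorphic_solution alpha0 alpha1 alpha2 alphaoo nu eta q1 q2 p1 p2 /\
     expands q1 (fun t s => / t)
       (fun t s => (alphaoo + alpha0 + alpha2) / alphaoo)
       [mon 1 0; mon 0 1] /\
     expands q2 (fun t s => 1)
       (fun t s => - alpha2 / alphaoo * s)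
       [mon 2 0; mon 1 1; mon 0 2] /\
     expands p1 (fun t s => t)
       (fun t s => - nu * alphaoo / (alphaoo + alpha0 + alpha2))
       [mon 1 0; mon 0 1] /\
     expands p2 (fun t s => 1)
       (fun t s => eta * nu * alphaoo * t
           / ((alpha1 + 2 * nu) * (alphaoo + alpha0 + alpha2)))
       [mon 0 1; mon 2 0]) /\
  (exists q1 q2 p1 p2 : C -> C -> C,
     meromorphic_solution alpha0 alpha1 alpha2 alphaoo nu eta q1 q2 p1 p2 /\
     expands q1 (fun t s => / t)
       (fun t s => (alphaoo - alpha0 - alpha2) / alphaoo)
       [mon 1 0; mon 0 1] /\
     expands q2 (fun t s => 1)
       (fun t s => alpha2 / alphaoo * s)
       [mon 2 0; mon 1 1; mon 0 2] /\
     expands p1 (fun t s => t)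
       (fun t s => - (nu + alphaoo) * alphaoo / (alphaoo - alpha0 - alpha2))
       [mon 1 0; mon 0 1] /\
     expands p2 (fun t s => 1)
       (fun t s => eta * alphaoo * (nu + alphaoo) * t
           / ((alphaoo - alpha0 - alpha2) * (1 + alphaoo - alpha0 - alpha2)))
       [mon 0 1; mon 2 0]) /\
  (exists q1 q2 p1 p2 : C -> C -> C,
     meromorphic_solution alpha0 alpha1 alpha2 alphaoo nu eta q1 q2 p1 p2 /\
     expands q1 (fun t s => / t)
       (fun t s => (alphaoo + alpha0 - alpha2) / alphaoo)
       [mon 1 0; mon 0 1] /\
     expands q2 (fun t s => s)
       (fun t s => alpha2 / alphaoo)
       [mon 1 0; mon 0 1] /\
     expands p1 (fun t s => t)
       (fun t s => - (nu + alpha2) * alphaoo / (alphaoo + alpha0 - alpha2))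
       [mon 1 0; mon 0 1] /\
     expands p2 (fun t s => / s)
       (fun t s => alphaoo)
       [mon 1 0; mon 0 1]) /\
  (exists q1 q2 p1 p2 : C -> C -> C,
     meromorphic_solution alpha0 alpha1 alpha2 alphaoo nu eta q1 q2 p1 p2 /\
     expands q1 (fun t s => / t)
       (fun t s => (alphaoo - alpha0 + alpha2) / alphaoo)
       [mon 1 0; mon 0 1] /\
     expands q2 (fun t s => s)
       (fun t s => - alpha2 / alphaoo)
       [mon 1 0; mon 0 1] /\
     expands p1 (fun t s => t)
       (fun t s => - (nu + alpha2 + alphaoo) * alphaoo
           / (alphaoo - alpha0 + alpha2))
       [mon 1 0; mon 0 1] /\
     expands p2 (fun t s => / s)
       (fun t s => - alphaoo)
       [mon 1 0; mon 0 1]).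
Proof.
  pose proof (sum_sym _ _ _ _ _ Hsum) as Hsum'.
  pose proof (generic_sym _ _ _ _ Hgen) as Hgen'.
  destruct Hgen as [Ha1 [Hoo [Hp [Hm [Hs [Hd [Hsp [Hsm [Hdp Hdm]]]]]]]]].
  assert (Hoo0 : alphaoo <> 0) by exact (nonint_neq _ 0 Hoo).
  assert (alphaoo - alpha1 <> 0)
    by (apply (nonint_affine _ _ 0 Hm); right; ring).
  assert (- alphaoo + alpha1 <> 0)
    by (apply (nonint_affine _ _ 0 Hm); left; ring).
  assert (1 + alphaoo - alpha1 <> 0)
    by (apply (nonint_affine _ _ 1 Hm); right; ring).
  assert (alphaoo - alpha0 - alpha2 <> 0)
    by (apply (nonint_affine _ _ 0 Hsm); right; ring).
  assert (- alphaoo + alpha0 + alpha2 <> 0)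
    by (apply (nonint_affine _ _ 0 Hsm); left; ring).
  assert (1 + alphaoo - alpha0 - alpha2 <> 0)
    by (apply (nonint_affine _ _ 1 Hsm); right; ring).
  assert (alphaoo - alpha0 + alpha2 <> 0)
    by (apply (nonint_affine _ _ 0 Hdm); right; ring).
  assert (- alphaoo + alpha0 - alpha2 <> 0)
    by (apply (nonint_affine _ _ 0 Hdm); left; ring).
  pose proof (alpha1_eq _ _ _ _ _ Hsum) as Ea1.
  assert (Hgen : generic alpha0 alpha1 alpha2 alphaoo)
    by (repeat split; assumption).
  split; [exact (solution_holomorphic _ _ _ _ _ _ Hsum Hgen)|].
  split.
  { destruct (solution_holomorphic _ _ _ _ _ eta Hsum' Hgen')
      as [q1 [q2 [p1 [p2 [S [X1 [X2 [X3 X4]]]]]]]].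
    exists q1, q2, p1, p2; split; [apply meromorphic_solution_sym, S|].
    split; [|split; [|split]]; (eapply expands_ext; [|eassumption]);
      intros t s; cbv beta; field; auto. }
  split; [exact (solution_q2_zero _ _ _ _ _ _ Hsum Hgen)|].
  split; [exact (solution_p2_polar _ _ _ _ _ _ Hsum Hgen)|].
  split; [exact (solution_q1_polar _ _ _ _ _ _ Hsum Hgen)|].
  split.
  { destruct (solution_q1_polar _ _ _ _ _ eta Hsum' Hgen')
      as [q1 [q2 [p1 [p2 [S [X1 [X2 [X3 X4]]]]]]]].
    exists q1, q2, p1, p2; split; [apply meromorphic_solution_sym, S|].
    split; [|split; [|split]]; (eapply expands_ext; [|eassumption]);
      intros t s; cbv beta; rewrite ?Ea1; field; auto. }
  split; [exact (solution_q1_p2_polar _ _ _ _ _ _ Hsum Hgen)|].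
  destruct (solution_q1_p2_polar _ _ _ _ _ eta Hsum' Hgen')
    as [q1 [q2 [p1 [p2 [S [X1 [X2 [X3 X4]]]]]]]].
  exists q1, q2, p1, p2; split; [apply meromorphic_solution_sym, S|].
  split; [|split; [|split]]; (eapply expands_ext; [|eassumption]);
    intros t s; cbv beta; field; auto.
Qed.
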